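(* Let $m\ge3$. Then there exist a bounded smooth domain $\Omega\subset\mathbb{R}^m$, a function $u\in C_c^\infty(\Omega)\cap\mathcal{Y}_0(\Omega)$, points $x,y\in\Omega$ with $x\ne y$, and a function $\rho_{\mathrm{AC}}$ belonging to $L^q(\Omega)$ for every $q\in[1,m-1)$, such that: (i) $\overline{xy}$ is a light segment for $u$, and $|Du|<1$ on $\Omega\setminus\overline{xy}$; (ii) for each fixed $\alpha\in(0,\infty)$, $u$ minimizes $I_\rho$ over $\mathcal{Y}_0(\Omega)$ with source $\rho=\alpha(\delta_y-\delta_x)+\rho_{\mathrm{AC}}$, but $u$ is not a weak solution of $(\mathcal{BI})$ with this source and zero boundary datum.
   Context: For a bounded domain $\Omega$, $\mathcal{Y}_0(\Omega)=\{v\in W^{1,\infty}(\Omega):|Dv|\le1\text{ a.e.},\ v=0\text{ on }\partial\Omega\}$. $\delta_z$ is the Dirac delta at $z$. A light segment for $u$ is a closed segment $\overline{xy}$ with $x\neq y$ and $|u(x)-u(y)|=|x-y|$. For $\rho$ a finite signed Borel measure on $\Omega$ (functions $f\in L^1(\Omega)$ are identified with the measures $f\,dx$), $I_\rho(v)=\int_\Omega(1-\sqrt{1-|Dv|^2})\,dx-\int_\Omega v\,d\rho$ for $v\in\mathcal{Y}_0(\Omega)$. A weak solution of $(\mathcal{BI})$ with source $\rho$ and zero boundary datum is $u\in\mathcal{Y}_0(\Omega)$ such that $(1-|Du|^2)^{-1/2}\in L^1_{\mathrm{loc}}(\Omega)$ and $\int_\Omega\frac{Du\cdot D\eta}{\sqrt{1-|Du|^2}}\,dx=\int_\Omega\eta\,d\rho$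 for all Lipschitz $\eta$ with compact support in $\Omega$. *)

(* Defs.v *)
From HB Require Import structures.
From mathcomp Require Import all_boot all_order all_algebra.
From mathcomp Require Import all_classical all_reals all_analysis.
From mathcomp Require Import measurable_realfun.

Set Implicit Arguments.
Unset Strict Implicit.
Unset Printing Implicit Defensive.

Import Order.TTheory GRing.Theory Num.Theory.
Import numFieldNormedType.Exports.

Local Open Scope classical_set_scope.
Local Open Scope ring_scope.

(* R^m is ['rV[R]_m], with its Borel sigma-algebra.  Its topology, bounded sets
   and Lipschitz maps are those of the library's sup norm [`|x|]; lengths and
   gradients are measured with the Euclidean norm [enorm] below. *)
Section borel.
Context {R : realType} (m : nat).

Let borel0 : <<s @open 'rV[R]_m >> set0.
Proof. exact: sigma_algebra0. Qed.

Let borelC A : <<s @open 'rV[R]_m >> A -> <<s @open 'rV[R]_m >> (~` A).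
Proof. exact: sigma_algebraC. Qed.

Let borel_bigcup (F : (set 'rV[R]_m)^nat) :
  (forall i, <<s @open 'rV[R]_m >> (F i)) ->
  <<s @open 'rV[R]_m >> (\bigcup_i F i).
Proof. exact: sigma_algebra_bigcup. Qed.

HB.instance Definition _ := @isMeasurable.Build
  (sigma_display (@open 'rV[R]_m)) 'rV[R]_m <<s @open 'rV[R]_m >>
  borel0 borelC borel_bigcup.

End borel.

Lemma open_measurable_rV (R : realType) (m : nat) (A : set 'rV[R]_m) :
  open A -> measurable A.
Proof. by move=> oA; exact: sub_sigma_algebra. Qed.

Section cons_rV.
Context {R : realType} {n : nat}.

Definition cons_rV (p : measurableTypeR R * 'rV[R]_n) : 'rV[R]_n.+1 :=
  row_mx (const_mx p.1 : 'rV[R]_1) p.2.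

Definition uncons_rV (x : 'rV[R]_n.+1) : measurableTypeR R * 'rV[R]_n :=
  (x ord0 ord0, \row_j x ord0 (lift ord0 j)).

Lemma cons_rV0 p : cons_rV p ord0 ord0 = p.1.
Proof.
have -> : ord0 = lshift n (ord0 : 'I_1) :> 'I_n.+1 by exact/val_inj.
by rewrite [LHS](row_mxEl _ p.2) mxE.
Qed.

Lemma cons_rVS p j : cons_rV p ord0 (lift ord0 j) = p.2 ord0 j.
Proof.
have -> : lift ord0 j = rshift 1 j :> 'I_n.+1 by exact/val_inj.
exact: row_mxEr.
Qed.

Lemma cons_rVK : cancel cons_rV uncons_rV.
Proof.
move=> p; rewrite [RHS]surjective_pairing; congr pair; first exact: cons_rV0.
by apply/rowP => j; rewrite mxE cons_rVS.
Qed.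

Lemma uncons_rVK : cancel uncons_rV cons_rV.
Proof.
move=> x; apply/rowP => i; case: (unliftP ord0 i) => [j|] ->.
  by rewrite cons_rVS mxE.
by rewrite cons_rV0.
Qed.

Lemma preimage_cons_rV_ball (y : 'rV[R]_n.+1) (e : R) :
  cons_rV @^-1` ball y e =
  ball (y ord0 ord0 : R) e `*` ball (uncons_rV y).2 e.
Proof.
apply/seteqP; split=> [p [e0 yp]|p [yp [e0 yp']]].
  split; first by have := yp ord0 ord0; rewrite cons_rV0.
  by split=> // i j; have := yp i (lift ord0 j); rewrite ord1 cons_rVS mxE.
split=> // i j; rewrite ord1; case: (unliftP ord0 j) => [k|] ->.
  by have := yp' ord0 k; rewrite cons_rVS mxE.
by rewrite cons_rV0.
Qed.

Lemma open_rV_bigcup (m : nat) (U : set 'rV[R]_m) : open U ->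
  U = \bigcup_(q : 'rV[rat]_m * nat)
        if `[< ball (map_mx (@ratr R) q.1) q.2.+1%:R^-1 `<=` U >]
        then ball (map_mx (@ratr R) q.1) q.2.+1%:R^-1 else set0.
Proof.
move=> oU; apply/seteqP; split=> [x Ux|x [q _]]; last first.
  by case: asboolP => // + ?; exact.
have /nbhs_ballP[e /= e0 xeU] := open_nbhs_nbhs (conj oU Ux).
have e20 : 0 < e / 2 by exact: divr_gt0.
have [k _ /(_ _ (leqnn k)) /= ke] := near_infty_natSinv_lt (PosNum e20).
have k0 : 0 < k.+1%:R^-1 :> R by rewrite invr_gt0.
have /choice[q qP] : forall j : 'I_m,
    exists q : rat, ball (x ord0 j : R) k.+1%:R^-1 (ratr q).
  move=> j; have B0 : ball (x ord0 j : R) k.+1%:R^-1 !=set0.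
    by exists (x ord0 j); exact: ballxx.
  by have [y [xr [r _ rE]]] := dense_rat B0 (ball_open _ _); exists r; rewrite rE.
have qx : ball (map_mx (@ratr R) (\row_j q j)) k.+1%:R^-1 x.
  by split=> // i j; rewrite !mxE ord1; exact/ball_sym/qP.
exists (\row_j q j, k) => //=; case: asboolP => // -[] y qy; apply: xeU => /=.
rewrite [e]splitr; apply: (@ball_triangle _ _ (map_mx (@ratr R) (\row_j q j))).
  by apply/ball_sym/(le_ball _ qx)/ltW.
by apply/(le_ball _ qy)/ltW.
Qed.

Lemma measurable_cons_rV : measurable_fun setT cons_rV.
Proof.
apply: (measurability (@open 'rV[R]_n.+1)) => // _ [U oU <-]; rewrite setTI.
rewrite (open_rV_bigcup oU) preimage_bigcup.
apply: countable_bigcupT_measurable; first exact: countableP.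
move=> q; case: asboolP => _; last by rewrite preimage_set0.
rewrite preimage_cons_rV_ball; apply: measurableX.
  exact: measurable_ball.
apply: open_measurable_rV; apply: ball_open; by rewrite invr_gt0.
Qed.

Lemma measurable_uncons_rV : measurable_fun setT uncons_rV.
Proof.
apply: measurable_fun_pair.
  apply: (measurability (@RGenOpens.G R)); first exact: RGenOpens.measurableE.
  move=> _ [_ [a [b ->]] <-]; rewrite setTI; apply: open_measurable_rV.
  by apply: open_comp; [move=> x _; exact: coord_continuous|exact: itv_open].
apply: (measurability (@open 'rV[R]_n)) => // _ [U oU <-]; rewrite setTI.
apply: open_measurable_rV; apply: open_comp => // x _ A /= /nbhs_ballP[e /= e0 eA].
apply/nbhs_ballP; exists e => //= y [_ xy]; apply: eA; split=> // i j.
by rewrite !mxE; exact: xy.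
Qed.

End cons_rV.

Section lebesgue_step.
Context {R : realType} {n : nat}.
Variable mu : {sigma_finite_measure set 'rV[R]_n -> \bar R}.

Definition leb_cons : set 'rV[R]_n.+1 -> \bar R :=
  pushforward (@lebesgue_measure R \x mu)%E cons_rV.

Let leb_cons0 : leb_cons set0 = 0%E.
Proof. by rewrite /leb_cons /pushforward preimage_set0 measure0. Qed.

Let leb_cons_ge0 A : (0 <= leb_cons A)%E.
Proof. exact: (measure_ge0 (lebesgue_measure \x mu)%E). Qed.

Let leb_cons_sigma : semi_sigma_additive leb_cons.
Proof.
exact: (@measure_semi_sigma_additive _ _ _
  (measure_function_pushforward__canonical__measure_function_Measure
     (lebesgue_measure \x mu)%E measurable_cons_rV)).
Qed.

HB.instance Definition _ := isMeasure.Build _ _ _ leb_cons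
  leb_cons0 leb_cons_ge0 leb_cons_sigma.

Let leb_cons_sigma_finite : sigma_finite setT leb_cons.
Proof.
have /sigma_finiteP[F [FT ndF Foo]] :=
  sigma_finiteT (@lebesgue_measure R : {sigma_finite_measure set _ -> \bar R}).
have /sigma_finiteP[G [GT ndG Goo]] := sigma_finiteT mu.
exists (fun k => uncons_rV @^-1` (F k `*` G k)) => [|k].
  rewrite -preimage_bigcup; apply/seteqP; split=> // x _.
  have [k _ Fk] : (\bigcup_k F k) (uncons_rV x).1 by rewrite -FT.
  have [l _ Gl] : (\bigcup_k G k) (uncons_rV x).2 by rewrite -GT.
  exists (maxn k l) => //; split.
    by move: Fk; exact/subsetPset/ndF/leq_maxl.
  by move: Gl; exact/subsetPset/ndG/leq_maxr.
have [mF Fk] := Foo k; have [mG Gk] := Goo k.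
split.
  rewrite -[X in measurable X]setTI.
  by apply: measurable_uncons_rV => //; exact: measurableX.
rewrite /leb_cons /pushforward -comp_preimage (_ : _ \o _ = id).
  rewrite preimage_id product_measure1E//.
  by rewrite lte_mul_pinfty// ge0_fin_numE.
by apply/funext => p; exact: cons_rVK.
Qed.

HB.instance Definition _ := Measure_isSigmaFinite.Build _ _ _ leb_cons
  leb_cons_sigma_finite.

End lebesgue_step.

(* m-dimensional Lebesgue measure on the Borel sets: the image of the iterated
   product of [lebesgue_measure] under (t, v) |-> row_mx t v. *)
Fixpoint leb {R : realType} (m : nat) :
    {sigma_finite_measure set 'rV[R]_m -> \bar R} :=
  if m is n.+1 then leb_cons (leb n) else dirac (0 : 'rV[R]_0).

Lemma leb_box (R : realType) (n : nat) (A : set (measurableTypeR R))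
    (B : set 'rV[R]_n) : measurable A -> measurable B ->
  leb n.+1 [set z | A (z ord0 ord0) /\ B (\row_j z ord0 (lift ord0 j))] =
  (lebesgue_measure A * leb n B)%E.
Proof.
move=> mA mB; rewrite /= /leb_cons /pushforward.
rewrite -[X in (_ \x _)%E X]/((uncons_rV \o cons_rV) @^-1` (A `*` B)).
rewrite (_ : _ \o _ = id) ?preimage_id ?product_measure1E//.
by apply/funext => p; exact: cons_rVK.
Qed.

Section euclidean.
Context {R : realType} {m : nat}.
Implicit Types (u v z : 'rV[R]_m) (f : 'rV[R]_m -> R).

Definition dotv u v : R := \sum_(i < m) u ord0 i * v ord0 i.
Definition enorm u : R := Num.sqrt (dotv u u).

Definition segment u v : set 'rV[R]_m :=
  [set z | exists2 t : R, 0 <= t <= 1 & z = (1 - t) *: u + t *: v].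

Definition partial (i : 'I_m) f : 'rV[R]_m -> R :=
  'D_(delta_mx ord0 i : 'rV[R]_m) (f : 'rV[R]_m -> R^o).

Definition grad f z : 'rV[R]_m := \row_i partial i f z.

(* f is C^oo on the open set U: every iterated partial derivative, listed by a
   sequence s of coordinates, exists and is continuous at the points of U. *)
Definition smooth_on (U : set 'rV[R]_m) f : Prop :=
  forall (s : seq 'I_m) z, U z ->
    {for z, continuous (foldr partial f s)} /\
    forall i, derivable (foldr partial f s : 'rV[R]_m -> R^o) z
                        (delta_mx ord0 i).

Definition frontier (A : set 'rV[R]_m) : set 'rV[R]_m :=
  closure A `\` interior A.

(* Near each boundary point, Omega is a strict sublevel set of a C^oo function
   without critical points. *)
Definition smooth_boundary (Omega : set 'rV[R]_m) : Prop :=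
  forall p, frontier Omega p ->
  exists (U : set 'rV[R]_m) (phi : 'rV[R]_m -> R),
    [/\ open_nbhs p U, smooth_on U phi,
        (forall z, U z -> grad phi z != 0) &
        Omega `&` U = [set z | phi z < 0] `&` U].

Definition bounded_domain (Omega : set 'rV[R]_m) : Prop :=
  [/\ Omega !=set0, open Omega, connected Omega & bounded_set Omega].

Definition compact_support_in (Omega : set 'rV[R]_m) f : Prop :=
  compact (closure [set z | f z != 0]) /\
  closure [set z | f z != 0] `<=` Omega.

(* Elements of C_c^oo(Omega) are extended by zero to the whole space. *)
Definition Cc_smooth (Omega : set 'rV[R]_m) f : Prop :=
  smooth_on setT f /\ compact_support_in Omega f.

Definition light_segment f u v : Prop :=
  u <> v /\ `|f u - f v| = enorm (u - v).

End euclidean.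

Section sobolev.
Context {R : realType} {m : nat}.
Variable Omega : set 'rV[R]_m.
Implicit Types (v f eta : 'rV[R]_m -> R) (G : 'rV[R]_m -> 'rV[R]_m).

Definition Lp_on (p : \bar R) f : Prop :=
  measurable_fun Omega f /\ finite_norm (leb m) p (f \_ Omega).

Definition L1loc (f : 'rV[R]_m -> \bar R) : Prop :=
  forall K : set 'rV[R]_m, compact K -> K `<=` Omega ->
    (leb m).-integrable K f.

Definition weak_gradient v G : Prop :=
  (forall i, L1loc (fun z => (G z ord0 i)%:E)) /\
  forall eta, Cc_smooth Omega eta -> forall i,
    \int[leb m]_(z in Omega) (v z * partial i eta z) =
    - \int[leb m]_(z in Omega) (G z ord0 i * eta z).

(* Weak gradients are unique up to a null set; [Dw v] is one of them, and 0 if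
   there is none. *)
Definition Dw v : 'rV[R]_m -> 'rV[R]_m :=
  xget (fun=> 0) [set G | weak_gradient v G].

Definition W1oo v : Prop :=
  Lp_on +oo%E v /\
  exists G, weak_gradient v G /\
            forall i, Lp_on +oo%E (fun z => G z ord0 i).

(* Members of W^{1,oo} are given by their continuous representative, which has
   to extend continuously by 0 to the boundary.  The values of v outside the
   closure of Omega are irrelevant. *)
Definition Y0 v : Prop :=
  [/\ W1oo v,
      {ae leb m, forall z, Omega z -> enorm (Dw v z) <= 1},
      {within closure Omega, continuous v} &
      forall z, frontier Omega z -> v z = 0].

(* Finite signed Borel measures on Omega are charges on the whole space, used
   only through their integrals over Omega. *)
Definition charge_integral (rho : {charge set 'rV[R]_m -> \bar R}) v : R :=
  let PN := cid (Hahn_decomposition rho) in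
  let hPN := svalP (cid (svalP PN)) in
  \int[jordan_pos hPN]_(z in Omega) v z -
  \int[jordan_neg hPN]_(z in Omega) v z.

Definition BI_energy (rho : {charge set 'rV[R]_m -> \bar R}) v : R :=
  \int[leb m]_(z in Omega) (1 - Num.sqrt (1 - enorm (Dw v z) ^+ 2)) -
  charge_integral rho v.

Definition BI_minimizer (rho : {charge set 'rV[R]_m -> \bar R}) v : Prop :=
  Y0 v /\ forall w, Y0 w -> BI_energy rho v <= BI_energy rho w.

(* The inverse in the second clause is that of [\bar R], where 0^-1 = +oo, so
   that this clause forces |Dv| < 1 almost everywhere. *)
Definition BI_weak_solution (rho : {charge set 'rV[R]_m -> \bar R}) v : Prop :=
  [/\ Y0 v,
      L1loc (fun z => (Num.sqrt (1 - enorm (Dw v z) ^+ 2))%:E^-1)%E &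
      forall eta, lipschitz (eta : 'rV[R]_m -> R^o) ->
        compact_support_in Omega eta ->
        \int[leb m]_(z in Omega)
          (dotv (Dw v z) (Dw eta z) / Num.sqrt (1 - enorm (Dw v z) ^+ 2)) =
        charge_integral rho eta].

End sobolev.

Definition dipole_source {R : realType} {m : nat} (alpha : R)
    (x y : 'rV[R]_m) (f : 'rV[R]_m -> R)
    (intf : (leb m).-integrable setT (EFin \o f)) :
    {charge set 'rV[R]_m -> \bar R} :=
  cadd (cscale alpha (cadd (charge_of_finite_measure (dirac y))
                           (copp (charge_of_finite_measure (dirac x)))))
       (induced_charge intf).

(* Main.v *)
From HB Require Import structures.
Require Import Defs.
From mathcomp Require Import all_boot all_order all_algebra.
From mathcomp Require Import all_classical all_reals all_analysis.
From mathcomp Require Import measurable_realfun ess_sup_inf ring lra.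

Set Implicit Arguments.
Unset Strict Implicit.
Unset Printing Implicit Defensive.

Import Order.TTheory GRing.Theory Num.Theory.
Import numFieldNormedType.Exports.

Local Open Scope classical_set_scope.
Local Open Scope ring_scope.

(* Let N = 1 - |Du|^2 ([gap]).  The function u(z) = h(z_0) k(z_1) ... k(z_n) has N = 0
   exactly on the segment [-1, 1] of the first axis, N grows at least
   quadratically away from that axis, and <D^2u Du, Du> = O(N^(1-c)) for every
   c > 0.  Hence
     rho_AC = - div (Du / sqrt N) = - (N^(-1/2) Lap u + N^(-3/2) <D^2u Du, Du>)
   is O(N^(-1/2-c)), which is in L^q for q < n = m - 1 since the segment has
   codimension n.  Replacing N by N + 1/k and letting k go to infinity shows
   that the divergence has no singular part on the segment:
     int Du . Dw / sqrt N = int rho_AC w   for all w in Y_0.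
   By convexity of p |-> 1 - sqrt (1 - |p|^2), this makes the energy of w exceed
   that of u by at least alpha (2 - (w(y) - w(x))), which is nonnegative because
   w is 1-Lipschitz along the segment; testing the weak equation against u would
   give 2 alpha = 0. *)

(** * One-dimensional profiles *)

(** The obstacle is the term N^(-3/2) <D^2u Du, Du>. With a Hessian factor that is merely bounded it
    could grow like N^(-3/2), that is like dist^(-3) from the axis. On the axis itself N = 1 - h'^2
    and the Hessian factor is h'' h'^2, so h has to leave slope 1 in such a way that h'' is bounded
    by (1 - h'^2)^(1-c) for every c > 0. A slope that leaves 1 like t^p yields only the exponent 1 -
    1/p; the flat function e^(-1/t) loses only logarithms. Every other entry of the quadratic form
    contains two transverse factors k', each O(sqrt N). This rests on k'^2 <= delta (1 - k^2) with
    delta small in terms of sup |h| and n: the transverse derivatives then use up at most a quarter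
    of 1 - (k(z_1) ... k(z_n))^2, and N stays comparable with what is left. The same exponents
    decide the dimension: the regularised divergences are dominated by a multiple of N^(-3/4), hence
    of dist^(-3/2), which is integrable because n >= 2. *)

Section flat_exponential.
Context {R : realType}.
Implicit Types (p : {poly R}) (t x c : R).

(** The polynomial in 1/t makes the family closed under differentiation, so that smoothness at 0 to
    all orders follows from a single estimate. *)
Definition flat p t : R := if 0 < t then p.[t^-1] * expR (- t^-1) else 0.

(** Induction on [p], splitting the exponent in two halves: one is for the induction hypothesis, the
    other absorbs the new factor x by 1 + y <= e^y. *)
Lemma horner_le_expR p c : 0 < c ->
  exists2 C : R, 0 <= C & forall x, 0 <= x -> `|p.[x]| <= C * expR (c * x).
Proof.
elim/poly_ind: p c => [|p a IH] c c0.
  by exists 0 => // x x0; rewrite horner0 normr0 mul0r.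
have c20 : 0 < c / 2 by rewrite divr_gt0.
have [C C0 hC] := IH _ c20.
exists (C * (c / 2)^-1 + `|a|) => [|x x0].
  by rewrite addr_ge0// mulr_ge0// invr_ge0 ltW.
rewrite hornerMXaddC (le_trans (ler_normD _ _))// mulrDl lerD//.
  have -> : expR (c * x) = expR (c / 2 * x) * expR (c / 2 * x).
    by rewrite -expRD -mulrDl -splitr.
  rewrite normrM (ger0_norm x0) mulrACA.
  apply: ler_pM => //; first exact: hC.
  rewrite mulrC ler_pdivlMr// mulrC.
  by rewrite (le_trans _ (expR_ge1Dx _))// lerDr.
by rewrite ler_peMr// -expR0 ler_expR mulr_ge0// ltW.
Qed.

Lemma flat_le0 p t : t <= 0 -> flat p t = 0.
Proof. by rewrite /flat; case: ltP. Qed.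

Lemma flat_gt0 p t : 0 < t -> flat p t = p.[t^-1] * expR (- t^-1).
Proof. by rewrite /flat => ->. Qed.

(** The growth bound is applied to p times X^2: the two extra powers of 1/t become the decay t^2,
    more than differentiability at 0 requires. *)
Lemma flat_le_sqr p : exists2 C : R, 0 <= C & forall t, `|flat p t| <= C * t ^+ 2.
Proof.
have [C C0 hC] := horner_le_expR (p * 'X^2) (@ltr01 R).
exists C => // t; case: (ltP 0 t) => t0; last first.
  by rewrite flat_le0// normr0 mulr_ge0// sqr_ge0.
have /hC : 0 <= t^-1 by rewrite invr_ge0 ltW.
rewrite mul1r flat_gt0// hornerM hornerXn normrM (@ger0_norm _ (_ ^+ 2)) ?sqr_ge0//.
rewrite normrM (gtr0_norm (expR_gt0 _)) expRN => h.
rewrite ler_pdivrMr ?expR_gt0//; move: h.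
by rewrite exprVn ler_pdivrMr ?exprn_gt0// mulrAC.
Qed.

Lemma is_derive_flat p t :
  is_derive t (1 : R) (flat p) (flat ('X^2 * (p - p^`())) t).
Proof.
have [t0|t0|->] := ltgtP t 0.
- rewrite flat_le0 ?ltW//; apply: (@near_eq_is_derive _ _ _ (cst 0)).
  by near=> s; rewrite flat_le0// ltW//; near: s; exact: lt_nbhsl.
- apply: (@near_eq_is_derive _ _ _ ((horner p \o GRing.inv) * (expR \o -%R \o GRing.inv))).
    by near=> s; rewrite /= flat_gt0//; near: s; exact: lt_nbhsr.
  have iV : is_derive t (1 : R) (GRing.inv : R -> R) (- t ^- 2).
    have t0' : id t != 0 by rewrite gt_eqF.
    by apply: (is_derive_eq (is_deriveV t0' (is_derive_id t 1))); rewrite [LHS]mulr1.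
  apply: is_derive_eq.
  rewrite flat_gt0//= hornerM hornerXn hornerD hornerN /GRing.scale/= exprVn.
  by rewrite /GRing.scale/=; field; rewrite gt_eqF.
- rewrite (flat_le0 _ (lexx 0)).
  have [C C0 hC] := flat_le_sqr p.
  (* At 0 the slope function takes the value 0, since 0^-1 = 0, and 0 is the derivative to be
     found. *)
  apply/is_derive1_caratheodory; exists (fun z => flat p z / z); split.
  + move=> z; rewrite (flat_le0 _ (lexx 0)) !subr0.
    have [->|z0] := eqVneq z 0; first by rewrite flat_le0 ?mulr0.
    by rewrite divfK.
  + apply/cvgrPdist_le => e e0; rewrite invr0 mulr0.
    near=> z; rewrite sub0r normrN normrM.
    have [->|z0] := eqVneq z 0; first by rewrite invr0 normr0 mulr0 ltW.
    rewrite normfV ler_pdivrMr ?normr_gt0// (le_trans (hC z))//.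
    rewrite -(real_normK (num_real z)) expr2 mulrA ler_pM2r ?normr_gt0//.
    have : `|z| <= e / (C + 1).
      rewrite -[z]subr0 distrC; near: z.
      by apply: cvgr_dist_le => //; rewrite divr_gt0// ltr_wpDl.
    rewrite ler_pdivlMr ?ltr_wpDl// => h; rewrite (le_trans _ h)// mulrC.
    by rewrite ler_wpM2l// lerDl.
  + by rewrite invr0 mulr0.
Unshelve. all: by end_near. Qed.

End flat_exponential.

Section pointwise_derivatives.
Context {R : realType} {V : normedModType R}.
Implicit Types (f g : V -> R) (x v : V) (df dg : R).

(** The rules are put in pointwise form, with products instead of scalings, so that they unify with
    explicit formulas. *)
Lemma is_derive_add f g x v df dg : is_derive x v f df -> is_derive x v g dg ->
  is_derive x v (fun z => f z + g z) (df + dg).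
Proof. by move=> hf hg; exact: (is_deriveD hf hg). Qed.

Lemma is_derive_mul f g x v df dg : is_derive x v f df -> is_derive x v g dg ->
  is_derive x v (fun z => f z * g z) (df * g x + f x * dg).
Proof.
move=> hf hg; apply: (is_derive_eq (is_deriveM hf hg)).
by rewrite /GRing.scale/= addrC mulrC.
Qed.

Lemma is_derive_sqr f x v df : is_derive x v f df ->
  is_derive x v (fun z => f z ^+ 2) (2 * f x * df).
Proof.
move=> hf; rewrite (_ : (fun _ => _) = fun z => f z * f z).
  by apply: is_derive_eq (is_derive_mul hf hf) _; ring.
by apply/funext => z; rewrite expr2.
Qed.

Lemma is_derive_opp f x v df :
  is_derive x v f df -> is_derive x v (fun z => - f z) (- df).
Proof. by move=> hf; exact: is_deriveN. Qed.

Lemma is_derive_sub f g x v df dg : is_derive x v f df -> is_derive x v g dg ->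
  is_derive x v (fun z => f z - g z) (df - dg).
Proof. by move=> hf hg; exact: is_derive_add (is_derive_opp hg). Qed.

Lemma is_derive_const (c : R) x v : is_derive x v (fun=> c) 0.
Proof. exact: is_derive_cst. Qed.

End pointwise_derivatives.

Section elementary.
Context {R : realType}.
Implicit Types (f g : R -> R).

(* A class of C^oo functions closed under derivation, so that smoothness never
   has to be proved for an individual function. *)
Inductive elem : (R -> R) -> Prop :=
| elem_cst c : elem (fun=> c)
| elem_id : elem id
| elem_add f g : elem f -> elem g -> elem (fun t => f t + g t)
| elem_mul f g : elem f -> elem g -> elem (fun t => f t * g t)
| elem_flat p f : elem f -> elem (fun t => flat p (f t)).

Lemma is_derive1_chain f g (t a b : R) :
  is_derive (g t) 1 f a -> is_derive t 1 g b ->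
  is_derive t 1 (fun x => f (g x)) (a * b).
Proof. by move=> hf hg; exact: (is_derive1_comp hf hg). Qed.

Lemma elem_derive f : elem f ->
  elem (derive1 f) /\ forall t : R, is_derive t 1 f (derive1 f t).
Proof.
suff : elem f -> exists2 f', elem f' & forall t : R, is_derive t 1 f (f' t).
  move=> h /h[f' ef' df]; suff -> : derive1 f = f' by [].
  by apply/funext => t; rewrite derive1E; exact: derive_val.
elim=> {f} [c||f g ef [f' ef' df] eg [g' eg' dg]|
            f g ef [f' ef' df] eg [g' eg' dg]|p f ef [f' ef' df]].
- by exists (fun=> 0); [exact: elem_cst|move=> t; exact: is_derive_const].
- by exists (fun=> 1); [exact: elem_cst|move=> t; exact: is_derive_id].
- exists (fun t => f' t + g' t); first exact: elem_add.
  by move=> t; exact: is_derive_add.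
- exists (fun t => f' t * g t + f t * g' t).
    by apply: elem_add; exact: elem_mul.
  by move=> t; exact: is_derive_mul.
- exists (fun t => flat ('X^2 * (p - p^`())) (f t) * f' t).
    by apply: elem_mul => //; exact: elem_flat.
  by move=> t; exact: is_derive1_chain (is_derive_flat _ _) (df t).
Qed.

Lemma elem_derive1 f : elem f -> elem (derive1 f).
Proof. by move=> /elem_derive[]. Qed.

Lemma elem_is_derive f (t : R) : elem f -> is_derive t 1 f (derive1 f t).
Proof. by move=> /elem_derive[]. Qed.

Lemma elem_continuous f : elem f -> continuous f.
Proof.
move=> ef t; apply: differentiable_continuous.
by apply/derivable1_diffP; have [] := elem_is_derive t ef.
Qed.

Lemma elem_comp f g : elem f -> elem g -> elem (fun t => f (g t)).
Proof.
move=> + eg; elim=> {f} [c||f1 f2 _ e1 _ e2|f1 f2 _ e1 _ e2|p f _ ef].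
- exact: elem_cst.
- exact: eg.
- exact: elem_add.
- exact: elem_mul.
- exact: elem_flat.
Qed.

Lemma elem_sub f g : elem f -> elem g -> elem (fun t => f t - g t).
Proof.
move=> ef eg; rewrite (_ : (fun _ => _) = fun t => f t + (-1) * g t).
  by apply: elem_add => //; apply: elem_mul => //; exact: elem_cst.
by apply/funext => t; rewrite mulN1r.
Qed.

Lemma elem_sqr f : elem f -> elem (fun t => f t ^+ 2).
Proof.
move=> ef; rewrite (_ : (fun _ => _) = fun t => f t * f t); first exact: elem_mul.
by apply/funext => t; rewrite expr2.
Qed.

Lemma derive1_eq f g : (forall t : R, is_derive t 1 f (g t)) -> derive1 f = g.
Proof. by move=> fg; apply/funext => t; rewrite derive1E; exact: derive_val. Qed.

(** The complement of [a, b] is open, so there [f] is locally the zero function. *)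
Lemma elem_derive1_out f a b : elem f -> (forall t, ~~ (a <= t <= b) -> f t = 0) ->
  forall t, ~~ (a <= t <= b) -> derive1 f t = 0.
Proof.
move=> ef f0 t tab; rewrite derive1E (@near_eq_derive _ _ _ f (cst 0)); last first.
  move: tab; rewrite negb_and -!ltNge => /orP[h|h]; near=> s; apply: f0.
    rewrite negb_and -ltNge; apply/orP; left.
    by near: s; exact: lt_nbhsl.
  rewrite negb_and -!ltNge; apply/orP; right.
  by near: s; exact: lt_nbhsr.
exact: derive_cst.
Unshelve. all: by end_near. Qed.

Lemma bounded_of_compact_support f (a b : R) : continuous f ->
  (forall t, ~~ (a <= t <= b) -> f t = 0) -> exists2 M, 0 <= M & forall t, `|f t| <= M.
Proof.
move=> cf f0; case: (leP a b) => [ab|ba]; last first.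
  exists 0 => // t; rewrite f0 ?normr0//; apply/negP => /andP[h1 h2].
  by have := lt_le_trans ba (le_trans h1 h2); rewrite ltxx.
have [c _ hc] : exists2 c, c \in `[a, b] & forall t, t \in `[a, b] -> `|f t| <= `|f c|.
  apply: (@EVT_max R (fun t => `|f t|) a b ab).
  by apply: continuous_subspaceT => x; apply: continuous_comp; [exact: cf|exact: norm_continuous].
exists `|f c| => // t; case: (boolP (a <= t <= b)) => h; first by apply: hc; rewrite in_itv.
by rewrite f0// normr0.
Qed.

End elementary.

(** * Steps, bumps and the two profiles *)

Section profiles.
Context {R : realType}.
Implicit Types (s t x c : R).

(** The function e^(-1/t), followed by its first and second derivatives (see [dE] and [dE1]). *)
Let E : R -> R := flat 1.
Let E1 : R -> R := flat 'X^2.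
Let E2 : R -> R := flat ('X^2 * ('X^2 - 'X *+ 2)).

Let EE t : 0 < t -> E t = expR (- t^-1).
Proof. by move=> t0; rewrite /E flat_gt0// hornerC mul1r. Qed.

Let E1E t : 0 < t -> E1 t = t^-1 ^+ 2 * expR (- t^-1).
Proof. by move=> t0; rewrite /E1 flat_gt0// hornerXn. Qed.

Let E2E t : 0 < t -> E2 t = t^-1 ^+ 2 * (t^-1 ^+ 2 - 2 * t^-1) * expR (- t^-1).
Proof.
move=> t0; rewrite /E2 flat_gt0// hornerM hornerXn hornerD hornerN hornerMn hornerXn hornerX.
by rewrite mulr_natl.
Qed.

Let dE t : is_derive t (1:R) E (E1 t).
Proof.
have := is_derive_flat (1 : {poly R}) t.
by rewrite derivC subr0 mulr1.
Qed.

Let dE1 t : is_derive t (1:R) E1 (E2 t).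
Proof.
have := is_derive_flat ('X^2 : {poly R}) t.
by rewrite derivXn expr1.
Qed.

Let E_ge0 t : 0 <= E t.
Proof.
case: (ltP 0 t) => t0; first by rewrite EE// expR_ge0.
by rewrite /E flat_le0.
Qed.

Let E1_ge0 t : 0 <= E1 t.
Proof.
case: (ltP 0 t) => t0; first by rewrite E1E// mulr_ge0// ?sqr_ge0// expR_ge0.
by rewrite /E1 flat_le0.
Qed.

Let elem_E f : elem f -> elem (fun t => E (f t)).
Proof. exact: elem_flat. Qed.

Let e : R := expR 1.
Let e_gt0 : 0 < e. Proof. exact: expR_gt0. Qed.

Let E_one : e * E 1 = 1.
Proof. by rewrite EE// invr1 /e -expRD subrr expR0. Qed.

Let E_homo s t : s <= t -> E s <= E t.
Proof.
move=> st; case: (ltP 0 s) => s0; last by rewrite {1}/E flat_le0.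
have t0 := lt_le_trans s0 st.
by rewrite !EE// ler_expR lerN2 lef_pV2// posrE.
Qed.

(** Nesting the flat exponential in itself gives a transition that is exactly 0 before 0 and exactly
    1 after 1. The usual quotient construction would leave the class [elem], which has no
    division. *)
Definition step t : R := 1 - e * E (1 - e * E t).

Lemma elem_step : elem step.
Proof.
rewrite /step; apply: elem_sub; first exact: elem_cst.
apply: elem_mul; first exact: elem_cst.
apply: elem_E; apply: elem_sub; first exact: elem_cst.
apply: elem_mul; first exact: elem_cst.
by apply: elem_E; exact: elem_id.
Qed.

Lemma step_le0 t : t <= 0 -> step t = 0.
Proof. by move=> t0; rewrite /step [E t]flat_le0// mulr0 subr0 E_one subrr. Qed.

Lemma step_ge1 t : 1 <= t -> step t = 1.
Proof.
move=> t1; rewrite /step /E [flat 1 (1 - _)]flat_le0 ?mulr0 ?subr0//.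
by rewrite subr_le0 -[leLHS]E_one ler_pM2l// E_homo.
Qed.

Lemma step_ge0 t : 0 <= step t.
Proof.
rewrite /step subr_ge0 -[leRHS]E_one ler_pM2l// E_homo//.
by rewrite gerBl mulr_ge0// ltW.
Qed.

Lemma step_le1 t : step t <= 1.
Proof. by rewrite /step gerBl mulr_ge0// ltW. Qed.

Lemma step_derive_ge0 t : 0 <= derive1 step t.
Proof.
have h (x : R) : is_derive x (1:R) step (e * E1 (1 - e * E x) * (e * E1 x)).
  rewrite /step.
  apply: is_derive_eq.
    apply: is_derive_add (is_derive_const _ _ _) _.
    apply: is_deriveN.
    apply: is_derive_mul (is_derive_const _ _ _) _.
    apply: is_derive1_chain (dE _) _.
    apply: is_derive_add (is_derive_const _ _ _) _.
    apply: is_deriveN.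
    apply: is_derive_mul (is_derive_const _ _ _) (dE _).
  by rewrite /=; ring.
by rewrite (derive1_eq h) !mulr_ge0// ltW.
Qed.

Lemma derive1_locally_const (f : R -> R) c t :
  (\near t, f t = c) -> derive1 f t = 0.
Proof.
by move=> h; rewrite derive1E (@near_eq_derive _ _ _ f (cst c)) ?derive_cst.
Qed.

Lemma step_derive_lt0 t : t < 0 -> derive1 step t = 0.
Proof.
move=> t0; apply: (derive1_locally_const (c := 0)); near=> s; apply: step_le0.
by apply: ltW; near: s; exact: lt_nbhsl.
Unshelve. all: by end_near. Qed.

Lemma step_derive_gt1 t : 1 < t -> derive1 step t = 0.
Proof.
move=> t0; apply: (@derive1_locally_const _ 1); near=> s; apply: step_ge1.
by apply: ltW; near: s; exact: lt_nbhsr.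
Unshelve. all: by end_near. Qed.

Lemma step_derive_bounded : exists2 M, 0 <= M & forall t, derive1 step t <= M.
Proof.
have [M M0 hM] : exists2 M, 0 <= M & forall t : R, `|derive1 step t| <= M.
  apply: (@bounded_of_compact_support _ _ 0 1).
    exact/elem_continuous/elem_derive1/elem_step.
  move=> t; rewrite negb_and -!ltNge => /orP[]; first exact: step_derive_lt0.
  exact: step_derive_gt1.
by exists M => // t; rewrite (le_trans (ler_norm _)).
Qed.

Definition bump t : R := e * E (1 - t ^+ 2).

Lemma elem_bump : elem bump.
Proof.
rewrite /bump; apply: elem_mul; first exact: elem_cst.
apply: elem_E; apply: elem_sub; first exact: elem_cst.
by apply: elem_sqr; exact: elem_id.
Qed.

Lemma bump0 : bump 0 = 1.
Proof. by rewrite /bump expr0n subr0 E_one. Qed.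

Lemma bump_out t : 1 <= `|t| -> bump t = 0.
Proof.
move=> t1; rewrite /bump /E flat_le0 ?mulr0// subr_le0.
by rewrite -[t ^+ 2]real_normK ?num_real// -(expr1n _ 2) ler_pXn2r// nnegrE.
Qed.

Lemma bump_ge0 t : 0 <= bump t.
Proof. by rewrite mulr_ge0// ltW. Qed.

(** With y = t^2 < 1 the bump is e^(-y/(1-y)). Its inverse is at least 1 + y/(1-y) >= 1 + y, and
    1/(1+y) <= 1 - y/2 on [0, 1]. *)
Lemma bump_le t : `|t| <= 1 -> bump t <= 1 - t ^+ 2 / 2.
Proof.
rewrite -(@ler_pXn2r _ 2)// ?nnegrE// real_normK ?num_real// expr1n.
rewrite le_eqVlt => /predU1P[t1|t1].
  by rewrite /bump t1 subrr /E flat_le0// mulr0 subr_ge0 ler_pdivrMr// mul1r ler1n.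
have t2 := sqr_ge0 t.
rewrite /bump EE ?subr_gt0// /e -expRD.
set y := t ^+ 2 in t1 t2 *.
have y1 : 0 < 1 - y by rewrite subr_gt0.
have -> : 1 + - (1 - y)^-1 = - (y / (1 - y)) by field; rewrite gt_eqF.
rewrite expRN.
have h : 1 + y <= expR (y / (1 - y)).
  apply: le_trans (expR_ge1Dx _); rewrite lerD2l ler_pdivlMr//; nra.
have h0 : 0 < 1 + y by lra.
rewrite (@le_trans _ _ (1 + y)^-1)//; first by rewrite lef_pV2// posrE ?expR_gt0.
rewrite -[leLHS]mul1r ler_pdivrMr//; nra.
Qed.

Lemma bump_le1 t : bump t <= 1.
Proof.
case: (leP `|t| 1) => t1; last by rewrite bump_out// ltW.
by rewrite (le_trans (bump_le t1))// gerBl divr_ge0// sqr_ge0.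
Qed.

(** Both sides vanish to second order at the maximum: the derivative is -2 t e E1(1 - t^2) with 0 <=
    E1 <= 2, while 1 - bump^2 >= 1 - bump >= t^2/2. This gives 16 e^2 t^2 against t^2/2, hence the
    constant 32 e^2. *)
Lemma bump_derive_sqr_le : exists2 C, 0 <= C &
  forall t, derive1 bump t ^+ 2 <= C * (1 - bump t ^+ 2).
Proof.
have h (x : R) : is_derive x (1:R) bump (- (2 * x) * (e * E1 (1 - x ^+ 2))).
  have h1 : is_derive x (1:R) (fun z : R => 1 - z ^+ 2) (- (2 * x)).
    apply: (is_derive_eq (is_derive_sub (is_derive_const _ _ _)
      (is_derive_sqr (is_derive_id _ _)))).
    by rewrite /=; ring.
  apply: (is_derive_eq
    (is_derive_mul (is_derive_const _ _ _) (is_derive1_chain (dE _) h1))).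
  by rewrite /=; ring.
exists (32 * e ^+ 2) => [|t]; first by rewrite mulr_ge0// sqr_ge0.
rewrite (derive1_eq h).
case: (ltP `|t| 1) => t1; last first.
  have t2 : 1 - t ^+ 2 <= 0.
    by rewrite subr_le0 -[t ^+ 2]real_normK ?num_real// -(expr1n _ 2) ler_pXn2r// nnegrE.
  rewrite /E1 flat_le0// !mulr0 bump_out// expr0n subr0 mulr1.
  by rewrite mulr_ge0// sqr_ge0.
have t2 : 0 < 1 - t ^+ 2.
  by rewrite subr_gt0 -[t ^+ 2]real_normK ?num_real// -[ltRHS](expr1n _ 2) ltr_pXn2r// nnegrE.
(* Here [E1] is w^2 e^(-w) with w = 1/(1 - t^2), and e^w >= 1 + w^2/2. *)
have E12 : E1 (1 - t ^+ 2) <= 2.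
  rewrite E1E//; set w := _^-1; rewrite expRN ler_pdivrMr ?expR_gt0//.
  have : 0 <= w by rewrite invr_ge0 ltW.
  by move=> /(@expR_ge1Dxn _ _ 1%N); rewrite (_ : 2`!%:R = 2 :> R)//; lra.
have b1 := bump_le (ltW t1).
have b0 := bump_ge0 t.
have : bump t ^+ 2 <= bump t by rewrite expr2 ler_piMr// bump_le1.
move=> b2.
have e12 : E1 (1 - t ^+ 2) ^+ 2 <= 4.
  by rewrite (_ : 4 = 2 ^+ 2) ?ler_pXn2r ?nnegrE//; ring.
have -> : (- (2 * t) * (e * E1 (1 - t ^+ 2))) ^+ 2 =
    e ^+ 2 * (4 * t ^+ 2 * E1 (1 - t ^+ 2) ^+ 2) by ring.
rewrite [32 * _]mulrC -[leRHS]mulrA ler_wpM2l ?sqr_ge0//.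
rewrite (@le_trans _ _ (4 * t ^+ 2 * 4))//; last by lra.
by rewrite ler_wpM2l// mulr_ge0// sqr_ge0.
Qed.

(** Rescaling the argument of the bump by [a] multiplies the constant of [bump_derive_sqr_le] by
    a^2, so every [delta] can be reached. *)
Lemma transverse_profile (delta : R) : 0 < delta -> exists k : R -> R,
  [/\ elem k, k 0 = 1 /\ (forall t, 0 <= k t <= 1),
      (exists S, forall t, S <= `|t| -> k t = 0),
      (forall t, derive1 k t ^+ 2 <= delta * (1 - k t ^+ 2)) &
      forall T, exists2 c, 0 < c & forall t, `|t| <= T -> c * t ^+ 2 <= 1 - k t ^+ 2].
Proof.
move=> d0; have [C C0 hC] := bump_derive_sqr_le.
pose a := Num.sqrt (delta / (C + 1)).
have C1 : 0 < C + 1 by rewrite ltr_wpDl.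
have a0 : 0 < a by rewrite sqrtr_gt0 divr_gt0.
have a2 : a ^+ 2 = delta / (C + 1) by rewrite sqr_sqrtr// divr_ge0// ltW.
exists (fun t => bump (a * t)); split.
- apply: elem_comp; first exact: elem_bump.
  by apply: elem_mul; [exact: elem_cst|exact: elem_id].
- split=> [|t]; first by rewrite mulr0 bump0.
  by rewrite bump_ge0 bump_le1.
- exists a^-1 => t ta; rewrite bump_out// normrM (gtr0_norm a0).
  by rewrite -(mulfV (lt0r_neq0 a0)) ler_pM2l.
- move=> t.
  have -> : derive1 (fun t => bump (a * t)) t = derive1 bump (a * t) * a.
    rewrite derive1E; apply: derive_val.
    apply: is_derive1_chain; first exact: elem_is_derive elem_bump.
    apply: (is_derive_eq (is_derive_mul (is_derive_const _ _ _) (is_derive_id _ _))).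
    by rewrite /=; ring.
  rewrite exprMn a2 mulrA ler_pdivrMr// [leLHS]mulrC -mulrA ler_pM2l//.
  apply: (le_trans (hC _)); rewrite mulrC ler_wpM2l ?lerDl//.
  by rewrite subr_ge0 expr_le1// ?bump_ge0 ?bump_le1.
(* The first term serves on the support of the bump, by [bump_le]; the second serves outside, where
   the right-hand side is 1 and t^2 <= T^2. *)
- move=> T; exists (Num.min (a ^+ 2 / 2) (T ^+ 2 + 1)^-1).
    rewrite lt_min divr_gt0 ?exprn_gt0//= invr_gt0.
    by rewrite ltr_wpDl// sqr_ge0.
  move=> t tT; case: (leP `|a * t| 1) => at1.
    have b1 := bump_le at1; have b0 := bump_ge0 (a * t).
    have : bump (a * t) ^+ 2 <= bump (a * t) by rewrite expr2 ler_piMr// bump_le1.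
    have : Num.min (a ^+ 2 / 2) (T ^+ 2 + 1)^-1 * t ^+ 2 <= a ^+ 2 / 2 * t ^+ 2.
      by rewrite ler_wpM2r ?sqr_ge0// ge_min lexx.
    by move: b1; rewrite exprMn; lra.
  rewrite bump_out ?(ltW at1)// expr0n subr0.
  apply: (@le_trans _ _ ((T ^+ 2 + 1)^-1 * t ^+ 2)).
    by rewrite ler_wpM2r ?sqr_ge0// ge_min lexx orbT.
  have T2 := sqr_ge0 T.
  rewrite mulrC ler_pdivrMr ?mul1r; last by rewrite ltr_wpDl.
  rewrite -(real_normK (num_real t)) (@le_trans _ _ (T ^+ 2)) ?lerDl//.
  by rewrite ler_pXn2r// nnegrE// (le_trans _ tT).
Qed.

(** The maximum is 4/e, attained at t = 1. It is reached by squaring (1+t)/2 <= e^((t-1)/2), and e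
    >= (3/2)^2 makes it at most 16/9. What matters is a bound below 2: it keeps the slope 1 -
    (1+w)^2 e^(-w) of [g0] away from -1. *)
Lemma sqr1Dx_expRN_le t : 0 <= t -> (1 + t) ^+ 2 * expR (- t) <= 9 / 5.
Proof.
move=> t0; rewrite expRN ler_pdivrMr ?expR_gt0//.
have h : (1 + t) / 2 <= expR ((t - 1) / 2).
  by apply: le_trans (expR_ge1Dx _); lra.
have h2 : ((1 + t) / 2) ^+ 2 <= expR (t - 1).
  rewrite (_ : expR (t - 1) = expR ((t - 1) / 2) ^+ 2).
    by rewrite ler_pXn2r ?nnegrE ?expR_ge0//; lra.
  by rewrite expr2 -expRD -splitr.
have e94 : 9 / 4 <= expR 1 :> R.
  have -> : expR 1 = expR 2^-1 * expR 2^-1 :> R.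
    by rewrite -expRD; congr expR; lra.
  by have := expR_ge1Dx (2^-1 : R); nra.
rewrite expRB ler_pdivlMr ?expR_gt0// in h2.
have := sqr_ge0 (1 + t); nra.
Qed.

(* For |s| > 1 and w = 2 / (s^2 - 1), the derivative of [g0] is
   1 - (1 + w)^2 e^(-w): its distance to 1 is at least e^(-w), while its second
   derivative is e^(-w) times a polynomial in s and w, hence is absorbed by any
   power of e^(-w) below 1. *)
Let g0 s := s * (1 - E ((s ^+ 2 - 1) / 2)).
Let g1 s := 1 - E ((s ^+ 2 - 1) / 2) - s ^+ 2 * E1 ((s ^+ 2 - 1) / 2).
Let g2 s := - (3 * s * E1 ((s ^+ 2 - 1) / 2) + s ^+ 3 * E2 ((s ^+ 2 - 1) / 2)).

Let d_arg s : is_derive s (1:R) (fun z => (z ^+ 2 - 1) / 2) s.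
Proof.
apply: (is_derive_eq (is_derive_mul (is_derive_sub (is_derive_sqr (is_derive_id _ _))
  (is_derive_const _ _ _)) (is_derive_const _ _ _))).
by rewrite /=; field.
Qed.

Let dg0 s : is_derive s (1:R) g0 (g1 s).
Proof.
apply: (is_derive_eq (is_derive_mul (is_derive_id _ _) (is_derive_sub
  (is_derive_const _ _ _) (is_derive1_chain (dE _) (d_arg s))))).
by rewrite /= /g1; ring.
Qed.

Let dg1 s : is_derive s (1:R) g1 (g2 s).
Proof.
apply: (is_derive_eq (is_derive_sub (is_derive_sub (is_derive_const _ _ _)
  (is_derive1_chain (dE _) (d_arg s)))
  (is_derive_mul (is_derive_sqr (is_derive_id _ _))
     (is_derive1_chain (dE1 _) (d_arg s))))).
by rewrite /= /g2; ring.
Qed.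

Let elem_g0 : elem g0.
Proof.
apply: elem_mul; first exact: elem_id.
apply: elem_sub; first exact: elem_cst.
apply: elem_E; apply: elem_mul; last exact: elem_cst.
apply: elem_sub; last exact: elem_cst.
by apply: elem_sqr; exact: elem_id.
Qed.

Let g_in s : `|s| <= 1 -> [/\ g0 s = s, g1 s = 1 & g2 s = 0].
Proof.
move=> s1; have s2 : (s ^+ 2 - 1) / 2 <= 0.
  rewrite pmulr_lle0 ?invr_gt0// subr_le0 -[s ^+ 2]real_normK ?num_real//.
  by rewrite -[leRHS](expr1n _ 2) ler_pXn2r// nnegrE.
rewrite /g0 /g1 /g2 /E /E1 /E2 !flat_le0// !mulr0 !subr0 mulr1.
by rewrite addr0 oppr0.
Qed.

Let wE s : 1 < `|s| -> 0 < (s ^+ 2 - 1) / 2.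
Proof.
move=> s1; rewrite divr_gt0// subr_gt0 -[s ^+ 2]real_normK ?num_real//.
by rewrite -[ltLHS](expr1n _ 2) ltr_pXn2r// nnegrE.
Qed.

Let g_out s : 1 < `|s| -> let w := ((s ^+ 2 - 1) / 2)^-1 in
  [/\ 0 < w, g0 s = s * (1 - expR (- w)), g1 s = 1 - (1 + w) ^+ 2 * expR (- w) &
      g2 s = s * (w ^+ 2 * (1 - w ^+ 2)) * expR (- w)].
Proof.
move=> /wE; set t := (s ^+ 2 - 1) / 2 => t0 w.
have w0 : 0 < w by rewrite invr_gt0.
have s2 : s ^+ 2 = 1 + 2 / w.
  by rewrite /w invrK /t; field.
rewrite /g0 /g1 /g2 -/t EE// E1E// E2E// -/w (exprS s 2) s2; split=> //.
  by field; rewrite gt_eqF.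
by field; rewrite gt_eqF.
Qed.

Let g1_lt s : 1 < `|s| -> - (4 / 5) <= g1 s < 1.
Proof.
move=> /g_out; set w := _^-1 => -[w0 _ -> _].
have := sqr1Dx_expRN_le (ltW w0).
have : 0 < (1 + w) ^+ 2 * expR (- w).
  by rewrite mulr_gt0// ?expR_gt0// exprn_gt0// addr_gt0.
by move=> ? ?; apply/andP; split; lra.
Qed.

(** Far out w is about 2/s^2 and [g0] about s w, so that [g0] is bounded with small slope: there is
    room for a cut-off without bringing the slope back to 1. *)
Let g_far s : 3 <= `|s| -> `|g0 s| <= 1 /\ `|g1 s| <= 1 / 2.
Proof.
move=> s3; have s1 : 1 < `|s| by lra.
have := g_out s1; set w := _^-1 => -[w0 -> -> _].
have s2 : s ^+ 2 = `|s| ^+ 2 by rewrite real_normK ?num_real.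
have ws : w * (`|s| ^+ 2 - 1) = 2.
  rewrite /w -s2; field; rewrite s2.
  by rewrite gt_eqF//; nra.
have w12 : w <= 1 / 4.
  have : w * 8 <= w * (`|s| ^+ 2 - 1) by rewrite (ler_wpM2l (ltW w0))//; nra.
  by rewrite ws; lra.
have e1 : 1 - w <= expR (- w) by apply: le_trans (expR_ge1Dx _).
have e2 : expR (- w) * (1 + w) <= 1.
  by rewrite expRN mulrC ler_pdivrMr ?expR_gt0// mul1r expR_ge1Dx.
have e0 := expR_gt0 (- w).
split.
  rewrite normrM (@ger0_norm _ (1 - _)); last by nra.
  have : `|s| * w <= 1 by nra.
  by apply: le_trans; rewrite ler_wpM2l//; lra.
rewrite ler_norml; apply/andP; split; nra.
Qed.

(** [h] is [g0] times a cut-off located where the slope of [g0] is at most 1/2. The product rule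
    adds at most 1/4 there, so the slope comes near 1 in absolute value only where [h] and [g0]
    agree. *)
Lemma axial_profile : exists h : R -> R,
  [/\ elem h, (forall s, `|s| <= 1 -> h s = s),
      (exists S, forall s, S <= `|s| -> h s = 0),
      (forall s, `|derive1 h s| <= 1 ?= iff (`|s| <= 1)) &
      forall c, 0 < c < 1 -> exists2 C, 0 <= C & forall s,
        `|derive1 (derive1 h) s| <= C * (1 - derive1 h s ^+ 2) `^ (1 - c)].
Proof.
have [M M0 hM] := step_derive_bounded.
(* With d M <= 1/16 the derivative of the cut-off stays below 1/4; with d <= 1/16 the cut-off acts
   only for |s| >= 3, where [g_far] applies. *)
pose d : R := (16 * (M + 1))^-1.
have M1 : 0 < 16 * (M + 1) by rewrite mulr_gt0// ltr_wpDl.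
have d0 : 0 < d by rewrite invr_gt0.
have dM : d * M <= 1 / 16.
  by rewrite /d mulrC ler_pdivrMr//; lra.
have d16 : d <= 1 / 16.
  by rewrite /d -div1r ler_pdivrMr//; lra.
(* Equal to 1 for |d s| <= 1 and to 0 for |d s| >= 2; the square replaces an absolute value, which
   is not smooth. *)
pose cut s := step (2 - (d * s) ^+ 2).
pose cut1 s := - (2 * d * (d * s)) * derive1 step (2 - (d * s) ^+ 2).
have dcut s : is_derive s (1:R) cut (cut1 s).
  have dds : is_derive s (1:R) (fun z => d * z) d.
    apply: (is_derive_eq (is_derive_mul (is_derive_const _ _ _) (is_derive_id _ _))).
    by rewrite /=; ring.
  have d2 := is_derive_sub (is_derive_const 2 s 1) (is_derive_sqr dds).
  apply: (is_derive_eq (is_derive1_chain (elem_is_derive _ elem_step) d2)).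
  by rewrite /= /cut1; ring.
have elem_ds : elem (fun s => 2 - (d * s) ^+ 2).
  apply: elem_sub; first exact: elem_cst.
  by apply: elem_sqr; apply: elem_mul; [exact: elem_cst|exact: elem_id].
have ecut : elem cut by exact: elem_comp elem_step elem_ds.
have ecut1 : elem cut1 by rewrite -(derive1_eq dcut); exact: elem_derive1.
pose cut2 := derive1 cut1.
pose h s := g0 s * cut s.
have eh : elem h by exact: elem_mul.
have dh : derive1 h = fun s => g1 s * cut s + g0 s * cut1 s.
  by apply: derive1_eq => s; exact: is_derive_mul.
have ddh : derive1 (derive1 h) =
    fun s => g2 s * cut s + 2 * g1 s * cut1 s + g0 s * cut2 s.
  rewrite dh; apply: derive1_eq => s.
  apply: (is_derive_eq (is_derive_add (is_derive_mul (dg1 s) (dcut s))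
    (is_derive_mul (dg0 s) (elem_is_derive s ecut1)))).
  by rewrite -/cut2; ring.
have sq t : t ^+ 2 = `|t| ^+ 2 by rewrite real_normK ?num_real.
have near_in s : `|d * s| < 1 -> \near s, `|d * s| < 1.
  have c : continuous (fun s => `|d * s|).
    move=> x; apply: (@continuous_comp _ _ _ (fun s => d * s)).
      exact/elem_continuous/elem_mul/elem_id/elem_cst.
    exact: norm_continuous.
  by move=> ds; exact: (c s _ (lt_nbhsl ds)).
have cut_in s : `|d * s| < 1 -> cut s = 1.
  by move=> ds; rewrite /cut step_ge1// sq; have := normr_ge0 (d * s); nra.
have cut1_in s : `|d * s| < 1 -> cut1 s = 0.
  move=> ds; rewrite /cut1 step_derive_gt1 ?mulr0// sq.
  by have := normr_ge0 (d * s); nra.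
have cut2_in s : `|d * s| < 1 -> cut2 s = 0.
  move=> /near_in ds; apply: (derive1_locally_const (c := 0)).
  by near=> z; apply: cut1_in; near: z.
have cut_out s : 2 <= `|d * s| -> cut s = 0.
  by move=> ds; rewrite /cut step_le0// sq; nra.
have cut1_le s : `|cut1 s| <= 1 / 4.
  rewrite /cut1; case: (leP `|d * s| 2) => ds; last first.
    by rewrite step_derive_lt0 ?mulr0 ?normr0// sq; nra.
  have st0 := step_derive_ge0 (2 - (d * s) ^+ 2).
  have st1 := hM (2 - (d * s) ^+ 2).
  rewrite normrM normrN !normrM (ger0_norm st0) (gtr0_norm d0) normr_nat.
  rewrite normrM (gtr0_norm d0) in ds.
  apply: (@le_trans _ _ (4 * d * M)); last by lra.
  apply: ler_pM => //; last by nra.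
  by rewrite !mulr_ge0// ltW.
have far s : 1 <= `|d * s| -> 3 <= `|s|.
  by rewrite normrM (gtr0_norm d0); nra.
have cut01 s : 0 <= cut s <= 1 by rewrite step_ge0 step_le1.
have dh_far s : 1 <= `|d * s| -> `|derive1 h s| <= 3 / 4.
  move=> /far /g_far[h0 h1]; rewrite dh (le_trans (ler_normD _ _))//.
  rewrite (normrM (g1 s)) (normrM (g0 s)).
  have := cut1_le s; have /andP[c0 c1] := cut01 s; rewrite (ger0_norm c0).
  have : `|g1 s| * cut s <= 1 / 2 * 1 by exact: ler_pM.
  have : `|g0 s| * `|cut1 s| <= 1 * (1 / 4) by exact: ler_pM.
  by lra.
have [M2 M20 hM2] : exists2 M, 0 <= M & forall t : R, `|derive1 (derive1 h) t| <= M.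
  apply: (@bounded_of_compact_support _ _ (- (2 / d)) (2 / d)).
    by apply/elem_continuous/elem_derive1/elem_derive1.
  move=> t; apply: elem_derive1_out; first exact: elem_derive1.
  move=> {}t; apply: elem_derive1_out => // {}t.
  rewrite -ler_norml -ltNge => td; rewrite /h cut_out ?mulr0//.
  by rewrite normrM (gtr0_norm d0) mulrC -ler_pdivrMr// ltW.
exists h; split => //.
- move=> s s1; have [h0 _ _] := g_in s1.
  rewrite /h h0 cut_in ?mulr1// normrM (gtr0_norm d0).
  by have := normr_ge0 s; nra.
- exists (2 / d) => s sd; rewrite /h cut_out ?mulr0//.
  by rewrite normrM (gtr0_norm d0) mulrC -ler_pdivrMr.
- move=> s; case: (ltP `|d * s| 1) => ds; last first.
    apply/leifP; case: ifPn => s1; first by have := far _ ds; lra.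
    by have := dh_far _ ds; lra.
  rewrite dh cut_in// cut1_in// mulr0 addr0 mulr1.
  apply/leifP; case: ifPn; first by move=> /g_in[_ -> _]; rewrite normr1.
  by rewrite -ltNge => /g1_lt; rewrite ltr_norml; lra.
move=> c /andP[c0 c1].
have [C C0 hC] := horner_le_expR ((1 + 'X) ^+ 4 : {poly R}) c0.
(* [K1] serves where the cut-off is 1: there |s| <= 1/d, the second derivative is at most (1+w)^4
   e^(-w) / d, and 1 - h'^2 >= e^(-w)/5. [K2] serves beyond, where |h'| <= 3/4 keeps 1 - h'^2 above
   e^(-2). *)
pose K1 := C / d * expR ((1 - c) * ln 5).
pose K2 := M2 * expR 2.
have K10 : 0 <= K1 by rewrite mulr_ge0 ?expR_ge0// divr_ge0// ltW.
have K20 : 0 <= K2 by rewrite mulr_ge0// expR_ge0.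
have c1' : 0 <= 1 - c by rewrite subr_ge0 ltW.
(* Lower bounds for 1 - h'^2 are kept in exponential form, so that taking the power 1 - c only
   rescales an exponent. *)
have powR_ge a b : expR a <= b -> expR ((1 - c) * a) <= b `^ (1 - c).
  move=> ab; rewrite mulrC expRM ge0_ler_powR// nnegrE ?expR_ge0//.
  by rewrite (le_trans _ ab)// expR_ge0.
exists (K1 + K2) => [|s]; first exact: addr_ge0.
rewrite mulrDl; case: (ltP `|d * s| 1) => ds; last first.
  rewrite (@le_trans _ _ (K2 * (1 - derive1 h s ^+ 2) `^ (1 - c)))//; last first.
    by rewrite lerDr mulr_ge0// powR_ge0.
  have h34 := dh_far _ ds.
  have : expR (- 2) <= 1 - derive1 h s ^+ 2.
    rewrite expRN (@le_trans _ _ 3^-1)//.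
      rewrite lef_pV2 ?posrE ?expR_gt0//.
      by have := expR_ge1Dx (2 : R); lra.
    by rewrite sq; have := normr_ge0 (derive1 h s); nra.
  move=> /powR_ge; set b := _ `^ _ => hb.
  rewrite (le_trans (hM2 s))// /K2 -mulrA ler_peMr//.
  rewrite (@le_trans _ _ (expR 2 * expR ((1 - c) * -2)))//; last first.
    by rewrite ler_wpM2l// expR_ge0.
  by rewrite -expRD -[leLHS]expR0 ler_expR; lra.
rewrite (@le_trans _ _ (K1 * (1 - derive1 h s ^+ 2) `^ (1 - c)))//; last first.
  by rewrite lerDl mulr_ge0// powR_ge0.
rewrite ddh dh cut_in// cut1_in// cut2_in// !mulr0 !addr0 !mulr1.
case: (leP `|s| 1) => s1.
  by have [_ _ ->] := g_in s1; rewrite normr0 mulr_ge0// powR_ge0.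
have := g_out s1; set w := _^-1 => -[w0 _ -> ->].
have q0 := expR_gt0 (- w).
have q1 := sqr1Dx_expRN_le (ltW w0).
(* 1 - (1 - q)^2 = q (2 - q), and e^(-w) <= q <= 9/5. *)
have : expR (- w - ln 5) <= 1 - (1 - (1 + w) ^+ 2 * expR (- w)) ^+ 2.
  rewrite expRB lnK ?posrE// ler_pdivrMr//.
  set q := (1 + w) ^+ 2 * _ in q1 *.
  have : expR (- w) <= q by rewrite /q ler_peMl// ?expR_ge0//; nra.
  nra.
move=> /powR_ge; set b := _ `^ _ => hb.
have hw : (1 + w) ^+ 4 <= C * expR (c * w).
  have := hC _ (ltW w0).
  by rewrite horner_exp hornerD hornerC hornerX ger0_norm// exprn_ge0// addr_ge0// ltW.
apply: (@le_trans _ _ (d^-1 * ((1 + w) ^+ 4 * expR (- w)))).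
  have hs : `|s| <= d^-1.
    rewrite -div1r ler_pdivlMr// mulrC.
    by move: ds; rewrite normrM (gtr0_norm d0) => /ltW.
  have hw4 : `|w ^+ 2 * (1 - w ^+ 2)| <= (1 + w) ^+ 4.
    by have w2 := sqr_ge0 w; rewrite ler_norml; apply/andP; split; nra.
  rewrite normrM (normrM s) (gtr0_norm q0) -mulrA.
  by apply: ler_pM => //; rewrite ler_pM2r.
rewrite (@le_trans _ _ (d^-1 * (C * expR (c * w) * expR (- w))))//.
  apply: ler_wpM2l; first by rewrite invr_ge0 ltW.
  by rewrite ler_pM2r.
have -> : d^-1 * (C * expR (c * w) * expR (- w)) = C / d * expR ((1 - c) * - w).
  rewrite (_ : (1 - c) * - w = c * w - w); last by ring.
  by rewrite expRD; ring.
rewrite /K1 -[leRHS]mulrA; apply: ler_wpM2l; first by rewrite divr_ge0// ltW.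
rewrite (@le_trans _ _ (expR ((1 - c) * ln 5) * expR ((1 - c) * (- w - ln 5))))//.
  by rewrite -expRD ler_expR; lra.
by rewrite ler_pM2l ?expR_gt0.
Unshelve. all: by end_near. Qed.

End profiles.

(** * Smooth functions and integration in several variables *)

Section smooth_functions.
Context {R : realType}.

(** Restriction to the line through x in direction v reduces directional derivatives to one-variable
    calculus at 0; no total derivative is ever formed. *)
Lemma is_derive_line {V : normedModType R} (f : V -> R) (x v : V) (df : R) :
  is_derive x v f df <-> is_derive (0 : R) (1 : R) (fun h => f (h *: v + x)) df.
Proof.
have e' : (fun h : R => h^-1 *: (f (h *: v + x) - f x)) =
    (fun h : R => h^-1 *: ((fun k : R => f (k *: v + x)) (h *: 1 + 0) - f (0 *: v + x))).
  by apply/funext => h; rewrite scale0r add0r addr0 [h%:A]mulr1.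
split=> -[h1 h2]; constructor.
- by move: h1; rewrite /derivable /= e'.
- by move: h2; rewrite /derive e'.
- by move: h1; rewrite /derivable /= e'.
- by move: h2; rewrite /derive e'.
Qed.

Lemma is_derive_chain {V : normedModType R} (phi : R -> R) (g : V -> R) (x v : V) (a b : R) :
  is_derive (g x) 1 phi a -> is_derive x v g b ->
  is_derive x v (fun z => phi (g z)) (a * b).
Proof.
move=> hphi /is_derive_line hg; apply/is_derive_line.
by apply: (@is_derive1_chain _ phi (fun h => g (h *: v + x))); rewrite ?scale0r ?add0r.
Qed.

Lemma is_derive_coord m (i j : 'I_m) (z : 'rV[R]_m) :
  is_derive z (delta_mx ord0 i) (fun z : 'rV[R]_m => z ord0 j) (i == j)%:R.
Proof.
apply/is_derive_line.
rewrite (_ : (fun _ => _) = fun h : R => h * (i == j)%:R + z ord0 j); last first.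
  by apply/funext => h; rewrite !mxE eqxx/= eq_sym.
apply: (is_derive_eq (is_derive_add (is_derive_mul (is_derive_id _ _)
  (is_derive_const _ _ _)) (is_derive_const _ _ _))).
by rewrite /=; ring.
Qed.

(* The multivariate analogue of [elem]; [smf_rsqrt] is there for the regularised
   flux Du / sqrt (N + 1/k). *)
Inductive smf m : ('rV[R]_m -> R) -> Prop :=
| smf_cst c : smf (fun=> c)
| smf_coord (f : R -> R) i : elem f -> smf (fun z => f (z ord0 i))
| smf_add f g : smf f -> smf g -> smf (fun z => f z + g z)
| smf_mul f g : smf f -> smf g -> smf (fun z => f z * g z)
| smf_rsqrt f : smf f -> (forall z, 0 < f z) -> smf (fun z => (Num.sqrt (f z))^-1).

Lemma smf_opp m (f : 'rV[R]_m -> R) : smf f -> smf (fun z => - f z).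
Proof.
move=> sf; rewrite (_ : (fun _ => _) = fun z => (-1) * f z).
  by apply: smf_mul => //; exact: smf_cst.
by apply/funext => z; rewrite mulN1r.
Qed.

Lemma smf_sub m (f g : 'rV[R]_m -> R) : smf f -> smf g -> smf (fun z => f z - g z).
Proof. by move=> sf sg; apply: smf_add => //; exact: smf_opp. Qed.

Lemma smf_prod m (I : Type) (r : seq I) (f : I -> 'rV[R]_m -> R) :
  (forall i, smf (f i)) -> smf (fun z => \prod_(i <- r) f i z).
Proof.
move=> sf; elim: r => [|i r IH].
  by rewrite (_ : (fun _ => _) = fun=> 1); [exact: smf_cst|apply/funext => z; rewrite big_nil].
rewrite (_ : (fun _ => _) = fun z => f i z * \prod_(i <- r) f i z).
  exact: smf_mul.
by apply/funext => z; rewrite big_cons.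
Qed.

Lemma smf_sum m (I : Type) (r : seq I) (f : I -> 'rV[R]_m -> R) :
  (forall i, smf (f i)) -> smf (fun z => \sum_(i <- r) f i z).
Proof.
move=> sf; elim: r => [|i r IH].
  by rewrite (_ : (fun _ => _) = fun=> 0); [exact: smf_cst|apply/funext => z; rewrite big_nil].
rewrite (_ : (fun _ => _) = fun z => f i z + \sum_(i <- r) f i z).
  exact: smf_add.
by apply/funext => z; rewrite big_cons.
Qed.

Lemma is_derive_rsqrt {V : normedModType R} (f : V -> R) (x v : V) (df : R) :
  0 < f x -> is_derive x v f df ->
  is_derive x v (fun z => (Num.sqrt (f z))^-1)
    (- 2^-1 * (Num.sqrt (f x))^-1 ^+ 3 * df).
Proof.
move=> f0 hf; have s0 : Num.sqrt (f x) != 0 by rewrite gt_eqF// sqrtr_gt0.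
have h : is_derive (f x) (1:R) (fun t => (Num.sqrt t)^-1)
    (- 2^-1 * (Num.sqrt (f x))^-1 ^+ 3).
  have hs := is_derive1_sqrt f0.
  apply: (is_derive_eq (is_deriveV s0 hs)).
  by rewrite /GRing.scale/=; field.
exact: is_derive_chain h hf.
Qed.

Lemma smf_partial m (f : 'rV[R]_m -> R) i : smf f -> smf (partial i f) /\
  forall z, is_derive z (delta_mx ord0 i) f (partial i f z).
Proof.
suff : smf f -> exists2 f', smf f' &
    forall z, is_derive z (delta_mx ord0 i) f (f' z).
  move=> h /h[f' ef' df]; suff -> : partial i f = f' by [].
  by apply/funext => z; rewrite /partial; exact: derive_val.
elim=> {f} [c|f j ef|f g sf [f' sf' df] sg [g' sg' dg]|
            f g sf [f' sf' df] sg [g' sg' dg]|f sf [f' sf' df] f0].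
- by exists (fun=> 0); [exact: smf_cst|move=> t; exact: is_derive_const].
- exists (fun z => derive1 f (z ord0 j) * (i == j)%:R).
    by apply: smf_mul; [apply/smf_coord/elem_derive1|exact: smf_cst].
  by move=> z; exact: is_derive_chain (elem_is_derive _ ef) (is_derive_coord _ _ _).
- exists (fun t => f' t + g' t); first exact: smf_add.
  by move=> t; exact: is_derive_add.
- exists (fun t => f' t * g t + f t * g' t).
    by apply: smf_add; exact: smf_mul.
  by move=> t; exact: is_derive_mul.
- exists (fun z => - 2^-1 * (Num.sqrt (f z))^-1 ^+ 3 * f' z).
    apply: smf_mul => //; apply: smf_mul; first exact: smf_cst.
    rewrite (_ : (fun _ => _) = fun z => (Num.sqrt (f z))^-1 *
        ((Num.sqrt (f z))^-1 * (Num.sqrt (f z))^-1)).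
      by do !apply: smf_mul; exact: smf_rsqrt.
    by apply/funext => z; rewrite !exprS expr0 mulr1.
  by move=> z; exact: is_derive_rsqrt.
Qed.

Lemma partial_smf m (f : 'rV[R]_m -> R) i : smf f -> smf (partial i f).
Proof. by move=> /smf_partial-/(_ i)[]. Qed.

Lemma smf_is_derive m (f : 'rV[R]_m -> R) i z : smf f ->
  is_derive z (delta_mx ord0 i) f (partial i f z).
Proof. by move=> /smf_partial-/(_ i)[]. Qed.

Lemma partial_eq m (f g : 'rV[R]_m -> R) i :
  (forall z, is_derive z (delta_mx ord0 i) f (g z)) -> partial i f = g.
Proof. by move=> h; apply/funext => z; exact: derive_val. Qed.

Lemma smf_continuous m (f : 'rV[R]_m -> R) : smf f -> continuous f.
Proof.
elim=> {f} [c|f j ef|f g _ cf _ cg|f g _ cf _ cg|f sf cf f0] z.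
- exact: cst_continuous.
- apply: (@continuous_comp _ _ _ (fun z : 'rV[R]_m => z ord0 j) f).
    exact: coord_continuous.
  exact: elem_continuous.
- exact: (@continuousD _ _ _ f g z (cf z) (cg z)).
- exact: (@continuousM _ _ f g z (cf z) (cg z)).
- apply: (@continuousV _ _ (fun z => Num.sqrt (f z))).
    by rewrite gt_eqF// sqrtr_gt0.
  by apply: (@continuous_comp _ _ _ f); [exact: cf|exact: sqrt_continuous].
Qed.

Lemma smf_smooth_on m (f : 'rV[R]_m -> R) (U : set 'rV[R]_m) : smf f -> smooth_on U f.
Proof.
move=> sf s z _.
have {}sf : smf (foldr partial f s) by elim: s => //= i s; exact: partial_smf.
split; first exact: smf_continuous.
by move=> i; have [] := smf_is_derive i z sf.
Qed.

End smooth_functions.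

(** * Lebesgue measure on row vectors, cubes and integration by parts *)

Section lebesgue_rV.
Context {R : realType}.
Local Notation mu := (@lebesgue_measure R).

Lemma continuous_measurable_rV m (f : 'rV[R]_m -> R) :
  continuous f -> measurable_fun setT f.
Proof.
move=> cf; apply: (measurability (@RGenOpens.G R)); first exact: RGenOpens.measurableE.
move=> _ [_ [a [b ->]] <-]; rewrite setTI; apply: open_measurable_rV.
by apply: open_comp; [move=> x _; exact: cf|exact: itv_open].
Qed.

Lemma measurable_coord m (i : 'I_m) :
  measurable_fun setT (fun z : 'rV[R]_m => z ord0 i).
Proof. by apply: continuous_measurable_rV; exact: coord_continuous. Qed.

Local Open Scope ereal_scope.

Lemma ge0_integral_leb_cons n (f : 'rV[R]_n.+1 -> \bar R) :
  measurable_fun setT f -> (forall z, 0 <= f z) ->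
  \int[leb n.+1]_z f z = \int[mu]_t \int[leb n]_v f (cons_rV (t, v)).
Proof.
move=> mf f0.
rewrite [LHS](@ge0_integral_pushforward _ _ _ _ _ _ measurable_cons_rV)//.
rewrite preimage_setT fubini_tonelli1//; first exact: measurableT_comp measurable_cons_rV.
by move=> x; exact: f0.
Qed.

Lemma measurable_prod_coord m (f : 'I_m -> R -> \bar R) :
  (forall i, measurable_fun setT (f i)) ->
  measurable_fun setT (fun z : 'rV[R]_m => \big[*%E/1]_(i < m) f i (z ord0 i)).
Proof.
move=> mf; elim: (index_enum _) => [|i s IH].
  by under eq_fun do rewrite big_nil; exact: measurable_cst.
under eq_fun do rewrite big_cons.
apply: emeasurable_funM => //.
exact: (measurableT_comp (mf i) (measurable_coord i)).
Qed.

Lemma big_mule_ge0 (I : Type) (s : seq I) (f : I -> \bar R) :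
  (forall i, 0 <= f i) -> 0 <= \big[*%E/1]_(i <- s) f i.
Proof.
move=> f0; elim: s => [|i s IH]; first by rewrite big_nil.
by rewrite big_cons mule_ge0.
Qed.

(** The volume of a cube, the mass of a mollifier, the nullity of hyperplanes and the integrability
    of the singular powers are all reduced to this product formula. *)
Lemma integral_prod_coord m (f : 'I_m -> R -> \bar R) :
  (forall i, measurable_fun setT (f i)) -> (forall i t, 0 <= f i t) ->
  \int[leb m]_z \big[*%E/1]_(i < m) f i (z ord0 i) =
  \big[*%E/1]_(i < m) \int[mu]_t f i t.
Proof.
elim: m f => [|n IH] f mf f0.
  rewrite big_ord0 [leb 0]/=; under eq_integral do rewrite big_ord0.
  by rewrite integral_cst//= diracT mule1.
rewrite ge0_integral_leb_cons//; last 2 first.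
- exact: measurable_prod_coord.
- by move=> z; exact: big_mule_ge0.
rewrite big_ord_recl -IH//.
transitivity (\int[mu]_t (f ord0 t *
    \int[leb n]_v \big[*%E/1]_(i < n) f (lift ord0 i) (v ord0 i))).
  apply: eq_integral => t _; rewrite -ge0_integralZl//; last 2 first.
  - apply: (@measurable_prod_coord _ (fun i => f (lift ord0 i))) => i; exact: mf.
  - by move=> v _; exact: big_mule_ge0.
  apply: eq_integral => v _; rewrite big_ord_recl cons_rV0/=.
  by under eq_bigr do rewrite cons_rVS/=.
rewrite ge0_integralZr//.
  exact: (mf ord0).
by apply: integral_ge0 => v _; exact: big_mule_ge0.
Qed.

End lebesgue_rV.

Section cubes.
Context {R : realType}.

Definition box m (a b : 'I_m -> R) : set 'rV[R]_m :=
  [set z | forall i, a i <= z ord0 i <= b i].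

Definition cube m (r : R) : set 'rV[R]_m := [set z | forall i, `|z ord0 i| <= r].
Arguments cube : clear implicits.

Lemma cubeE m (r : R) : cube m r = box (fun=> - r) (fun=> r).
Proof. by apply/seteqP; split => z h i; have := h i; rewrite ler_norml. Qed.

Lemma compact_box m (a b : 'I_m -> R) : compact (box a b).
Proof.
rewrite (_ : box a b = [set z | forall i, `[a i, b i]%classic (z ord0 i)]).
  by apply: (@rV_compact R m (fun i => `[a i, b i]%classic)) => i; exact: segment_compact.
by apply/seteqP; split => z h i; have := h i; rewrite /= in_itv.
Qed.

Lemma compact_cube m (r : R) : compact (cube m r).
Proof. by rewrite cubeE; exact: compact_box. Qed.

Lemma measurable_closed_rV m (A : set 'rV[R]_m) : closed A -> measurable A.
Proof.
by move=> cA; rewrite -(setCK A); apply: measurableC; apply: open_measurable_rV; exact: closed_openC.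
Qed.

Lemma measurable_compact_rV m (A : set 'rV[R]_m) : compact A -> measurable A.
Proof.
move=> cA; apply: measurable_closed_rV; apply: compact_closed => //.
Qed.

Lemma measurable_cube m (r : R) : measurable (cube m r).
Proof. by apply: measurable_compact_rV; exact: compact_cube. Qed.

Lemma compact_sub_cube m (A : set 'rV[R]_m) : compact A -> exists r, A `<=` cube m r.
Proof.
move=> cA; pose F (i : 'I_m) := (fun z : 'rV[R]_m => `|z ord0 i|).
have hF i : exists M, forall z, A z -> F i z <= M.
  have [->|/set0P A0] := eqVneq A set0; first by exists 0 => z.
  have cF : {within A, continuous F i}.
    apply: continuous_subspaceT => z; apply: (@continuous_comp _ _ _ (fun z : 'rV[R]_m => z ord0 i)).
      exact: coord_continuous.
    exact: norm_continuous.
  have [c _ hc] := EVT_max_rV A0 cA cF.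
  by exists (F i c) => z Az; apply: hc; rewrite inE.
have [M hM] := choice hF.
exists (\sum_i `|M i|) => z Az i.
rewrite (le_trans (hM i _ Az))// (le_trans (ler_norm _))//.
by rewrite (bigD1 i)//= lerDl sumr_ge0.
Qed.

Lemma big_mule_lty (I : Type) (s : seq I) (f : I -> \bar R) :
  (forall i, 0 <= f i < +oo)%E -> (\big[*%E/1%E]_(i <- s) f i < +oo)%E.
Proof.
move=> f0; elim: s => [|i s IH]; first by rewrite big_nil ltry.
have /andP[fi0 fioo] := f0 i.
by rewrite big_cons lte_mul_pinfty// ge0_fin_numE.
Qed.

Lemma leb_cube_lty m (r : R) : (leb m (cube m r) < +oo)%E.
Proof.
rewrite -(setIT (cube m r)) -[X in (X < _)%E]integral_indic//; last exact: measurable_cube.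
pose f (_ : 'I_m) t : \bar R := (\1_`[- r, r] t)%:E.
rewrite (_ : (\int[_]_x _)%E =
    (\int[leb m]_z \big[*%E/1]_(i < m) f i (z ord0 i))%E); last first.
  apply: eq_integral => z _; rewrite /f -(@big_morph _ _ EFin 1%E *%E 1%R *%R)//.
  congr EFin; rewrite indicE; case: (boolP (z \in cube m r)); rewrite ?inE ?notin_setE => hz.
    rewrite big1// => i _; rewrite indicE mem_set//= in_itv/= -ler_norml; exact: hz.
  move: hz => /existsNP[i hi]; rewrite (bigD1 i)//= indicE memNset ?mul0r//.
  by rewrite /= in_itv/= -ler_norml.
rewrite integral_prod_coord; last 2 first.
- by move=> i; apply/measurable_EFinP; exact: measurable_indic.
- by move=> i t; rewrite /f lee_fin.
apply: big_mule_lty => i; rewrite integral_indic//= setIT lebesgue_measure_itv/=.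
case: ifP => [|_]; last by rewrite lexx ltry.
by rewrite lte_fin => rr; rewrite -EFinB ltry lee_fin subr_ge0 ltW.
Qed.

End cubes.
Arguments cube {R} m r.

Section integration_by_parts.
Context {R : realType}.
Local Notation mu := (@lebesgue_measure R).

Lemma integrable_bounded m (A : set 'rV[R]_m) (f : 'rV[R]_m -> R) (r M : R) :
  measurable A -> A `<=` cube m r -> measurable_fun A f ->
  (forall z, A z -> `|f z| <= M) -> (leb m).-integrable A (EFin \o f).
Proof.
move=> mA Ar mf fM; apply: measurable_bounded_integrable => //.
  apply: (le_lt_trans _ (@leb_cube_lty R m r)).
  by apply: le_measure; rewrite ?inE//; exact: measurable_cube.
exists M; split; first exact: num_real.
by move=> x Mx y Ay /=; rewrite (le_trans (fM _ Ay))// ltW.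
Qed.

Lemma continuous_bounded_on m (K : set 'rV[R]_m) (f : 'rV[R]_m -> R) :
  compact K -> continuous f -> exists2 M, 0 <= M & forall z, K z -> `|f z| <= M.
Proof.
move=> cK cf; have [->|/set0P K0] := eqVneq K set0; first by exists 0.
have cF : {within K, continuous (fun z => `|f z|)}.
  apply: continuous_subspaceT => z.
  by apply: (@continuous_comp _ _ _ f); [exact: cf|exact: norm_continuous].
have [c _ hc] := EVT_max_rV K0 cK cF.
by exists `|f c| => // z Kz; apply: hc; rewrite inE.
Qed.

Lemma integrable_continuous_compact m (A : set 'rV[R]_m) (f : 'rV[R]_m -> R) r :
  measurable A -> A `<=` cube m r -> continuous f -> (leb m).-integrable A (EFin \o f).
Proof.
move=> mA Ar cf.
have [M _ hM] := continuous_bounded_on (@compact_cube R m r) cf.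
apply: (integrable_bounded mA Ar) => [|z /Ar]; last exact: hM.
by apply: measurable_funTS; exact: continuous_measurable_rV.
Qed.

Lemma integrable_compact_support m (f : 'rV[R]_m -> R) r :
  continuous f -> (forall z, ~ cube m r z -> f z = 0) ->
  (leb m).-integrable setT (EFin \o f).
Proof.
move=> cf f0.
have h := @integrable_continuous_compact m (cube m r) f r
  (@measurable_cube R m r) (@subset_refl _ _) cf.
have := (integrable_mkcond (EFin \o f) (@measurable_cube R m r)).1 h.
congr (_.-integrable _ _); apply/funext => z.
rewrite /patch; case: ifPn => //; rewrite notin_setE => /f0 /= ->.
by [].
Qed.

Lemma integral_compact_derivative (F g : R -> R) (a b : R) : a < b ->
  (forall t : R, is_derive t 1 F (g t)) -> continuous g ->
  (forall t, ~~ (a <= t <= b) -> g t = 0) ->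
  (\int[mu]_t (g t)%:E = (F b - F a)%:E)%E.
Proof.
move=> ab dF cg g0.
have -> : (\int[mu]_t (g t)%:E = \int[mu]_(t in `[a, b]) (g t)%:E)%E.
  rewrite [RHS]integral_mkcond; apply: eq_integral => t _.
  rewrite /patch; case: ifPn => //; rewrite notin_setE /= in_itv/= => h.
  by rewrite g0//; exact/negP.
rewrite (@continuous_FTC2 _ g F)//.
- exact: continuous_subspaceT.
- have cF : continuous F.
    move=> t; apply: differentiable_continuous; apply/derivable1_diffP.
    by have [] := dF t.
  split => //.
  + by apply: cvg_at_right_filter; exact: cF.
  + by apply: cvg_at_left_filter; exact: cF.
- by move=> t _; rewrite derive1E; have [_] := dF t.
Qed.

Lemma integrable_cons_rV n (f : 'rV[R]_n.+1 -> \bar R) :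
  (leb n.+1).-integrable setT f -> (mu \x leb n)%E.-integrable setT (f \o cons_rV).
Proof.
move=> /integrableP[mf fi]; apply/integrableP; split.
  exact: measurableT_comp measurable_cons_rV.
move: fi; rewrite (@ge0_integral_pushforward _ _ _ _ _ _ measurable_cons_rV)//.
exact: measurableT_comp.
Qed.

Lemma integral_leb_cons12 n (f : 'rV[R]_n.+1 -> \bar R) :
  (leb n.+1).-integrable setT f ->
  (\int[leb n.+1]_z f z = \int[mu]_t \int[leb n]_v f (cons_rV (t, v)))%E.
Proof.
move=> fi; have fi' := integrable_cons_rV fi.
rewrite [LHS](integral_pushforward measurable_cons_rV)//.
- by rewrite preimage_setT -integral12_prod_meas1.
- exact: measurable_int fi.
Qed.

Lemma integral_leb_cons21 n (f : 'rV[R]_n.+1 -> \bar R) :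
  (leb n.+1).-integrable setT f ->
  (\int[leb n.+1]_z f z = \int[leb n]_v \int[mu]_t f (cons_rV (t, v)))%E.
Proof.
move=> fi; have fi' := integrable_cons_rV fi.
rewrite [LHS](integral_pushforward measurable_cons_rV)//.
- by rewrite preimage_setT -integral21_prod_meas1.
- exact: measurable_int fi.
Qed.

Lemma cons_rVD n (a b : R) (v w : 'rV[R]_n) :
  cons_rV (a, v) + cons_rV (b, w) = cons_rV (a + b, v + w).
Proof.
apply/rowP => i; rewrite mxE; case: (unliftP ord0 i) => [j|] ->.
  by rewrite !cons_rVS mxE.
by rewrite !cons_rV0.
Qed.

Lemma delta_ord0 n h : h *: delta_mx ord0 ord0 = cons_rV (h, 0) :> 'rV[R]_n.+1.
Proof.
apply/rowP => i; rewrite [LHS]mxE [X in _ * X]mxE; case: (unliftP ord0 i) => [j|] ->.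
  by rewrite !cons_rVS mxE/= mulr0.
by rewrite !cons_rV0/= mulr1.
Qed.

Lemma delta_lift n (j : 'I_n) (h : R) :
  h *: delta_mx ord0 (lift ord0 j) = cons_rV (0 : R, h *: delta_mx ord0 j) :> 'rV[R]_n.+1.
Proof.
apply/rowP => i; rewrite [LHS]mxE [X in _ * X]mxE; case: (unliftP ord0 i) => [k|] ->.
  by rewrite !cons_rVS !mxE/= (inj_eq lift_inj).
by rewrite !cons_rV0/= mulr0.
Qed.

Lemma continuous_cons_rV1 n (v : 'rV[R]_n) : continuous (fun t : R => cons_rV (t, v)).
Proof.
move=> t A /nbhs_ballP[e /= e0 eA]; apply/nbhs_ballP; exists e => //= s ts.
apply: eA; split=> // i j; rewrite ord1; case: (unliftP ord0 j) => [k|] ->.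
  by rewrite !cons_rVS; exact: ballxx.
by rewrite !cons_rV0.
Qed.

Lemma continuous_cons_rV2 n (t : R) : continuous (fun v : 'rV[R]_n => cons_rV (t, v)).
Proof.
move=> v A /nbhs_ballP[e /= e0 eA]; apply/nbhs_ballP; exists e => //= w [_ vw].
apply: eA; split=> // i j; rewrite ord1; case: (unliftP ord0 j) => [k|] ->.
  by rewrite !cons_rVS.
by rewrite !cons_rV0; exact: ballxx.
Qed.

Lemma open_notcube m (r : R) : open (~` cube m r).
Proof. by apply: closed_openC; apply: compact_closed => //; exact: compact_cube. Qed.

(** Induction on the dimension. For a derivative along a later coordinate, the integral over each
    slice vanishes by induction. Along the first coordinate, the fundamental theorem on each line
    leaves two end values, both 0. *)
Lemma integral_partial0 m (f g : 'rV[R]_m -> R) (i : 'I_m) (r : R) :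
  (forall z, is_derive z (delta_mx ord0 i) f (g z)) -> continuous g ->
  (forall z, ~ cube m r z -> f z = 0) -> (\int[leb m]_z (g z)%:E = 0)%E.
Proof.
elim: m i f g r => [[]//|n IH] i f g r dfg cg f0.
wlog r0 : r f0 / 0 < r.
  move=> h; apply: (h (`|r| + 1)) => [z nz|]; last by rewrite ltr_wpDl.
  by apply: f0; apply: contra_not nz => zr k; rewrite (le_trans (zr k))// (le_trans (ler_norm _))// lerDl.
have g0 z : ~ cube n.+1 r z -> g z = 0.
  move=> nz; have [_ <-] := dfg z.
  rewrite (@near_eq_derive _ _ _ f (cst 0)) ?derive_cst//.
  have : nbhs z (~` cube n.+1 r) by apply: open_nbhs_nbhs; split => //; exact: open_notcube.
  by apply: filterS => w; exact: f0.
have gi := integrable_compact_support cg g0.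
case: (unliftP ord0 i) => [j|] ei.
  rewrite integral_leb_cons12//; apply: integral0_eq => t _.
  apply: (IH j (fun v => f (cons_rV (t, v))) _ r) => [v||v nv].
  - have := dfg (cons_rV (t, v)); rewrite ei => /is_derive_line h.
    apply/is_derive_line; move: h; congr is_derive.
    by apply/funext => h; rewrite delta_lift cons_rVD add0r.
  - move=> v; apply: (@continuous_comp _ _ _ (fun v => cons_rV (t, v)) g).
      exact: continuous_cons_rV2.
    exact: cg.
  - by apply: f0; apply: contra_not nv => zr k; have := zr (lift ord0 k); rewrite cons_rVS.
rewrite integral_leb_cons21//; apply: integral0_eq => v _.
have out t : ~~ (- r <= t <= r) -> ~ cube n.+1 r (cons_rV (t, v)).
  by move=> tr /(_ ord0); rewrite cons_rV0/= ler_norml; exact/negP.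
(* The interval is widened by 1 so that its end points lie strictly outside the cube, where [f]
   vanishes. *)
have rr : - (r + 1) < r + 1 by rewrite gtrN// ltr_wpDl// ltW.
have dF (t : R) : is_derive t (1 : R) (fun t => f (cons_rV (t, v))) (g (cons_rV (t, v))).
  have := dfg (cons_rV (t, v)); rewrite ei => /is_derive_line h.
  apply/is_derive_line; move: h; congr is_derive.
  by apply/funext => h; rewrite delta_ord0 cons_rVD add0r [h *: 1]mulr1.
rewrite (integral_compact_derivative rr dF).
- rewrite !f0 ?subrr//; apply: out.
    by rewrite negb_and -!ltNge ltrN2 ltrDl ltr01.
  by rewrite negb_and -!ltNge ltrDl ltr01 orbT.
- move=> t; apply: (@continuous_comp _ _ _ (fun t => cons_rV (t, v)) g).
    exact: continuous_cons_rV1.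
  exact: cg.
- move=> t ht; apply: g0; apply: out; apply: contra ht => /andP[h1 h2].
  by apply/andP; split; lra.
Qed.

End integration_by_parts.

(** * Weak gradients *)

Section box_bumps.
Context {R : realType}.

Definition obox m (a b : 'I_m -> R) : set 'rV[R]_m :=
  [set z | forall i, a i < z ord0 i < b i].

(** As k grows these smooth functions converge pointwise to the indicator of the open box; they
    carry information from test functions over to boxes. *)
Definition boxbump m k (a b : 'I_m -> R) (z : 'rV[R]_m) : R :=
  \prod_(i < m) (step (k.+1%:R * (z ord0 i - a i)) * step (k.+1%:R * (b i - z ord0 i))).

Lemma smf_boxbump m k (a b : 'I_m -> R) : smf (boxbump k a b).
Proof.
apply: smf_prod => i; apply: (@smf_coord _ _ (fun t => step (k.+1%:R * (t - a i)) * step (k.+1%:R * (b i - t)))).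
apply: elem_mul; apply: elem_comp (elem_step) _; apply: elem_mul.
- exact: elem_cst.
- by apply: elem_sub; [exact: elem_id|exact: elem_cst].
- exact: elem_cst.
- by apply: elem_sub; [exact: elem_cst|exact: elem_id].
Qed.

Lemma boxbump_itv m k (a b : 'I_m -> R) z : 0 <= boxbump k a b z <= 1.
Proof.
rewrite prodr_ge0/= => [|i _]; last by rewrite mulr_ge0// step_ge0.
rewrite (@le_trans _ _ (\prod_(i < m) 1))//; last by rewrite big1.
by apply: ler_prod => i _; rewrite mulr_ge0 ?step_ge0//= mulr_ile1 ?step_ge0 ?step_le1.
Qed.

Lemma boxbump_out m k (a b : 'I_m -> R) z : ~ obox a b z -> boxbump k a b z = 0.
Proof.
move=> /existsNP[i /negP]; rewrite negb_and -!leNgt => h.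
rewrite /boxbump (bigD1 i)//=; case/orP: h => h.
  by rewrite step_le0 ?mul0r// pmulr_rle0// subr_le0.
by rewrite [X in _ * X * _]step_le0 ?mulr0 ?mul0r// pmulr_rle0// subr_le0.
Qed.

Lemma step_near1 (t : R) : 0 < t -> \forall k \near \oo, step (k.+1%:R * t) = 1.
Proof.
move=> t0; near=> k; apply: step_ge1.
have : k.+1%:R^-1 < t.
  by near: k; exact: (near_infty_natSinv_lt (PosNum t0)).
by rewrite -div1r ltr_pdivrMr// mulrC => /ltW.
Unshelve. all: by end_near. Qed.

Lemma boxbump_near1 m (a b : 'I_m -> R) z : obox a b z ->
  \forall k \near \oo, boxbump k a b z = 1.
Proof.
move=> abz.
have : \forall k \near \oo, forall i : 'I_m,
    step (k.+1%:R * (z ord0 i - a i)) * step (k.+1%:R * (b i - z ord0 i)) = 1.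
  apply: filter_forall => i; have /andP[h1 h2] := abz i.
  have n1 : 0 < z ord0 i - a i by rewrite subr_gt0.
  have n2 : 0 < b i - z ord0 i by rewrite subr_gt0.
  by apply: filterS2 (step_near1 n1) (step_near1 n2) => k -> ->; rewrite mulr1.
by apply: filterS => k h; rewrite /boxbump big1.
Qed.

Lemma obox_sub_box m (a b : 'I_m -> R) : obox a b `<=` box a b.
Proof. by move=> z h i; have /andP[/ltW-> /ltW->] := h i. Qed.

Lemma open_obox m (a b : 'I_m -> R) : open (obox a b).
Proof.
rewrite openE => z abz.
suff : \forall y \near z, forall i : 'I_m, a i < (y : 'rV[R]_m) ord0 i < b i by [].
apply: (@filter_forall _ _ (fun i (y : 'rV[R]_m) => a i < y ord0 i < b i) (nbhs z)) => i.
have : (z ord0 i) \in `]a i, b i[ by rewrite in_itv/=; exact: abz.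
move=> /near_in_itvoo h.
have hc : nbhs z [set y : 'rV[R]_m | y ord0 i \in `]a i, b i[].
  exact: (@coord_continuous _ 1 m ord0 i z) _ h.
by apply: (@filterS _ (nbhs z) _ _ _ _ hc) => y; rewrite /= in_itv.
Qed.

Lemma measurable_obox m (a b : 'I_m -> R) : measurable (obox a b).
Proof. by apply: open_measurable_rV; exact: open_obox. Qed.

Lemma ball_obox m (x : 'rV[R]_m) (e : R) : 0 < e ->
  ball x e = obox (fun i => x ord0 i - e) (fun i => x ord0 i + e).
Proof.
move=> e0; apply/seteqP; split => [y [_ xy] i|y xy].
  by have := xy ord0 i; rewrite /ball/= ltr_distlC.
by split => // i j; rewrite ord1 /ball/= ltr_distlC.
Qed.

(** Balls of the sup norm are boxes, and an open set is a countable union of rational balls. With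
    [setI_closed_obox] this makes the boxes a generating pi-system. *)
Lemma measurable_rV_obox m :
  (@measurable _ 'rV[R]_m) = <<s [set A | exists a b, A = @obox m a b] >>.
Proof.
apply/seteqP; split => A.
  apply: smallest_sub; first exact: smallest_sigma_algebra.
  move=> U oU; rewrite (open_rV_bigcup oU).
  apply: (@countable_bigcupT_measurable _ (g_sigma_algebraType _)); first exact: countableP.
  move=> q; case: asboolP => _; last exact: (@measurable0 _ (g_sigma_algebraType _)).
  apply: sub_sigma_algebra => /=; rewrite ball_obox ?invr_gt0//.
  by exists (fun i => map_mx (@ratr R) q.1 ord0 i - q.2.+1%:R^-1),
     (fun i => map_mx (@ratr R) q.1 ord0 i + q.2.+1%:R^-1).
apply: smallest_sub; first exact: sigma_algebra_measurable.
by move=> _ [a [b ->]]; exact: measurable_obox.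
Qed.

Lemma setI_closed_obox m : setI_closed [set A | exists a b, A = @obox m a b].
Proof.
move=> _ _ [a [b ->]] [c [d ->]].
exists (fun i => Num.max (a i) (c i)), (fun i => Num.min (b i) (d i)).
apply/seteqP; split => [z [h1 h2] i|z h].
  have /andP[h3 h4] := h1 i; have /andP[h5 h6] := h2 i.
  by rewrite gt_max h3 h5 lt_min h4 h6.
by split => i; have := h i; rewrite gt_max lt_min => /andP[/andP[h1 h2] /andP[h3 h4]]; apply/andP; split.
Qed.

End box_bumps.

Section box_integrals.
Context {R : realType}.

Lemma measurable_box m (a b : 'I_m -> R) : measurable (box a b).
Proof. by apply: measurable_compact_rV; exact: compact_box. Qed.

Lemma smf_measurable m (f : 'rV[R]_m -> R) A : smf f -> measurable_fun A f.
Proof.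
by move=> sf; apply: measurable_funTS; apply: continuous_measurable_rV; exact: smf_continuous.
Qed.

Lemma integral_obox_eq0 m (g : 'rV[R]_m -> R) (a b : 'I_m -> R) :
  (leb m).-integrable (box a b) (EFin \o g) ->
  (forall k, \int[leb m]_(z in box a b) (g z * boxbump k a b z)%:E = 0)%E ->
  (\int[leb m]_(z in obox a b) (g z)%:E = 0)%E.
Proof.
move=> gi g0.
have mg := measurable_int _ gi; move/measurable_EFinP : (mg) => mg'.
have mb := @measurable_box m a b.
have mo := @measurable_obox R m a b.
have obE : obox a b = box a b `&` obox a b.
  by rewrite setIC; apply/esym/setIidl/obox_sub_box.
rewrite obE integral_mkcondr.
have [] := @dominated_convergence _ _ _ (leb m) (box a b) mb
  (fun k z => (g z * boxbump k a b z)%:E) ((EFin \o g) \_ (obox a b)) (abse \o (EFin \o g)).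
- move=> k; apply/measurable_EFinP; apply: measurable_funM => //.
  by apply: smf_measurable; exact: smf_boxbump.
- apply: (measurable_restrict (EFin \o g) mo mb).1; exact: measurable_funS mb (@subIsetl _ _ _) mg.
- apply: aeW => z _; rewrite /patch; case: ifPn => [|]; rewrite ?inE ?notin_setE => zo.
    apply: cvg_near_cst; apply: filterS (boxbump_near1 zo) => k ->.
    by rewrite mulr1.
  by under eq_fun do rewrite boxbump_out// mulr0; exact: cvg_cst.
- exact: integrable_abse.
- apply: aeW => z k _ /=; rewrite lee_fin normrM.
  have /andP[h1 h2] := boxbump_itv k a b z.
  by rewrite (ger0_norm h1) ler_piMr.
move=> _ _ /cvg_lim <-//.
by apply: cvg_lim => //; apply: cvg_near_cst; apply: nearW => k; exact: g0.
Qed.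

(** The charge with density [g] on the box vanishes on all boxes, hence on all Borel sets by the
    Dynkin argument; its density is therefore 0 almost everywhere. *)
Lemma obox_ae_eq0 m (g : 'rV[R]_m -> R) (a b : 'I_m -> R) :
  (leb m).-integrable (box a b) (EFin \o g) ->
  (forall c d, box c d `<=` box a b -> \int[leb m]_(z in obox c d) (g z)%:E = 0)%E ->
  ae_eq (leb m) (obox a b) (EFin \o g) (cst 0%E).
Proof.
move=> gi g0.
have mo := @measurable_obox R m a b.
have gio : (leb m).-integrable (obox a b) (EFin \o g).
  by apply: integrableS gi => //; [exact: measurable_box|exact: obox_sub_box].
have giT := (integrable_mkcond _ mo).1 gio.
pose nu := induced_charge giT.
have nuE A : nu A = (\int[leb m]_(z in A `&` obox a b) (g z)%:E)%E.
  by rewrite /nu /induced_charge -integral_mkcondr.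
have nu0 A : measurable A -> nu A = 0%E.
  rewrite measurable_rV_obox; move: A.
  apply: (dynkin_induction (measurable_rV_obox m) (@setI_closed_obox R m)).
  - by rewrite nuE setTI; exact: g0.
  - move=> _ [c [d ->]]; rewrite nuE.
    pose e i := Num.max (c i) (a i); pose f i := Num.min (d i) (b i).
    rewrite (_ : _ `&` _ = obox e f).
      apply: g0 => z h i; have := h i; rewrite ge_max le_min.
      by move=> /andP[/andP[_ ->] /andP[_ ->]].
    apply/seteqP; split => [z [h1 h2] i|z h].
      have /andP[h3 h4] := h1 i; have /andP[h5 h6] := h2 i.
      by rewrite gt_max h3 h5 lt_min h4 h6.
    split => i; have := h i; rewrite gt_max lt_min.
      by move=> /andP[/andP[-> _] /andP[-> _]].
    by move=> /andP[/andP[_ ->] /andP[_ ->]].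
  - move=> S mS S0; rewrite -setTD.
    have -> : nu (setT `\` S) = (nu setT - nu (setT `&` S))%E by exact: chargeD.
    rewrite setTI (S0 : nu S = 0%E) sube0.
    by rewrite nuE setTI; exact: g0.
  - move=> F mF tF F0.
    have cF := @charge_semi_sigma_additive _ _ _ nu F mF tF (bigcup_measurable (fun k _ => mF k)).
    have c0 : (fun n => (\sum_(0 <= i < n) nu (F i))%E) @ \oo --> 0%E.
      by apply: cvg_near_cst; apply: nearW => n; apply: big1 => k _; exact: F0.
    exact: cvg_unique cF c0.
apply: integral_ae_eq => //.
move=> E Eab mE; rewrite integral0 -[RHS](nu0 E mE) nuE; congr (integral _ _ _).
by apply/esym/setIidl.
Qed.

End box_integrals.

Section weak_gradients.
Context {R : realType}.

Lemma smf_Cc_smooth m (f : 'rV[R]_m -> R) (Omega K : set 'rV[R]_m) :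
  smf f -> compact K -> K `<=` Omega -> (forall z, ~ K z -> f z = 0) ->
  Cc_smooth Omega f.
Proof.
move=> sf cK KO f0; split; first exact: smf_smooth_on.
have clK : closed K by apply: compact_closed.
have sK : closure [set z | f z != 0] `<=` K.
  rewrite closureE; apply: smallest_sub => // z /= fz.
  by apply: contrapT => /f0 fz0; rewrite fz0 eqxx in fz.
split; last exact: subset_trans KO.
by apply: subclosed_compact cK sK; exact: closed_closure.
Qed.

Lemma integral_supp m (A K : set 'rV[R]_m) (f : 'rV[R]_m -> R) :
  K `<=` A -> (forall z, ~ K z -> f z = 0) ->
  (\int[leb m]_(z in A) (f z)%:E = \int[leb m]_(z in K) (f z)%:E)%E.
Proof.
move=> KA f0; rewrite integral_mkcond [RHS]integral_mkcond; apply: eq_integral => z _.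
rewrite /patch; case: ifPn => [zA|]; case: ifPn => [zK|]; rewrite ?inE ?notin_setE //.
- by move=> /f0 ->.
- by move=> nA; case: nA; apply: KA; rewrite inE in zK.
Qed.

Lemma Rintegral_supp m (A K : set 'rV[R]_m) (f : 'rV[R]_m -> R) :
  K `<=` A -> (forall z, ~ K z -> f z = 0) ->
  \int[leb m]_(z in A) f z = \int[leb m]_(z in K) f z.
Proof. by move=> KA f0; rewrite /Rintegral (integral_supp KA). Qed.

Lemma integrable_mul_bounded m (K : set 'rV[R]_m) (g eta : 'rV[R]_m -> R) M :
  measurable K -> (leb m).-integrable K (EFin \o g) -> measurable_fun K eta ->
  (forall z, K z -> `|eta z| <= M) -> (leb m).-integrable K (fun z => (g z * eta z)%:E).
Proof.
move=> mK gi me hM.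
have mg : measurable_fun K g by apply/measurable_EFinP; exact: measurable_int gi.
have gM : (leb m).-integrable K (fun z => (M%:E * (g z)%:E)%E) by exact: integrableZl.
apply: le_integrable gM => //.
  by apply/measurable_EFinP; apply: measurable_funM.
move=> z Kz; rewrite -EFinM !abse_EFin lee_fin mulrC !normrM ler_wpM2r//.
by rewrite (le_trans (hM _ Kz))// ler_norm.
Qed.

(** Box bumps give vanishing integrals over boxes in Omega, hence [g] = 0 almost everywhere on each
    such box; countably many rational boxes whose closures stay in Omega cover Omega. *)
Lemma fundamental_lemma m (Omega : set 'rV[R]_m) (g : 'rV[R]_m -> R) :
  open Omega -> L1loc Omega (EFin \o g) ->
  (forall eta, Cc_smooth Omega eta -> \int[leb m]_(z in Omega) (g z * eta z) = 0) ->
  {ae leb m, forall z, Omega z -> g z = 0}.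
Proof.
move=> oO gloc g0.
have obox0 c d : box c d `<=` Omega -> (\int[leb m]_(z in obox c d) (g z)%:E = 0)%E.
  move=> cdO; apply: integral_obox_eq0; first exact: gloc (@compact_box _ _ _ _) cdO.
  move=> k.
  have b0 z : ~ box c d z -> boxbump k c d z = 0.
    by move=> ncd; apply: boxbump_out; apply: contra_not ncd; exact: obox_sub_box.
  have := g0 _ (smf_Cc_smooth (smf_boxbump k c d) (@compact_box _ _ c d) cdO b0).
  rewrite (@Rintegral_supp _ _ (box c d))//; last by move=> z /b0 ->; rewrite mulr0.
  rewrite /Rintegral => /eqP; rewrite fine_eq0; first by move=> /eqP.
  apply: integrable_fin_num; first exact: measurable_box.
  apply: (@integrable_mul_bounded _ _ _ _ 1).
  - exact: measurable_box.
  - exact: gloc (@compact_box _ _ _ _) cdO.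
  - by apply: smf_measurable; exact: smf_boxbump.
  - by move=> z _; have /andP[h1 h2] := boxbump_itv k c d z; rewrite ger0_norm.
pose lo (q : 'rV[rat]_m * nat) (i : 'I_m) : R := map_mx ratr q.1 ord0 i - q.2.+1%:R^-1.
pose hi (q : 'rV[rat]_m * nat) (i : 'I_m) : R := map_mx ratr q.1 ord0 i + q.2.+1%:R^-1.
have aeq q : box (lo q) (hi q) `<=` Omega ->
    {ae leb m, forall z, obox (lo q) (hi q) z -> g z = 0}.
  move=> qO; have := @obox_ae_eq0 _ _ g (lo q) (hi q) (gloc _ (@compact_box _ _ _ _) qO).
  have h c d : box c d `<=` box (lo q) (hi q) -> (\int[leb m]_(z in obox c d) (g z)%:E = 0)%E.
    by move=> h; apply: obox0; exact: subset_trans qO.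
  by move=> /(_ h); apply: filterS => z /= + oz => /(_ oz) [].
(* The exceptional sets are collected along an enumeration of the rational boxes. *)
have : {ae leb m, forall z, forall n : nat, forall q, unpickle n = Some q ->
    box (lo q) (hi q) `<=` Omega -> obox (lo q) (hi q) z -> g z = 0}.
  apply: ae_foralln => n; case: (unpickle n) => [q|]; last by apply: aeW.
  have [qO|nqO] := pselect (box (lo q) (hi q) `<=` Omega).
    by have := aeq q qO; apply: filterS => z gz _ [<-] _; exact: gz.
  by apply: aeW => z q' [<-].
apply: filterS => z gz Oz.
have /nbhs_ballP[e /= e0 zeO] : nbhs z Omega by apply: open_nbhs_nbhs.
have e30 : 0 < e / 3 by rewrite divr_gt0.
have oB : open (ball z (e / 3)) by apply: ball_open.
have := @open_rV_bigcup R m _ oB.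
move=> /seteqP[+ _] => /(_ z (ballxx z e30))[q _].
case: asboolP => // qz zq.
have qball : ball (map_mx (@ratr R) q.1) q.2.+1%:R^-1 = obox (lo q) (hi q).
  by rewrite ball_obox// invr_gt0.
apply: (gz (pickle q) q); [exact: pickleK| |by rewrite -qball].
move=> y yq; apply: zeO.
have qc : ball (map_mx (@ratr R) q.1) q.2.+1%:R^-1 (map_mx (@ratr R) q.1).
  by apply: ballxx; rewrite invr_gt0.
(* A point y of the closed box may lie outside the ball of radius e/3 around z, but the centre and
   its midpoint with y do not. As y is twice the midpoint minus the centre, its distance to z is
   below 3 (e/3). *)
have qd : ball (map_mx (@ratr R) q.1) q.2.+1%:R^-1 (2^-1 *: (map_mx (@ratr R) q.1 + y)).
  rewrite qball => i; have := yq i; rewrite /lo /hi !mxE.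
  have : 0 < q.2.+1%:R^-1 :> R by rewrite invr_gt0.
  set Q := ratr _; set r := _^-1; set t := y _ _.
  by move=> r0 /andP[? ?]; apply/andP; split; lra.
have [_ h1] := qz _ qc; have [_ h2] := qz _ qd.
split => // i j; have := h1 i j; have := h2 i j.
rewrite /ball/= !mxE !ltr_norml => /andP[h3 h4] /andP[h5 h6].
by apply/andP; split; lra.
Qed.

End weak_gradients.

Section weak_gradient_theory.
Context {R : realType}.

Lemma Cc_smooth_supp m (Omega : set 'rV[R]_m) eta : Cc_smooth Omega eta ->
  exists K, [/\ compact K, K `<=` Omega & forall z, ~ K z -> eta z = 0].
Proof.
move=> [_ [cK KO]]; exists (closure [set z | eta z != 0]); split => // z nz.
by apply: contrapT => /eqP ez; apply: nz; exact: subset_closure.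
Qed.

Lemma Cc_smooth_continuous m (Omega : set 'rV[R]_m) eta :
  Cc_smooth Omega eta -> continuous eta.
Proof. by move=> [se _] z; have [] := se [::] z I. Qed.

Lemma Cc_smooth_partial_continuous m (Omega : set 'rV[R]_m) eta i :
  Cc_smooth Omega eta -> continuous (partial i eta).
Proof. by move=> [se _] z; have [] := se [:: i] z I. Qed.

Lemma Cc_smooth_is_derive m (Omega : set 'rV[R]_m) (eta : 'rV[R]_m -> R) i z :
  Cc_smooth Omega eta -> is_derive z (delta_mx ord0 i) eta (partial i eta z).
Proof. by move=> [se _]; have [_ /(_ i)] := se [::] z I; exact: derivableP. Qed.

Lemma partial_supp m (K : set 'rV[R]_m) (f : 'rV[R]_m -> R) i : closed K ->
  (forall z, ~ K z -> f z = 0) -> forall z, ~ K z -> partial i f z = 0.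
Proof.
move=> cK f0 z nz; rewrite /partial (@near_eq_derive _ _ _ f (cst 0)) ?derive_cst//.
have : nbhs z (~` K) by apply: open_nbhs_nbhs; split => //; exact: closed_openC.
by apply: filterS => w; exact: f0.
Qed.

Lemma L1loc_continuous m (Omega : set 'rV[R]_m) (f : 'rV[R]_m -> R) :
  continuous f -> L1loc Omega (EFin \o f).
Proof.
move=> cf K cK KO; have [r Kr] := compact_sub_cube cK.
exact: integrable_continuous_compact (measurable_compact_rV cK) Kr cf.
Qed.

Lemma L1loc_mul_integrable m (Omega : set 'rV[R]_m) (g eta : 'rV[R]_m -> R) K :
  L1loc Omega (EFin \o g) -> compact K -> K `<=` Omega -> continuous eta ->
  (leb m).-integrable K (fun z => (g z * eta z)%:E).
Proof.
move=> gl cK KO ce; have [M _ hM] := continuous_bounded_on cK ce.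
apply: integrable_mul_bounded hM.
- exact: measurable_compact_rV.
- exact: gl.
- by apply: measurable_funTS; exact: continuous_measurable_rV.
Qed.

(** The product of [u] and [eta] has compact support, so its partial derivative has integral 0 over
    the whole space. *)
Lemma by_parts m (Omega : set 'rV[R]_m) (u eta : 'rV[R]_m -> R) i :
  smf u -> Cc_smooth Omega eta ->
  \int[leb m]_(z in Omega) (u z * partial i eta z) =
  - \int[leb m]_(z in Omega) (partial i u z * eta z).
Proof.
move=> su se; have [K [cK KO e0]] := Cc_smooth_supp se.
have ce := Cc_smooth_continuous se.
have cde := Cc_smooth_partial_continuous (i := i) se.
have clK : closed K by apply: compact_closed.
have de0 := partial_supp i clK e0.
have cu := smf_continuous su.
have cdu := smf_continuous (partial_smf i su).
rewrite (@Rintegral_supp _ _ _ K)//; last by move=> z /de0 ->; rewrite mulr0.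
rewrite (@Rintegral_supp _ _ _ K _ KO)//; last by move=> z /e0 ->; rewrite mulr0.
apply/eqP; rewrite -addr_eq0 -RintegralD; last 3 first.
- exact: measurable_compact_rV.
- by apply: (L1loc_mul_integrable _ cK KO cde); exact: L1loc_continuous.
- by apply: (L1loc_mul_integrable _ cK KO ce); exact: L1loc_continuous.
rewrite -(@Rintegral_supp _ _ setT K)//; last first.
  by move=> z nz; rewrite de0// e0// !mulr0 addr0.
have [r Kr] := compact_sub_cube cK.
have cg : continuous (fun z => u z * partial i eta z + partial i u z * eta z).
  move=> z; apply: (@continuousD _ _ _ (fun z => u z * partial i eta z) (fun z => partial i u z * eta z)).
    by apply: (@continuousM _ _ u (partial i eta)); [exact: cu|exact: cde].
  by apply: (@continuousM _ _ (partial i u) eta); [exact: cdu|exact: ce].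
rewrite /Rintegral (_ : (\int[leb m]_z _)%E = 0%E)//.
apply: (@integral_partial0 _ m (fun z => u z * eta z) _ i r) => [z||z nz].
- move: (is_derive_mul (smf_is_derive i z su) (Cc_smooth_is_derive i z se)) => h.
  by apply: is_derive_eq h _; rewrite addrC.
- exact: cg.
- by rewrite e0 ?mulr0//; apply: contra_not nz; exact: Kr.
Qed.

Lemma weak_gradient_smf m (Omega : set 'rV[R]_m) (u : 'rV[R]_m -> R) :
  smf u -> weak_gradient Omega u (grad u).
Proof.
move=> su; split => [i|eta se i].
  rewrite (_ : (fun z => _) = EFin \o (partial i u)).
    by apply: L1loc_continuous; apply: smf_continuous; exact: partial_smf.
  by apply/funext => z; rewrite /= mxE.
by rewrite by_parts//; congr (- _); apply: eq_Rintegral => z _; rewrite mxE.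
Qed.

(** Each coordinate of the difference integrates to 0 against all test functions. *)
Lemma weak_gradient_unique m (Omega : set 'rV[R]_m) v (G G' : 'rV[R]_m -> 'rV[R]_m) :
  open Omega -> weak_gradient Omega v G -> weak_gradient Omega v G' ->
  {ae leb m, forall z, Omega z -> G z = G' z}.
Proof.
move=> oO [Gl GE] [Gl' GE'].
have h i : {ae leb m, forall z, Omega z -> G z ord0 i - G' z ord0 i = 0}.
  apply: fundamental_lemma => // [K cK KO|eta se].
    rewrite (_ : _ \o _ = (fun z => (G z ord0 i)%:E - (G' z ord0 i)%:E)%E).
      apply: integrableB; [exact: measurable_compact_rV|exact: Gl|exact: Gl'].
    by apply/funext => z; rewrite /= EFinB.
  have [K [cK KO e0]] := Cc_smooth_supp se.
  have ce := Cc_smooth_continuous se.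
  have := GE eta se i; rewrite GE'// => /oppr_inj.
  rewrite (@Rintegral_supp _ _ _ K _ KO); last by move=> z /e0 ->; rewrite mulr0.
  rewrite (@Rintegral_supp _ _ _ K _ KO); last by move=> z /e0 ->; rewrite mulr0.
  rewrite (@Rintegral_supp _ _ _ K _ KO); last by move=> z /e0 ->; rewrite mulr0.
  move=> GG'; rewrite (_ : (fun z => _) = (fun z => G z ord0 i * eta z - G' z ord0 i * eta z)); last first.
    by apply/funext => z; rewrite mulrBl.
  rewrite RintegralB ?GG' ?subrr//.
  - exact: measurable_compact_rV.
  - exact: (L1loc_mul_integrable (Gl i) cK KO ce).
  - exact: (L1loc_mul_integrable (Gl' i) cK KO ce).
have : {ae leb m, forall z, forall i : 'I_m, Omega z -> G z ord0 i - G' z ord0 i = 0}.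
  exact: (@filter_forall _ _ (fun i z => Omega z -> G z ord0 i - G' z ord0 i = 0)).
apply: filterS => z hz Oz; apply/rowP => i.
by apply/eqP; rewrite -subr_eq0 hz.
Qed.

Lemma weak_gradient_Dw m (Omega : set 'rV[R]_m) v G :
  weak_gradient Omega v G -> weak_gradient Omega v (Dw Omega v).
Proof. by move=> vG; apply: (@xgetPex _ (fun=> 0) [set G | weak_gradient Omega v G]); exists G. Qed.

Lemma Dw_smf m (Omega : set 'rV[R]_m) (u : 'rV[R]_m -> R) :
  open Omega -> smf u -> {ae leb m, forall z, Omega z -> Dw Omega u z = grad u z}.
Proof.
move=> oO su; have gu := weak_gradient_smf Omega su.
exact: weak_gradient_unique oO (weak_gradient_Dw gu) gu.
Qed.

End weak_gradient_theory.

(** * One-sided mollifiers and the increment along the axis *)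

Section mollification.
Context {R : realType}.
Local Notation mu := (@lebesgue_measure R).

(** The derivative of t -> step((k+1) t): a density of mass 1 on [0, 1/(k+1)] whose primitive is
    explicit and again smooth. *)
Definition dstep k (t : R) : R := k.+1%:R * derive1 step (k.+1%:R * t).

Lemma elem_dstep k : elem (dstep k).
Proof.
apply: elem_mul; first exact: elem_cst.
apply: elem_comp; first exact/elem_derive1/elem_step.
by apply: elem_mul; [exact: elem_cst|exact: elem_id].
Qed.

Lemma dstep_ge0 k t : 0 <= dstep k t.
Proof. by rewrite mulr_ge0// step_derive_ge0. Qed.

Lemma dstep_out k t : ~~ (0 <= t <= k.+1%:R^-1) -> dstep k t = 0.
Proof.
rewrite negb_and -!ltNge /dstep => /orP[h|h].
  by rewrite step_derive_lt0 ?mulr0// pmulr_rlt0.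
rewrite step_derive_gt1 ?mulr0//.
by rewrite -div1r ltr_pdivrMr// mulrC in h.
Qed.

Lemma is_derive_step_scaled k (c t : R) :
  is_derive t (1 : R) (fun s => step (k.+1%:R * (s - c))) (dstep k (t - c)).
Proof.
have h : is_derive t (1 : R) (fun s => k.+1%:R * (s - c)) k.+1%:R.
  apply: (is_derive_eq (is_derive_mul (is_derive_const _ _ _)
    (is_derive_sub (is_derive_id _ _) (is_derive_const _ _ _)))).
  by rewrite /=; ring.
apply: (is_derive_eq (is_derive1_chain (elem_is_derive _ elem_step) h)).
by rewrite /dstep mulrC.
Qed.

Lemma measurable_elem (f : R -> R) : elem f -> measurable_fun setT f.
Proof. by move=> ef; apply: continuous_measurable_fun; exact: elem_continuous. Qed.

Lemma elem_shift (f : R -> R) c : elem f -> elem (fun t => f (t - c)).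
Proof.
by move=> ef; apply: elem_comp => //; apply: elem_sub; [exact: elem_id|exact: elem_cst].
Qed.

Lemma integral_dstep k c : (\int[mu]_t (dstep k (t - c))%:E = 1)%E.
Proof.
have kp : 0 < k.+1%:R^-1 :> R by rewrite invr_gt0.
have ab : c < c + k.+1%:R^-1 by rewrite ltrDl.
rewrite (integral_compact_derivative ab (is_derive_step_scaled k c)).
- have -> : c + k.+1%:R^-1 - c = k.+1%:R^-1 by rewrite addrC addKr.
  by rewrite mulfV// subrr mulr0 step_ge1// step_le0// subr0.
- exact/elem_continuous/elem_shift/elem_dstep.
- by move=> t h; apply: dstep_out; rewrite subr_ge0 lerBlDl.
Qed.

Definition moll m k (p z : 'rV[R]_m) : R := \prod_(i < m) dstep k (z ord0 i - p ord0 i).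

Lemma smf_moll m k (p : 'rV[R]_m) : smf (moll k p).
Proof.
apply: smf_prod => i; apply: (@smf_coord _ _ (fun t => dstep k (t - p ord0 i))).
by apply: elem_shift; exact: elem_dstep.
Qed.

Lemma moll_ge0 m k (p z : 'rV[R]_m) : 0 <= moll k p z.
Proof. by apply: prodr_ge0 => i _; exact: dstep_ge0. Qed.

Definition mollbox m k (p : 'rV[R]_m) : set 'rV[R]_m :=
  box (p ord0) (fun i => p ord0 i + k.+1%:R^-1).

Lemma moll_out m k (p z : 'rV[R]_m) : ~ mollbox k p z -> moll k p z = 0.
Proof.
move=> /existsNP[i /negP h]; rewrite /moll (bigD1 i)//= dstep_out ?mul0r//.
by apply: contra h; rewrite subr_ge0 lerBlDl.
Qed.

Lemma EFin_prod (I : Type) (s : seq I) (f : I -> R) :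
  (\prod_(i <- s) f i)%:E = (\big[*%E/1]_(i <- s) (f i)%:E)%E.
Proof. by elim: s => [|i s IH]; rewrite ?big_nil// !big_cons EFinM IH. Qed.

Lemma integral_moll m k (p : 'rV[R]_m) : (\int[leb m]_z (moll k p z)%:E = 1)%E.
Proof.
under eq_integral do rewrite EFin_prod.
rewrite (integral_prod_coord (f := fun i t => (dstep k (t - p ord0 i))%:E)).
- by apply: big1_seq => i _; exact: integral_dstep.
- move=> i; apply/measurable_EFinP; apply: measurable_elem.
  by apply: elem_shift; exact: elem_dstep.
- by move=> i t; rewrite lee_fin dstep_ge0.
Qed.

Lemma mollbox_near m (p : 'rV[R]_m) (A : set 'rV[R]_m) : nbhs p A ->
  \forall k \near \oo, mollbox k p `<=` A.
Proof.
move=> /nbhs_ballP[e /= e0 eA]; near=> k; move=> z zp; apply: eA; split => // i j.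
have ke : k.+1%:R^-1 < e by near: k; exact: (near_infty_natSinv_lt (PosNum e0)).
rewrite ord1 /ball/= ltr_distlC; have /andP[h1 h2] := zp j.
by apply/andP; split; [rewrite (lt_le_trans _ h1)// gtrBl|rewrite (le_lt_trans h2)// ltrD2l].
Unshelve. all: by end_near. Qed.

Lemma integrable_supp m (A K : set 'rV[R]_m) (f : 'rV[R]_m -> R) :
  measurable A -> measurable K -> K `<=` A -> (forall z, ~ K z -> f z = 0) ->
  (leb m).-integrable K (EFin \o f) -> (leb m).-integrable A (EFin \o f).
Proof.
move=> mA mK KA f0 /(integrable_mkcond _ mK).1 h; apply/(integrable_mkcond _ mA).2.
move: h; congr (_.-integrable _ _); apply/funext => z.
rewrite /patch; case: ifPn => [zK|]; case: ifPn => [zA|]; rewrite ?inE ?notin_setE //.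
- by move=> nA; case: nA; apply: KA; rewrite inE in zK.
- by move=> /f0 /= ->.
Qed.

(** For large k the support of the mollifier lies in the part of Omega where [w] is within e of
    [w p]. There [w] is bounded, whence integrability, and the average against a mass 1 stays within
    e. *)
Lemma moll_near m (Omega : set 'rV[R]_m) (w : 'rV[R]_m -> R) (p : 'rV[R]_m) (e : R) :
  open Omega -> Omega p -> measurable_fun Omega w -> {for p, continuous w} -> 0 < e ->
  \forall k \near \oo,
    (leb m).-integrable Omega (EFin \o (fun z => w z * moll k p z)) /\
   `|\int[leb m]_(z in Omega) (w z * moll k p z) - w p| <= e.
Proof.
move=> oO Op mw cw e0.
have n1 : nbhs p (Omega `&` [set z | `|w z - w p| <= e]).
  apply: filterI; first exact: open_nbhs_nbhs.
  by move/cvgrPdist_le : cw => /(_ _ e0); apply: filterS => z /=; rewrite distrC.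
have := mollbox_near n1; apply: filterS => k kO.
have kO1 : mollbox k p `<=` Omega by move=> z /kO[].
have mb : measurable (mollbox k p) by exact: measurable_box.
have cb : compact (mollbox k p) by exact: compact_box.
have [r kr] := compact_sub_cube cb.
have mw' : measurable_fun (mollbox k p) w by apply: measurable_funS mw => //; exact: open_measurable_rV.
have [M M0 hM] := continuous_bounded_on cb (smf_continuous (smf_moll k p)).
have mm : measurable_fun (mollbox k p) (moll k p) by apply: smf_measurable; exact: smf_moll.
have im : (leb m).-integrable (mollbox k p) (EFin \o moll k p).
  exact: integrable_bounded mb kr mm hM.
have iw : (leb m).-integrable (mollbox k p) (EFin \o w).
  apply: (@integrable_bounded _ _ _ _ r (`|w p| + e)) => // z /kO[_ /= h].
  by rewrite -[w z](subrK (w p)) addrC (le_trans (ler_normD _ _))// lerD2l.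
have m1 : \int[leb m]_(z in mollbox k p) moll k p z = 1.
  rewrite -(@Rintegral_supp _ _ setT)//; last exact: moll_out.
  by rewrite /Rintegral integral_moll.
have iwm : (leb m).-integrable (mollbox k p) (fun z => (w z * moll k p z)%:E).
  exact: integrable_mul_bounded hM.
split.
  apply: integrable_supp iwm => //; first exact: open_measurable_rV.
  by move=> z /moll_out ->; rewrite mulr0.
have izm c : (leb m).-integrable (mollbox k p) (EFin \o (fun z => c * moll k p z)).
  rewrite (_ : _ \o _ = (fun z => c%:E * (moll k p z)%:E)%E); first exact: integrableZl.
  by apply/funext => z; rewrite /= EFinM.
rewrite (@Rintegral_supp _ _ _ (mollbox k p))//; last by move=> z /moll_out ->; rewrite mulr0.
rewrite -[w p]mulr1 -m1 -RintegralZl// -RintegralB//.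
rewrite (_ : (fun z => _) = fun z => (w z - w p) * moll k p z); last first.
  by apply/funext => z; rewrite mulrBl.
have iwp : (leb m).-integrable (mollbox k p) (fun z => ((w z - w p) * moll k p z)%:E).
  apply: integrable_mul_bounded hM => //.
  rewrite (_ : _ \o _ = (fun z => (w z)%:E - (w p)%:E)%E).
    apply: integrableB => //.
    apply: (@integrable_bounded _ _ _ (fun=> w p) r (`|w p|)) => //.
  by apply/funext => z.
rewrite (le_trans (le_normr_Rintegral mb iwp))//.
rewrite -[leRHS]mulr1 -m1 -RintegralZl//.
apply: le_Rintegral => //.
- by have := integrable_abse iwp.
- move=> z /kO[_ /= h]; rewrite normrM (ger0_norm (moll_ge0 _ _ _)).
  by rewrite ler_wpM2r// moll_ge0.
Qed.

End mollification.

Section axis_bound.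
Context {R : realType}.

Opaque step dstep.

(* A smooth approximation of the indicator of the segment [a, b] of the first
   axis, normalised transversally: its derivative along the axis is a difference
   of mollifiers at both ends. *)
Definition axis_test n k (a b : R) (z : 'rV[R]_n.+1) : R :=
  (step (k.+1%:R * (z ord0 ord0 - a)) - step (k.+1%:R * (z ord0 ord0 - b))) *
  \prod_(j < n) dstep k (z ord0 (lift ord0 j)).

Definition axis_pt n (c : R) : 'rV[R]_n.+1 := c *: delta_mx ord0 ord0.

Lemma axis_pt0 n (c : R) : axis_pt n c ord0 ord0 = c.
Proof. by rewrite !mxE/= mulr1. Qed.

Lemma axis_ptS n (c : R) j : axis_pt n c ord0 (lift ord0 j) = 0.
Proof. by rewrite !mxE/= mulr0. Qed.

Lemma elem_step_scaled k (c : R) : elem (fun s => step (k.+1%:R * (s - c))).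
Proof.
apply: elem_comp; first exact: elem_step.
apply: elem_mul; first exact: elem_cst.
by apply: elem_sub; [exact: elem_id|exact: elem_cst].
Qed.

Lemma smf_axis_test n k a b : smf (@axis_test n k a b).
Proof.
apply: smf_mul.
  apply: (@smf_coord _ _ (fun s => step (k.+1%:R * (s - a)) - step (k.+1%:R * (s - b)))).
  by apply: elem_sub; exact: elem_step_scaled.
by apply: smf_prod => j; apply: smf_coord; exact: elem_dstep.
Qed.

Lemma moll_axis n k c (z : 'rV[R]_n.+1) : moll k (axis_pt n c) z =
  dstep k (z ord0 ord0 - c) * \prod_(j < n) dstep k (z ord0 (lift ord0 j)).
Proof.
rewrite /moll big_ord_recl [X in dstep k (_ - X)](axis_pt0 n c).
apply: f_equal2; first by [].
apply: eq_bigr => j _; congr dstep.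
by rewrite [X in _ - X]axis_ptS subr0.
Qed.

Lemma partial_axis_test n k a b : partial ord0 (@axis_test n k a b) =
  fun z => moll k (axis_pt n a) z - moll k (axis_pt n b) z.
Proof.
apply: partial_eq => z; rewrite !moll_axis -mulrBl.
have h1 : is_derive z (delta_mx ord0 ord0) (fun z : 'rV[R]_n.+1 =>
    step (k.+1%:R * (z ord0 ord0 - a)) - step (k.+1%:R * (z ord0 ord0 - b)))
    (dstep k (z ord0 ord0 - a) - dstep k (z ord0 ord0 - b)).
  have := is_derive_chain (is_derive_sub (is_derive_step_scaled k a (z ord0 ord0))
    (is_derive_step_scaled k b (z ord0 ord0))) (is_derive_coord ord0 ord0 z).
  by rewrite eqxx mulr1.
have h2 : is_derive z (delta_mx ord0 ord0) (fun z : 'rV[R]_n.+1 =>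
    \prod_(j < n) dstep k (z ord0 (lift ord0 j))) 0.
  apply/is_derive_line.
  rewrite (_ : (fun _ => _) = fun=> \prod_(j < n) dstep k (z ord0 (lift ord0 j))).
    exact: is_derive_const.
  by apply/funext => h; apply: eq_bigr => j _; rewrite !mxE/= mulr0 add0r.
by apply: is_derive_eq (is_derive_mul h1 h2) _; rewrite mulr0 addr0.
Qed.

(** The steps and mollifiers being one-sided, the support of [axis_test] exceeds the segment by [d]
    at the end b and on the positive side of each transverse coordinate. *)
Definition slab n (a b d : R) : set 'rV[R]_n.+1 :=
  [set z | a <= z ord0 ord0 <= b + d /\ forall j, 0 <= z ord0 (lift ord0 j) <= d].

Lemma slab_box n a b d : @slab n a b d = box (fun i => if i == ord0 then a else 0)
  (fun i => if i == ord0 then b + d else d).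
Proof.
apply/seteqP; split => [z [h1 h2] i|z h].
  by case: (unliftP ord0 i) => [j|] ->.
split; first by have := h ord0.
by move=> j; have := h (lift ord0 j).
Qed.

Lemma axis_test_out n k a b z : a <= b -> ~ slab a b k.+1%:R^-1 z -> @axis_test n k a b z = 0.
Proof.
move=> ab nz; rewrite /axis_test.
have [h2|] := pselect (forall j, 0 <= z ord0 (lift ord0 j) <= k.+1%:R^-1); last first.
  move=> /existsNP[j /negP h]; rewrite [X in _ * X](bigD1 j)//= dstep_out// mul0r mulr0//.
have : ~~ (a <= z ord0 ord0 <= b + k.+1%:R^-1) by apply/negP => h1; exact: nz.
have k0 : 0 < k.+1%:R :> R by [].
rewrite negb_and -!ltNge => /orP[h|h].
  rewrite !step_le0 ?subrr ?mul0r// pmulr_rle0// subr_le0 ?(ltW h)//.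
  by rewrite (le_trans (ltW h)).
have h' : 1 <= k.+1%:R * (z ord0 ord0 - b).
  by rewrite mulrC -ler_pdivrMr// div1r lerBrDl ltW.
rewrite !step_ge1 ?subrr ?mul0r//.
by rewrite (le_trans h')// ler_pM2l// lerD2l lerN2.
Qed.

(** In absolute value the function is at most the indicator of [a, b + 1/(k+1)] times transverse
    densities of mass 1. *)
Lemma integral_abs_axis_test n k a b : a <= b ->
  (\int[leb n.+1]_z `|axis_test k a b z|%:E <= (b - a + k.+1%:R^-1)%:E)%E.
Proof.
move=> ab; set d := k.+1%:R^-1.
have d0 : 0 < d :> R by rewrite invr_gt0.
pose f (i : 'I_n.+1) (t : R) : \bar R :=
  if i == ord0 then (\1_`[a, b + d] t)%:E else (dstep k t)%:E.
have mf i : measurable_fun setT (f i).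
  rewrite /f; case: eqP => _; apply/measurable_EFinP; first exact: measurable_indic.
  by apply: measurable_elem; exact: elem_dstep.
have f0 i t : (0 <= f i t)%E.
  by rewrite /f; case: eqP => _; rewrite lee_fin// dstep_ge0.
have -> : ((b - a + d)%:E = \int[leb n.+1]_z \big[*%E/1]_(i < n.+1) f i (z ord0 i))%E.
  rewrite integral_prod_coord// big_ord_recl big1 ?mule1.
    rewrite /f eqxx integral_indic//= setIT lebesgue_measure_itv/= lte_fin.
    by rewrite ifT; [rewrite -EFinB addrAC|rewrite (le_lt_trans ab)// ltrDl].
  by move=> j _; rewrite -[RHS](integral_dstep k 0); apply: eq_integral => t _; rewrite subr0.
apply: ge0_le_integral => //.
- apply/measurable_EFinP; apply: measurableT_comp => //.
  by apply: smf_measurable; exact: smf_axis_test.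
- exact: measurable_prod_coord.
move=> z _; rewrite big_ord_recl {1}/f eqxx.
rewrite (_ : (\big[*%E/1]_(i < n) f (lift ord0 i) (z ord0 (lift ord0 i)) =
   (\prod_(j < n) dstep k (z ord0 (lift ord0 j)))%:E)%E); last by rewrite EFin_prod.
rewrite -EFinM lee_fin.
have p0 : 0 <= \prod_(j < n) dstep k (z ord0 (lift ord0 j)).
  by apply: prodr_ge0 => j _; exact: dstep_ge0.
have [zs|nz] := pselect (slab a b d z); last first.
  by rewrite axis_test_out// normr0 mulr_ge0.
rewrite /axis_test normrM (ger0_norm p0) ler_wpM2r//.
rewrite indicE mem_set/=; last by rewrite in_itv/=; case: zs.
have := step_ge0 (k.+1%:R * (z ord0 ord0 - a)); have := step_le1 (k.+1%:R * (z ord0 ord0 - a)).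
have := step_ge0 (k.+1%:R * (z ord0 ord0 - b)); have := step_le1 (k.+1%:R * (z ord0 ord0 - b)).
by move=> ? ? ? ?; rewrite ler_norml; apply/andP; split; lra.
Qed.

(** The segment is a null set, so the almost everywhere bound on [G] says nothing about it directly.
    Testing the weak gradient with [axis_test] compares averages of [w] near the two ends with an
    integral of [G] over a thin tube, bounded by the L^1 norm of the test function; continuity of
    [w] at the ends allows the limit. *)
Lemma axis_increment n (Omega : set 'rV[R]_n.+1) w G (a b d : R) :
  open Omega -> weak_gradient Omega w G -> measurable_fun Omega w ->
  {ae leb n.+1, forall z, Omega z -> `|G z ord0 ord0| <= 1} ->
  a <= b -> 0 < d -> slab a b d `<=` Omega ->
  {for axis_pt n a, continuous w} -> {for axis_pt n b, continuous w} ->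
  w (axis_pt n b) - w (axis_pt n a) <= b - a.
Proof.
move=> oO [Gl GE] mw G1 ab d0 dO ca cb.
have mO : measurable Omega by exact: open_measurable_rV.
have Oa : Omega (axis_pt n a).
  apply: dO; split; first by rewrite axis_pt0 lexx/= ler_wpDr// ltW.
  by move=> j; rewrite axis_ptS lexx ltW.
have Ob : Omega (axis_pt n b).
  apply: dO; split; first by rewrite axis_pt0 ab/= lerDl ltW.
  by move=> j; rewrite axis_ptS lexx ltW.
apply/ler_addgt0Pr => e e0.
have e30 : 0 < e / 3 by rewrite divr_gt0.
(* The three errors: the averages at both ends and the excess length of the tube. *)
have aux (x y Ia Ib S r : R) : `|Ia - x| <= e / 3 -> `|Ib - y| <= e / 3 ->
    Ia - Ib = - S -> r < e / 3 -> S <= b - a + r -> y - x <= b - a + e.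
  by rewrite !ler_norml => /andP[? ?] /andP[? ?] ? ? ?; lra.
near \oo => k.
have [ia ha] : (leb n.+1).-integrable Omega (EFin \o (fun z => w z * moll k (axis_pt n a) z)) /\
    `|\int[leb n.+1]_(z in Omega) (w z * moll k (axis_pt n a) z) - w (axis_pt n a)| <= e / 3.
  by near: k; exact: moll_near.
have [ib hb] : (leb n.+1).-integrable Omega (EFin \o (fun z => w z * moll k (axis_pt n b) z)) /\
    `|\int[leb n.+1]_(z in Omega) (w z * moll k (axis_pt n b) z) - w (axis_pt n b)| <= e / 3.
  by near: k; exact: moll_near.
have ke : k.+1%:R^-1 < e / 3 by near: k; exact: (near_infty_natSinv_lt (PosNum e30)).
have kd : k.+1%:R^-1 < d by near: k; exact: (near_infty_natSinv_lt (PosNum d0)).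
have kO : slab a b k.+1%:R^-1 `<=` Omega.
  apply: subset_trans dO => z [/andP[h1 h2] h3]; split.
    by rewrite h1 (le_trans h2)// lerD2l ltW.
  by move=> j; have /andP[h4 h5] := h3 j; rewrite h4 (le_trans h5)// ltW.
have cK : compact (@slab n a b k.+1%:R^-1) by rewrite slab_box; exact: compact_box.
have mK := measurable_compact_rV cK.
have t0 z : ~ slab a b k.+1%:R^-1 z -> @axis_test n k a b z = 0 by exact: axis_test_out.
have := GE _ (smf_Cc_smooth (smf_axis_test n k a b) cK kO t0) ord0.
rewrite partial_axis_test.
rewrite (_ : (fun z => _) = fun z => w z * moll k (axis_pt n a) z - w z * moll k (axis_pt n b) z); last first.
  by apply/funext => z; rewrite mulrBr.
rewrite (RintegralB mO ia ib) => E.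
apply: (aux _ _ _ _ _ _ ha hb E ke).
rewrite (@Rintegral_supp _ _ _ (slab a b k.+1%:R^-1))//; last by move=> z /t0 ->; rewrite mulr0.
have iG : (leb n.+1).-integrable (slab a b k.+1%:R^-1) (fun z => (G z ord0 ord0 * axis_test k a b z)%:E).
  exact: (L1loc_mul_integrable (Gl ord0) cK kO (smf_continuous (smf_axis_test n k a b))).
rewrite -lee_fin fineK; last exact: integrable_fin_num iG.
have miG := measurable_int _ iG.
rewrite (le_trans (lee_abs _))// (le_trans (le_abse_integral _ mK miG))//.
apply: le_trans (integral_abs_axis_test n k ab).
have mt : measurable_fun setT (fun z => `|@axis_test n k a b z|%:E).
  apply/measurable_EFinP; apply: measurableT_comp => //.
  by apply: smf_measurable; exact: smf_axis_test.
apply: (@le_trans _ _ (\int[leb n.+1]_(z in slab a b k.+1%:R^-1) `|axis_test k a b z|%:E)%E); last first.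
  by apply: ge0_subset_integral.
apply: ae_ge0_le_integral => //.
- by apply: measurableT_comp.
- exact: measurable_funTS.
apply: filterS G1 => z Gz /kO /Gz h /=.
by rewrite lee_fin normrM ler_piMl.
Unshelve. all: by end_near. Qed.

End axis_bound.

(** * Integrals against the charge alpha (delta_y - delta_x) + rho dx *)

Section density_measure.
Local Open Scope ereal_scope.
Context d (T : measurableType d) {R : realType} (mu : {sigma_finite_measure set T -> \bar R}).
Variable f : T -> \bar R.
Hypothesis f0 : forall x, 0 <= f x.
Hypothesis fi : mu.-integrable setT f.

(** The two hypotheses are arguments so that a finite measure structure can be attached to the set
    function itself. *)
Definition density_measure of (forall x, 0 <= f x) & mu.-integrable setT f :=
  fun A => \int[mu]_(x in A) f x.

Local Notation nu := (density_measure f0 fi).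

Let nu0 : nu set0 = 0. Proof. by rewrite /density_measure integral_set0. Qed.

Let nu_ge0 A : 0 <= nu A. Proof. by apply: integral_ge0. Qed.

Let nu_sigma : semi_sigma_additive nu.
Proof. by apply: semi_sigma_additive_nng_induced => //; exact: measurable_int fi. Qed.

HB.instance Definition _ := isMeasure.Build _ _ _ nu nu0 nu_ge0 nu_sigma.

Let nu_fin : fin_num_fun nu.
Proof.
move=> A mA; apply: integrable_fin_num => //; apply: integrableS fi => //.
Qed.

HB.instance Definition _ := @Measure_isFinite.Build _ _ _ nu nu_fin.

Let nu_dom : nu `<< mu.
Proof.
apply/null_content_dominatesP => A mA muA.
apply: null_set_integral => //; apply: measurable_funTS; exact: measurable_int fi.
Qed.

(** The change of variables of Radon and Nikodym gives the formula with the derivative of the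
    density measure, and this derivative agrees with [f] almost everywhere, both having the same
    integral over every measurable set. *)
Lemma ge0_integral_density (g : T -> \bar R) D : (forall x, 0 <= g x) -> measurable D ->
  measurable_fun D g ->
  \int[nu]_(x in D) g x = \int[mu]_(x in D) (g x * f x).
Proof.
move=> g0 mD mg.
have mf : measurable_fun setT f by exact: measurable_int fi.
have di := Radon_Nikodym_SigmaFinite.f_integrable nu_dom.
rewrite -(Radon_Nikodym_SigmaFinite.change_of_variables nu_dom)//.
apply: ae_eq_integral => //.
- apply: emeasurable_funM => //; apply: measurable_funTS; exact: measurable_int di.
- by apply: emeasurable_funM => //; exact: measurable_funTS.
apply: ae_eqe_mul2l; apply: integral_ae_eq => //.
- exact: integrableS di.
- exact: measurable_funTS.
by move=> E _ mE; rewrite -Radon_Nikodym_SigmaFinite.f_integral.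
Qed.

End density_measure.

Section dipole_charge.
Context {R : realType} {m : nat}.
Local Open Scope ereal_scope.
Variables (Omega : set 'rV[R]_m) (alpha : R) (x y : 'rV[R]_m) (f : 'rV[R]_m -> R).
Hypothesis intf : (leb m).-integrable setT (EFin \o (f \_ Omega)).
Hypothesis mO : measurable Omega.
Hypothesis a0 : (0 <= alpha)%R.
Hypotheses (Ox : Omega x) (Oy : Omega y).

Let F := EFin \o (f \_ Omega).
Let Fp := density_measure (funepos_ge0 F) (integrable_funepos measurableT intf).
Let Fn := density_measure (funeneg_ge0 F) (integrable_funeneg measurableT intf).
Let al : {nonneg R} := NngNum a0.
Let nu := dipole_source alpha x y intf.

Let dipoleE A : measurable A ->
  nu A = alpha%:E * (\d_y A - \d_x A) + (Fp A - Fn A).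
Proof.
move=> mA; transitivity (alpha%:E * (\d_y A - \d_x A) + \int[leb m]_(z in A) F z) => //.
by rewrite integralE.
Qed.

(** The Hahn decomposition behind [charge_integral] is an arbitrary choice about which nothing is
    known. Moving all negative terms across turns the Jordan decomposition into an equality of two
    positive measures, which can be integrated. *)
Let jordan_balance P N (h : hahn_decomposition nu P N) A : measurable A ->
  jordan_pos h A + (alpha%:E * \d_x A + Fn A) = jordan_neg h A + (alpha%:E * \d_y A + Fp A).
Proof.
move=> mA; have := dipoleE mA.
rewrite [LHS](jordan_decomp h mA) /cadd/= cscaleN1 /=.
have : jordan_pos h A \is a fin_num by rewrite fin_num_measure.
have : jordan_neg h A \is a fin_num by rewrite fin_num_measure.
have : Fp A \is a fin_num by rewrite fin_num_measure.
have : Fn A \is a fin_num by rewrite fin_num_measure.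
rewrite !diracE.
move: (Fp A) (Fn A) (jordan_pos h A) (jordan_neg h A) => [p| |] [q| |] [s| |] [t| |]//= _ _ _ _.
rewrite /copp/= -?EFinB -?EFinM -?EFinD => -[e]; congr EFin; lra.
Qed.

Let integral_balance P N (h : hahn_decomposition nu P N) (g : 'rV[R]_m -> R) :
  (forall z, 0 <= g z)%R -> measurable_fun Omega g ->
  \int[jordan_pos h]_(z in Omega) (g z)%:E +
    (alpha%:E * (g x)%:E + \int[leb m]_(z in Omega) ((g z)%:E * F^\- z)) =
  \int[jordan_neg h]_(z in Omega) (g z)%:E +
    (alpha%:E * (g y)%:E + \int[leb m]_(z in Omega) ((g z)%:E * F^\+ z)).
Proof.
move=> g0 mg.
have mg' : measurable_fun Omega (EFin \o g) by exact/measurable_EFinP.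
have g0' z : 0 <= (EFin \o g) z by rewrite /= lee_fin.
have g0D z : Omega z -> 0 <= (g z)%:E by rewrite lee_fin.
have split3 (m1 m3 : {measure set 'rV[R]_m -> \bar R}) c :
    \int[measure_add m1 (measure_add (mscale al \d_c) m3)]_(z in Omega) (g z)%:E =
    \int[m1]_(z in Omega) (g z)%:E + (alpha%:E * (\d_c Omega * (g c)%:E) +
      \int[m3]_(z in Omega) (g z)%:E).
  rewrite ge0_integral_measure_add//; congr (_ + _).
  rewrite ge0_integral_measure_add//; congr (_ + _).
  by rewrite ge0_integral_mscale//= integral_dirac.
have addE (m1 m3 : {measure set 'rV[R]_m -> \bar R}) c A :
    measure_add m1 (measure_add (mscale al \d_c) m3) A = m1 A + (alpha%:E * \d_c A + m3 A).
  by rewrite measure_addE; congr (_ + _); exact: measure_addE.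
have := split3 (jordan_pos h) Fn x; have := split3 (jordan_neg h) Fp y.
rewrite !diracE !mem_set// !mul1e.
rewrite (ge0_integral_density (funepos_ge0 F) (integrable_funepos measurableT intf) g0' mO mg').
rewrite (ge0_integral_density (funeneg_ge0 F) (integrable_funeneg measurableT intf) g0' mO mg').
move=> <- <-; apply: eq_measure_integral => A mA _.
by have := jordan_balance h mA; rewrite -(addE (jordan_pos h) Fn x) -(addE (jordan_neg h) Fp y).
Qed.

Let bounded_charge_integrable (mu : {finite_measure set 'rV[R]_m -> \bar R}) (g : 'rV[R]_m -> R) M :
  measurable_fun Omega g -> (forall z, Omega z -> `|g z| <= M)%R ->
  mu.-integrable Omega (EFin \o g).
Proof.
move=> mg gM; apply: measurable_bounded_integrable => //.
  by rewrite -ge0_fin_numE// fin_num_measure.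
exists M; split; first exact: num_real.
by move=> c Mc z Oz /=; rewrite (le_trans (gM _ Oz))// ltW.
Qed.

Let integrable_mul_density (g : 'rV[R]_m -> R) M (k : 'rV[R]_m -> R) :
  measurable_fun Omega g -> (forall z, Omega z -> `|g z| <= M)%R ->
  (leb m).-integrable Omega (EFin \o k) ->
  (leb m).-integrable Omega (EFin \o (fun z => k z * g z)%R).
Proof. by move=> mg gM ik; exact: integrable_mul_bounded gM. Qed.

Let Rintegral_balance P N (h : hahn_decomposition nu P N) (g : 'rV[R]_m -> R) M :
  (forall z, 0 <= g z)%R -> measurable_fun Omega g -> (forall z, Omega z -> `|g z| <= M)%R ->
  (\int[jordan_pos h]_(z in Omega) g z - \int[jordan_neg h]_(z in Omega) g z =
   alpha * (g y - g x) + \int[leb m]_(z in Omega) (f z * g z))%R.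
Proof.
move=> g0 mg gM; have := integral_balance h g0 mg.
have ip := bounded_charge_integrable (jordan_pos h) mg gM.
have iN := bounded_charge_integrable (jordan_neg h) mg gM.
have iF : (leb m).-integrable Omega F by apply: integrableS intf.
have iFp := integrable_funepos mO iF.
have iFn := integrable_funeneg mO iF.
have finp z : F^\+ z = (fine (F^\+ z))%:E by rewrite funeposE /F/= -EFin_max.
have finn z : F^\- z = (fine (F^\- z))%:E by rewrite funenegE /F/= -EFin_max.
have igp : (leb m).-integrable Omega (EFin \o (fun z => fine (F^\+ z) * g z)%R).
  apply: (integrable_mul_density mg gM).
  by move: iFp; congr (_.-integrable _ _); apply/funext.
have ign : (leb m).-integrable Omega (EFin \o (fun z => fine (F^\- z) * g z)%R).
  apply: (integrable_mul_density mg gM).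
  by move: iFn; congr (_.-integrable _ _); apply/funext.
rewrite (_ : \int[leb m]_(z in Omega) ((g z)%:E * F^\- z) =
    (\int[leb m]_(z in Omega) (fine (F^\- z) * g z))%:E); last first.
  rewrite fineK; last exact: integrable_fin_num ign.
  by apply: eq_integral => z _; rewrite {1}finn -EFinM mulrC.
rewrite (_ : \int[leb m]_(z in Omega) ((g z)%:E * F^\+ z) =
    (\int[leb m]_(z in Omega) (fine (F^\+ z) * g z))%:E); last first.
  rewrite fineK; last exact: integrable_fin_num igp.
  by apply: eq_integral => z _; rewrite {1}finp -EFinM mulrC.
rewrite -(fineK (integrable_fin_num mO ip)) -(fineK (integrable_fin_num mO iN)).
rewrite -!EFinM -!EFinD => -[].
rewrite -/(Rintegral _ _ _) -/(Rintegral _ _ _) => E.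
have -> : (\int[leb m]_(z in Omega) (f z * g z) =
    \int[leb m]_(z in Omega) (fine (F^\+ z) * g z) -
    \int[leb m]_(z in Omega) (fine (F^\- z) * g z))%R.
  rewrite -RintegralB//; apply: eq_Rintegral => z zO.
  rewrite -mulrBl; congr (_ * _)%R; apply: EFin_inj.
  rewrite EFinB -finp -finn -[RHS]/((F^\+ \- F^\-) z) -funeposneg /F /= /patch.
  by rewrite zO.
move: E; rewrite /Rintegral; lra.
Qed.

(** The balance of positive measures is used for the positive and the negative part of [w]
    separately; boundedness of [w] keeps every integral finite, so the terms can be moved back. *)
Lemma charge_integral_dipole (w : 'rV[R]_m -> R) M :
  measurable_fun Omega w -> (forall z, Omega z -> `|w z| <= M)%R ->
  (charge_integral Omega nu w =
   alpha * (w y - w x) + \int[leb m]_(z in Omega) (f z * w z))%R.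
Proof.
move=> mw wM; rewrite /charge_integral.
case: cid => P [N h] /=; case: cid => N' h' /=.
pose wp z := Num.max (w z) 0%R; pose wn z := Num.max (- w z)%R 0%R.
have wz z : (w z = wp z - wn z)%R.
  rewrite /wp /wn /Num.max.
  by case: ifP; case: ifP => //; rewrite ?oppr_lt0 ?subr0 ?sub0r ?opprK//; lra.
have wE : w = (fun z => wp z - wn z)%R by exact/funext.
have w0 z : (0 <= wp z)%R /\ (0 <= wn z)%R by rewrite /wp /wn !le_max lexx !orbT.
have mwp : measurable_fun Omega wp by exact: measurable_maxr.
have mwn : measurable_fun Omega wn by apply: measurable_maxr => //; exact: measurableT_comp.
have wpM z : Omega z -> (`|wp z| <= M)%R.
  move=> /wM zM; rewrite ger0_norm; last by case: (w0 z).
  by rewrite /wp ge_max (le_trans (ler_norm _) zM) (le_trans _ zM).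
have wnM z : Omega z -> (`|wn z| <= M)%R.
  move=> /wM zM; rewrite ger0_norm; last by case: (w0 z).
  by rewrite /wn ge_max -normrN in zM *; rewrite (le_trans (ler_norm _) zM) (le_trans _ zM).
have iF : (leb m).-integrable Omega (EFin \o f).
  by apply/(integrable_mkcond _ mO); rewrite restrict_EFin.
have Bp := Rintegral_balance h' (fun z => (w0 z).1) mwp wpM.
have Bn := Rintegral_balance h' (fun z => (w0 z).2) mwn wnM.
rewrite [in LHS]wE RintegralB//; last 2 first.
- exact: bounded_charge_integrable wpM.
- exact: bounded_charge_integrable wnM.
rewrite [X in (_ - X = _)%R]RintegralB//; last 2 first.
- exact: bounded_charge_integrable wpM.
- exact: bounded_charge_integrable wnM.
have -> : (\int[leb m]_(z in Omega) (f z * w z) =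
  \int[leb m]_(z in Omega) (f z * wp z) - \int[leb m]_(z in Omega) (f z * wn z))%R.
  rewrite -RintegralB//.
  - by apply: eq_Rintegral => z _; rewrite -mulrBr wz.
  - exact: integrable_mul_density wpM _.
  - exact: integrable_mul_density wnM _.
by move: Bp Bn; rewrite (wz y) (wz x); lra.
Qed.

End dipole_charge.

(** * The function u *)

Section singular_integrals.
Context {R : realType}.
Local Notation mu := (@lebesgue_measure R).

Lemma integral_powR_pos (gam r : R) : 0 < gam < 1 -> 0 < r ->
  (\int[mu]_(t in `]0%R, r]) (t `^ (- gam))%:E < +oo)%E.
Proof.
move=> /andP[g0 g1] r0.
have mg (A : set R) : measurable_fun A (fun t : R => (t `^ (- gam))%:E).
  by apply/measurable_EFinP; apply: measurable_funTS; exact: measurable_powR.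
(* The value at r of the primitive of t^(-gam); the value subtracted at the lower end is
   nonnegative, so the bound is uniform in k. *)
pose C : R := r `^ (1 - gam) / (1 - gam).
have h k : (\int[mu]_(t in `[k.+1%:R^-1%R, r]) (t `^ (- gam))%:E <= C%:E)%E.
  have k0 : 0 < k.+1%:R^-1 :> R by rewrite invr_gt0.
  case: (boolP (k.+1%:R^-1 < r)) => [kr|]; last first.
    rewrite -leNgt => rk.
    have [->|nkr] := eqVneq r k.+1%:R^-1.
      rewrite set_itv1 integral_set1 lee_fin divr_ge0 ?powR_ge0//.
      by rewrite subr_ge0 ltW.
    rewrite set_itv_ge ?integral_set0 ?lee_fin ?divr_ge0 ?powR_ge0//.
      by rewrite subr_ge0 ltW.
    by rewrite -leNgt leBSide/= lt_neqAle nkr.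
  pose F (t : R) := t `^ (1 - gam) / (1 - gam).
  have dF (t : R) : 0 < t -> is_derive t (1:R) F (t `^ (- gam)).
    move=> t0; apply: (is_derive_eq (is_derive_mul (is_derive1_powR (1 - gam) t0) (is_derive_const _ _ _))).
    rewrite mulr0 addr0 mulrAC mulfV ?mul1r; last by rewrite gt_eqF// subr_gt0.
    by congr (_ `^ _); ring.
  have cF (t : R) : 0 < t -> {for t, continuous F}.
    move=> t0; apply: differentiable_continuous; apply/derivable1_diffP.
    by have [] := dF t t0.
  rewrite (@continuous_FTC2 _ (fun t => t `^ (- gam)) F)//.
  - rewrite -EFinB lee_fin gerBl divr_ge0 ?powR_ge0//.
    by rewrite subr_ge0 ltW.
  - apply: continuous_in_subspaceT => t; rewrite inE/= in_itv/= => /andP[kt _].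
    have t0 : 0 < t by rewrite (lt_le_trans k0).
    apply: differentiable_continuous; apply/derivable1_diffP.
    by have [] := is_derive1_powR (- gam) t0.
  - split.
    + by move=> t; rewrite in_itv/= => /andP[kt _]; have [] := dF t (lt_trans k0 kt).
    + by apply: cvg_at_right_filter; exact: cF.
    + by apply: cvg_at_left_filter; exact: cF (lt_trans k0 kr).
  - move=> t; rewrite in_itv/= => /andP[kt _]; rewrite derive1E.
    by have [_] := dF t (lt_trans k0 kt).
have -> : `]0%R, r]%classic = \bigcup_k `[k.+1%:R^-1, r]%classic :> set R.
  apply/seteqP; split => t /=; rewrite in_itv/=.
    move=> /andP[t0 tr].
    have [k _ /(_ _ (leqnn k)) kt] := near_infty_natSinv_lt (PosNum t0).
    by exists k => //=; rewrite in_itv/= tr andbT ltW.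
  move=> [k _]; rewrite /= in_itv/= => /andP[kt ->]; rewrite andbT.
  by rewrite (lt_le_trans _ kt)// invr_gt0.
apply: (@le_lt_trans _ _ C%:E); last by rewrite ltry.
have nd : nondecreasing_seq (fun k => `[k.+1%:R^-1, r]%classic : set R).
  move=> i j ij; rewrite subsetEset => t /=; rewrite !in_itv/= => /andP[it ->].
  by rewrite (le_trans _ it)// lef_pV2 ?posrE// ler_nat.
have f0 k (t : R) : [set` `[k.+1%:R^-1, r]] t -> (0 <= (t `^ (- gam))%:E)%E.
  by move=> _; rewrite lee_fin powR_ge0.
have mI k : measurable [set` `[k.+1%:R^-1 : R, r]] by [].
have cv := @ge0_nondecreasing_set_cvg_integral _ _ _ _ _ mu nd mI (fun k => mg _) f0.
rewrite -(cvg_lim _ cv)//; apply: lime_le; last by apply: nearW => k; exact: h.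
by apply/cvg_ex; eexists; exact: cv.
Qed.

Lemma integral_powR_abs (gam r : R) : 0 < gam < 1 -> 0 < r ->
  (\int[mu]_t ((`|t| `^ (- gam)) * \1_`[- r, r] t)%:E < +oo)%E.
Proof.
move=> g01 r0; have /andP[g0 g1] := g01.
pose G (t : R) : \bar R := ((`|t| `^ (- gam)) * \1_`[- r, r] t)%:E.
have G0 t : (0 <= G t)%E by rewrite lee_fin mulr_ge0// powR_ge0.
have mG (A : set R) : measurable_fun A G.
  apply: measurable_funTS; apply/measurable_EFinP; apply: measurable_funM.
    by apply: (measurableT_comp (measurable_powR _)).
  exact: measurable_indic.
have GN t : G (- t) = G t.
  rewrite /G normrN !indicE; congr (_ * _%:R)%:E.
  by congr (nat_of_bool _); apply/idP/idP; rewrite !inE/= !in_itv/=; lra.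
have half : (\int[mu]_(t in `[0%R, +oo[) G t < +oo)%E.
  rewrite (_ : (\int[mu]_(t in _) G t = \int[mu]_(t in `]0%R, r]) (t `^ (- gam))%:E)%E).
    exact: integral_powR_pos.
  rewrite integral_mkcond [RHS]integral_mkcond; apply: eq_integral => t _.
  rewrite /patch /G; case: ifPn; case: ifPn; rewrite ?inE ?notin_setE/= ?in_itv/= ?andbT => h1 h2 //.
  - by have /andP[t0 tr] := h1; rewrite gtr0_norm// indicE mem_set ?mulr1//= in_itv/=; lra.
  (* At the singularity the power is 0 by convention, which matches the half-open interval. *)
  - have [->|tn0] := eqVneq t 0.
      by rewrite normr0 powR0 ?mul0r// oppr_eq0 gt_eqF.
    rewrite indicE memNset ?mulr0//= in_itv/= => /andP[h3 h4]; apply: h1.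
    by rewrite h4 andbT lt_neqAle eq_sym tn0.
  - by move: h1 => /andP[t0 _]; case: h2; rewrite ltW.
have UT : `]-oo, 0%R] `|` `]0%R, +oo[ = [set: R].
  by apply/seteqP; split => // t _ /=; rewrite !in_itv/= andbT; case: (leP t (0 : R)); [left|right].
have dis : [disjoint `]-oo, 0%R]%classic & (`]0%R, +oo[%classic : set R)].
  apply/disj_setPLR => t /=; rewrite !in_itv/= andbT => t0; apply/negP.
  by rewrite -leNgt.
have U := @ge0_integral_setU _ _ _ mu `]-oo, 0%R]%classic `]0%R, +oo[%classic
  (measurable_itv _) (measurable_itv _) G (mG _) (fun t _ => G0 t) dis.
rewrite -UT [X in (X < _)%E]U.
have e := ge0_integration_by_substitution0 (mG setT) G0.
apply: lte_add_pinfty.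
  rewrite (_ : (\int[mu]_(t in _) G t = \int[mu]_(t in `]-oo, 0%R]) G (- t)%R)%E).
    by rewrite -e.
  by apply: eq_integral => t _; rewrite GN.
apply: le_lt_trans half; apply: ge0_subset_integral => //; first exact: mG.
by move=> t /=; rewrite !in_itv/= !andbT => /ltW.
Qed.

Lemma negligible_coord0 m (j : 'I_m) : (leb m).-negligible [set z : 'rV[R]_m | z ord0 j = 0].
Proof.
have mS : measurable [set z : 'rV[R]_m | z ord0 j = 0].
  rewrite (_ : [set z : 'rV[R]_m | _] = (fun z : 'rV[R]_m => z ord0 j) @^-1` [set 0]).
    rewrite -[X in measurable X]setTI; exact: (measurable_coord j).
  by [].
apply/negligibleP => //.
rewrite -(setIT [set z : 'rV[R]_m | _]) -[LHS]integral_indic//.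
pose f (i : 'I_m) (t : R) : \bar R := if i == j then (\1_[set 0] t)%:E else 1%E.
have mf i : measurable_fun setT (f i).
  by rewrite /f; case: eqP => _ //; apply/measurable_EFinP; exact: measurable_indic.
have f0 i t : (0 <= f i t)%E by rewrite /f; case: eqP => _.
transitivity (\int[leb m]_z \big[*%E/1]_(i < m) f i (z ord0 i))%E.
  apply: eq_integral => z _.
  have fE : (\big[*%E/1]_(i < m) f i (z ord0 i) = (\prod_(i < m) (if i == j then \1_[set 0] (z ord0 i) else 1 : R))%:E)%E.
    by rewrite EFin_prod; apply: eq_bigr => i _; rewrite /f; case: eqP.
  rewrite fE (bigD1 j)//= eqxx big1 ?mulr1 => [|i /negbTE ->//].
  by rewrite !indicE; congr (_%:R)%:E; congr nat_of_bool; apply/idP/idP; rewrite !inE.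
rewrite integral_prod_coord//.
have fj0 : (\int[mu]_t f j t = 0)%E.
  by rewrite /f eqxx integral_indic//= setIT lebesgue_measure_set1.
have : forall s : seq 'I_m, j \in s -> (\big[*%E/1]_(i <- s) \int[mu]_t f i t = 0)%E.
  elim => // i s IH; rewrite inE big_cons => /predU1P[<-|/IH ->]; last by rewrite mule0.
  by rewrite fj0 mul0e.
by apply; rewrite mem_index_enum.
Qed.

(** Instead of polar coordinates, all n transverse bounds are used at once: N^(-th) is the product
    of n factors N^(-th/n), and the j-th is at most (c z_j^2)^(-th/n). The integral then splits into
    one-dimensional ones of |t|^(-2 th/n), finite because 2 th < n; the first coordinate contributes
    only a length. *)
Lemma singular_integrable n (A : set 'rV[R]_n.+1) (N : 'rV[R]_n.+1 -> R) (r c th : R) :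
  measurable A -> A `<=` cube n.+1 r -> measurable_fun A N ->
  0 < c -> (forall z (j : 'I_n), A z -> c * z ord0 (lift ord0 j) ^+ 2 <= N z) ->
  0 < th -> 2 * th < n%:R ->
  (leb n.+1).-integrable A (EFin \o (fun z => N z `^ (- th))).
Proof.
move=> mA Ar mN c0 hN th0 thn.
have n0 : 0 < n%:R :> R by rewrite (lt_trans _ thn)// mulr_gt0.
have r1 : 0 < `|r| + 1 by rewrite ltr_wpDl.
pose b := th / n%:R; pose gam := 2 * b.
have b0 : 0 < b by rewrite divr_gt0.
have g01 : 0 < gam < 1.
  by rewrite mulr_gt0//= /gam /b mulrA ltr_pdivrMr// mul1r.
pose e (t : R) : R := c `^ (- b) * (`|t| `^ (- gam) * \1_`[- (`|r| + 1), `|r| + 1] t).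
have e0 t : 0 <= e t by rewrite mulr_ge0 ?powR_ge0// mulr_ge0// powR_ge0.
pose f (i : 'I_n.+1) (t : R) : \bar R :=
  if i == ord0 then (\1_`[- (`|r| + 1), `|r| + 1] t)%:E else (e t)%:E.
have me : measurable_fun setT e.
  apply: measurable_funM => //; apply: measurable_funM.
    by apply: (measurableT_comp (measurable_powR _)).
  exact: measurable_indic.
have mf i : measurable_fun setT (f i).
  by rewrite /f; case: eqP => _; apply/measurable_EFinP => //; exact: measurable_indic.
have f0 i t : (0 <= f i t)%E by rewrite /f; case: eqP => _; rewrite lee_fin.
have mNth : measurable_fun A (fun z => (N z `^ (- th))%:E).
  by apply/measurable_EFinP; apply: (measurableT_comp (measurable_powR _)).
apply/integrableP; split => //.
under eq_integral do rewrite /= ger0_norm ?powR_ge0//.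
apply: (@le_lt_trans _ _ (\int[leb n.+1]_(z in A) \big[*%E/1]_(i < n.+1) f i (z ord0 i))%E).
  apply: ae_ge0_le_integral => //.
  - by move=> z _; rewrite lee_fin powR_ge0.
  - by move=> z _; exact: big_mule_ge0.
  - by apply: measurable_funTS; exact: measurable_prod_coord.
  (* The coordinate hyperplanes are set aside: there a factor of the majorant is 0 by convention and
     the comparison could fail. *)
  have ne0 : {ae leb n.+1, forall z : 'rV[R]_n.+1, forall j : 'I_n, z ord0 (lift ord0 j) != 0}.
    apply: (@filter_forall _ _ (fun (j : 'I_n) (z : 'rV[R]_n.+1) => z ord0 (lift ord0 j) != 0) (almost_everywhere (leb n.+1))) => j.
    apply: negligibleS (negligible_coord0 (lift ord0 j)) => z /=.
    by move=> /negP/negPn/eqP.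
  apply: filterS ne0 => z zn0 Az.
  have N0 : 0 < N z.
    have i0 : (0 < n)%N by rewrite -(ltr_nat R).
    apply: lt_le_trans (hN z (Ordinal i0) Az).
    by rewrite mulr_gt0// lt_def sqrf_eq0 zn0 sqr_ge0.
  have zr i : `[- (`|r| + 1), `|r| + 1]%classic (z ord0 i).
    rewrite /= in_itv/= -ler_norml (le_trans (Ar z Az i))//.
    by rewrite (le_trans (ler_norm _))// lerDl.
  rewrite big_ord_recl {1}/f eqxx indicE mem_set// mul1e.
  rewrite (_ : (\big[*%E/1]_(i < n) f (lift ord0 i) (z ord0 (lift ord0 i)) =
     (\prod_(j < n) e (z ord0 (lift ord0 j)))%:E)%E); last by rewrite EFin_prod.
  rewrite lee_fin.
  have -> : N z `^ (- th) = \prod_(j < n) N z `^ (- b).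
    rewrite prodr_const card_ord -powR_mulrn ?powR_ge0// -powRrM; congr (_ `^ _).
    by rewrite /b; field; rewrite gt_eqF.
  apply: ler_prod => j _; rewrite powR_ge0/= /e indicE mem_set// mulr1.
  have z0 : 0 < `|z ord0 (lift ord0 j)| by rewrite normr_gt0.
  rewrite (_ : - gam = 2 * - b); last by rewrite /gam; ring.
  rewrite powRrM powR_mulrn// real_normK ?num_real// -powRM ?sqr_ge0 ?(ltW c0)//.
  have zz : 0 < c * z ord0 (lift ord0 j) ^+ 2.
    by rewrite mulr_gt0// lt_def sqrf_eq0 zn0 sqr_ge0.
  rewrite !powRN lef_pV2 ?posrE ?powR_gt0//.
  by apply: ge0_ler_powR; rewrite ?nnegrE ?(ltW b0) ?(ltW zz) ?(ltW N0)//; exact: hN.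
apply: (@le_lt_trans _ _ (\int[leb n.+1]_z \big[*%E/1]_(i < n.+1) f i (z ord0 i))%E).
  apply: ge0_subset_integral => //.
  - exact: measurable_prod_coord.
  - by move=> z _; exact: big_mule_ge0.
rewrite integral_prod_coord//; apply: big_mule_lty => i.
rewrite integral_ge0//= /f; case: eqP => _.
  rewrite integral_indic//= setIT lebesgue_measure_itv/=.
  by case: ifP => _; rewrite ?ltry// -EFinB ltry.
rewrite /e; under eq_integral do rewrite EFinM.
rewrite ge0_integralZl//.
- apply: lte_mul_pinfty; rewrite ?lee_fin ?powR_ge0//.
  exact: integral_powR_abs.
- apply/measurable_EFinP; apply: measurable_funM.
    by apply: (measurableT_comp (measurable_powR _)).
  exact: measurable_indic.
- by rewrite lee_fin powR_ge0.
Qed.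

End singular_integrals.

(** * Product functions, the gap and the Hessian form *)

Section product_functions.
Context {R : realType} {n : nat}.
Variable h : 'I_n -> R -> R.
Hypothesis eh : forall i, elem (h i).

Definition iter_derive d (f : R -> R) : R -> R := iter d (fun g => derive1 g) f.

Lemma elem_iter_derive d f : elem f -> elem (iter_derive d f).
Proof. by move=> ef; elim: d => //= d; exact: elem_derive1. Qed.

(** The multi-index records how often each factor has been differentiated. A partial derivative only
    raises an index, so mixed derivatives commute because addition does. *)
Definition prodf (d : 'I_n -> nat) (z : 'rV[R]_n) : R :=
  \prod_(i < n) iter_derive (d i) (h i) (z ord0 i).

Lemma smf_prodf d : smf (prodf d).
Proof. by apply: smf_prod => i; apply: smf_coord; exact: elem_iter_derive. Qed.

Lemma partial_prodf d j : partial j (prodf d) = prodf (fun i => (d i + (i == j))%N).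
Proof.
apply: partial_eq => z.
pose P (z : 'rV[R]_n) := \prod_(i < n | i != j) iter_derive (d i) (h i) (z ord0 i).
have h1 : is_derive z (delta_mx ord0 j) (fun z : 'rV[R]_n => iter_derive (d j) (h j) (z ord0 j))
    (iter_derive (d j).+1 (h j) (z ord0 j)).
  have := is_derive_chain (elem_is_derive (z ord0 j) (elem_iter_derive (d j) (eh j)))
    (is_derive_coord j j z).
  by rewrite eqxx mulr1.
have h2 : is_derive z (delta_mx ord0 j) P 0.
  apply/is_derive_line; rewrite (_ : (fun _ => _) = fun=> P z); first exact: is_derive_const.
  apply/funext => t; apply: eq_bigr => i /negbTE ij.
  by rewrite !mxE ij/= mulr0 add0r.
rewrite (_ : prodf d = fun z => iter_derive (d j) (h j) (z ord0 j) * P z); last first.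
  by apply/funext => y; rewrite /prodf (bigD1 j).
apply: is_derive_eq (is_derive_mul h1 h2) _; rewrite mulr0 addr0.
rewrite /prodf (bigD1 j)//= eqxx addn1; congr (_ * _).
by apply: eq_bigr => i /negbTE ->; rewrite addn0.
Qed.

End product_functions.

Section calibrated_function.
Context {R : realType}.

Definition gap m (u : 'rV[R]_m -> R) (z : 'rV[R]_m) : R := 1 - \sum_i partial i u z ^+ 2.

(** The quadratic form <D^2u Du, Du>. *)
Definition hessq m (u : 'rV[R]_m -> R) (z : 'rV[R]_m) : R :=
  \sum_i \sum_j partial i u z * partial j u z * partial j (partial i u) z.

Variables (n : nat) (h k : R -> R) (H delta : R).
Hypotheses (eh : elem h) (ek : elem k).
Hypothesis hH : forall s, `|h s| <= H.
Hypothesis dh : forall s, `|derive1 h s| <= 1 ?= iff (`|s| <= 1).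
Hypothesis k0 : k 0 = 1.
Hypothesis k01 : forall t, 0 <= k t <= 1.
Hypothesis dk : forall t, derive1 k t ^+ 2 <= delta * (1 - k t ^+ 2).
Hypothesis delta0 : 0 <= delta.
Hypothesis Hd : H ^+ 2 * n%:R * delta <= 1 / 4.

Let hk (i : 'I_n.+1) : R -> R := if i == ord0 then h else k.

Let ehk i : elem (hk i). Proof. by rewrite /hk; case: eqP. Qed.

Definition calib : 'rV[R]_n.+1 -> R := prodf hk (fun=> 0%N).

Lemma smf_calib : smf calib. Proof. exact: smf_prodf. Qed.

Let P (z : 'rV[R]_n.+1) : R := \prod_(j < n) k (z ord0 (lift ord0 j)).

Let H0 : 0 <= H. Proof. exact: le_trans (normr_ge0 _) (hH 0). Qed.

Lemma calibE z : calib z = h (z ord0 ord0) * P z.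
Proof. by rewrite /calib /prodf big_ord_recl. Qed.

Let prod01 (p : pred 'I_n) (z : 'rV[R]_n.+1) :
  0 <= \prod_(j < n | p j) k (z ord0 (lift ord0 j)) <= 1.
Proof.
rewrite prodr_ge0 => [|j _]; last by case/andP: (k01 (z ord0 (lift ord0 j))).
rewrite (@le_trans _ _ (\prod_(j < n | p j) 1))//; last by rewrite big1.
by apply: ler_prod => j _; exact: k01.
Qed.

Let P01 z : 0 <= P z <= 1. Proof. exact: prod01. Qed.

Let P_le j z : P z <= k (z ord0 (lift ord0 j)).
Proof.
rewrite /P (bigD1 j)//=; have /andP[p0 p1] := prod01 (fun i => i != j) z.
by rewrite ler_piMr//; case/andP: (k01 (z ord0 (lift ord0 j))).
Qed.

Let partial0E z : partial ord0 calib z = derive1 h (z ord0 ord0) * P z.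
Proof. by rewrite /calib partial_prodf// /prodf big_ord_recl. Qed.

Let partialSE j z : partial (lift ord0 j) calib z =
  h (z ord0 ord0) * (derive1 k (z ord0 (lift ord0 j)) *
   \prod_(i < n | i != j) k (z ord0 (lift ord0 i))).
Proof.
rewrite /calib partial_prodf// /prodf big_ord_recl /=; congr (_ * _).
rewrite (bigD1 j)//= eqxx; congr (_ * _).
by apply: eq_bigr => i /negbTE ij; rewrite (inj_eq lift_inj) ij.
Qed.

Let partial00E z : partial ord0 (partial ord0 calib) z =
  derive1 (derive1 h) (z ord0 ord0) * P z.
Proof. by rewrite /calib !partial_prodf// /prodf big_ord_recl. Qed.

Let partial_comm i j z : partial j (partial i calib) z = partial i (partial j calib) z.
Proof.
rewrite /calib !partial_prodf//; congr (prodf _ _ _); apply/funext => l.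
by rewrite !add0n addnC.
Qed.

Let partial0SE j z : partial (lift ord0 j) (partial ord0 calib) z =
  derive1 h (z ord0 ord0) * (derive1 k (z ord0 (lift ord0 j)) *
   \prod_(i < n | i != j) k (z ord0 (lift ord0 i))).
Proof.
rewrite /calib !partial_prodf// /prodf big_ord_recl /=; congr (_ * _).
rewrite (bigD1 j)//= eqxx; congr (_ * _).
by apply: eq_bigr => i /negbTE ij; rewrite (inj_eq lift_inj) ij.
Qed.

Let partialS_le j z : `|partial (lift ord0 j) calib z| <= H * `|derive1 k (z ord0 (lift ord0 j))|.
Proof.
rewrite partialSE normrM; apply: ler_pM => //.
rewrite normrM; have /andP[p0 p1] := prod01 (fun i => i != j) z.
by rewrite (ger0_norm p0) ler_piMr.
Qed.

Let partial0S_le j z : `|partial (lift ord0 j) (partial ord0 calib) z| <=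
  `|derive1 k (z ord0 (lift ord0 j))|.
Proof.
rewrite partial0SE normrM; have /andP[p0 p1] := prod01 (fun i => i != j) z.
rewrite normrM (ger0_norm p0) -[leRHS]mul1r; apply: ler_pM => //.
- by rewrite mulr_ge0.
- exact: (dh _).1.
- by rewrite ler_piMr.
Qed.

Let sqr_le1 (x : R) : `|x| <= 1 -> x ^+ 2 <= 1.
Proof. by move=> x1; rewrite -(real_normK (num_real x)) expr_le1. Qed.

Let dh_sqr s : derive1 h s ^+ 2 <= 1.
Proof. by apply: sqr_le1; exact: (dh s).1. Qed.

(** Each squared transverse derivative is at most H^2 delta (1 - k(z_j)^2) <= H^2 delta (1 - P^2),
    as P <= k(z_j). By [Hd] their sum is at most a quarter of 1 - P^2, hence of 1 - (h' P)^2. *)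
Let gap_ge (z : 'rV[R]_n.+1) : 3 / 4 * (1 - (derive1 h (z ord0 ord0) * P z) ^+ 2) <= gap calib z.
Proof.
have /andP[p0 p1] := P01 z.
have hP : (derive1 h (z ord0 ord0) * P z) ^+ 2 <= P z ^+ 2.
  by rewrite exprMn ler_piMl ?sqr_ge0.
rewrite /gap big_ord_recl partial0E.
have : \sum_(j < n) partial (lift ord0 j) calib z ^+ 2 <= 1 / 4 * (1 - P z ^+ 2).
  apply: (@le_trans _ _ (\sum_(j < n) H ^+ 2 * delta * (1 - P z ^+ 2))).
    apply: ler_sum => j _.
    have : `|partial (lift ord0 j) calib z| ^+ 2 <=
        (H * `|derive1 k (z ord0 (lift ord0 j))|) ^+ 2.
      by rewrite ler_pXn2r ?nnegrE ?mulr_ge0//; exact: partialS_le.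
    rewrite exprMn !real_normK ?num_real// => /le_trans; apply.
    rewrite -mulrA ler_wpM2l ?sqr_ge0// (le_trans (dk _))// ler_wpM2l//.
    by rewrite lerD2l lerN2 ler_pXn2r ?nnegrE//; case/andP: (k01 (z ord0 (lift ord0 j))).
  rewrite sumr_const card_ord -[leLHS]mulr_natl mulrA ler_wpM2r ?subr_ge0 ?expr_le1//.
  by rewrite (le_trans _ Hd)// mulrCA mulrA.
by lra.
Qed.

Let gap_P (z : 'rV[R]_n.+1) : 3 / 4 * (1 - P z ^+ 2) <= gap calib z.
Proof.
apply: le_trans (gap_ge z); rewrite ler_wpM2l// lerD2l lerN2 exprMn.
by rewrite ler_piMl ?sqr_ge0.
Qed.

Let gap_h (z : 'rV[R]_n.+1) : 3 / 4 * (1 - derive1 h (z ord0 ord0) ^+ 2) <= gap calib z.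
Proof.
have /andP[p0 p1] := P01 z.
apply: le_trans (gap_ge z); rewrite ler_wpM2l// lerD2l lerN2 exprMn.
by rewrite ler_piMr ?sqr_ge0// expr_le1.
Qed.

Lemma gap_calib_k (z : 'rV[R]_n.+1) (j : 'I_n) : 3 / 4 * (1 - k (z ord0 (lift ord0 j)) ^+ 2) <= gap calib z.
Proof.
have /andP[p0 p1] := P01 z.
apply: le_trans (gap_P z); rewrite ler_wpM2l// lerD2l lerN2.
by rewrite ler_pXn2r ?nnegrE//; case/andP: (k01 (z ord0 (lift ord0 j))).
Qed.

Lemma gap_calib_ge0 z : 0 <= gap calib z.
Proof. by apply: le_trans (gap_h z); rewrite mulr_ge0// subr_ge0. Qed.

Lemma gap_calib_le1 z : gap calib z <= 1.
Proof. by rewrite gerBl sumr_ge0// => i _; rewrite sqr_ge0. Qed.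

Lemma gap_calib_eq0 z : gap calib z = 0 ->
  `|z ord0 ord0| <= 1 /\ forall j, k (z ord0 (lift ord0 j)) = 1.
Proof.
move=> g0; split.
  have := gap_h z; rewrite g0 pmulr_rle0// subr_le0 => h1.
  rewrite -(dh (z ord0 ord0)).2 eq_le (dh (z ord0 ord0)).1/=.
  rewrite -(@ler_pXn2r _ 2) ?nnegrE//= expr1n real_normK// num_real//.
move=> j; have := gap_calib_k z j; rewrite g0 pmulr_rle0// subr_le0 => h1.
have /andP[q0 q1] := k01 (z ord0 (lift ord0 j)).
by apply/eqP; rewrite eq_le q1/= -(@ler_pXn2r _ 2) ?nnegrE//= expr1n.
Qed.

Let dk_gap (z : 'rV[R]_n.+1) (j : 'I_n) : derive1 k (z ord0 (lift ord0 j)) ^+ 2 <= 4 / 3 * delta * gap calib z.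
Proof.
apply: (le_trans (dk _)).
rewrite (_ : 4 / 3 * delta * gap calib z = delta * (4 / 3 * gap calib z)); last by ring.
rewrite ler_wpM2l//; have := gap_calib_k z j; lra.
Qed.

Let partial_le1 i (z : 'rV[R]_n.+1) : `|partial i calib z| <= 1.
Proof.
rewrite -(@ler_pXn2r _ 2) ?nnegrE// expr1n real_normK ?num_real//.
have := gap_calib_ge0 z; rewrite /gap subr_ge0; apply: le_trans.
by rewrite (bigD1 i)//= lerDl sumr_ge0// => j _; rewrite sqr_ge0.
Qed.

(** Entries with a transverse index are O(N), which suffices since N <= 1: the mixed ones have one
    factor k' in the gradient and one in the Hessian, the purely transverse ones have both in the
    gradient and a Hessian entry bounded by [M]. The remaining entry is controlled by h'' alone, and
    this is where the loss [c] occurs. *)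
Lemma hessq_calib_le (c C M : R) : 0 < c < 1 -> 0 <= C ->
  (forall s, `|derive1 (derive1 h) s| <= C * (1 - derive1 h s ^+ 2) `^ (1 - c)) ->
  0 <= M -> (forall i j z, `|partial j (partial i calib) z| <= M) ->
  exists2 K, 0 <= K & forall z, `|hessq calib z| <= K * gap calib z `^ (1 - c).
Proof.
move=> /andP[c0 c1] C0 hC M0 hM.
have c1' : 0 <= 1 - c by rewrite subr_ge0 ltW.
pose D := 4 / 3 * delta.
have D0 : 0 <= D by rewrite mulr_ge0.
pose K := C * 2 + (H * D + H ^+ 2 * M * D).
have K0 : 0 <= K by rewrite !addr_ge0// !mulr_ge0// sqr_ge0.
exists (\sum_(i < n.+1) \sum_(j < n.+1) K); first by rewrite !sumr_ge0// => ? _; rewrite sumr_ge0.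
move=> z; set g := gap calib z.
have g0 : 0 <= g by exact: gap_calib_ge0.
have g1 : g <= 1 by exact: gap_calib_le1.
have gg : g <= g `^ (1 - c).
  have [->|gn0] := eqVneq g 0; first exact: powR_ge0.
  by apply: ger1_powR; rewrite ?lt_def ?gn0 ?g0//=; lra.
have K1 x : x <= C * 2 -> x * g `^ (1 - c) <= K * g `^ (1 - c).
  move=> xC; rewrite ler_wpM2r ?powR_ge0// (le_trans xC)// lerDl.
  by rewrite addr_ge0// !mulr_ge0// sqr_ge0.
have K2 x : x <= (H * D + H ^+ 2 * M * D) * g -> x <= K * g `^ (1 - c).
  move=> /le_trans; apply; rewrite ler_pM//.
    by rewrite addr_ge0// !mulr_ge0// sqr_ge0.
  by rewrite lerDr mulr_ge0.
have dk1 j : `|derive1 k (z ord0 (lift ord0 j))| ^+ 2 <= D * g.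
  by rewrite real_normK ?num_real//; exact: dk_gap.
rewrite /hessq (le_trans (ler_norm_sum _ _ _))// mulr_suml ler_sum// => i _.
rewrite (le_trans (ler_norm_sum _ _ _))// mulr_suml ler_sum// => j _.
rewrite !normrM.
have mixed l : `|partial (lift ord0 l) calib z| * `|partial (lift ord0 l) (partial ord0 calib) z|
    <= (H * D + H ^+ 2 * M * D) * g.
  apply: (@le_trans _ _ (H * (D * g))).
    apply: (le_trans (ler_pM _ _ (partialS_le l z) (partial0S_le l z))) => //.
    by rewrite -mulrA -expr2 ler_wpM2l.
  by rewrite mulrA ler_wpM2r// lerDl !mulr_ge0// sqr_ge0.
case: (unliftP ord0 i) => [i'|] ->; case: (unliftP ord0 j) => [j'|] ->.
- apply: K2; apply: (@le_trans _ _ (H ^+ 2 * M * D * g)); last first.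
    by rewrite ler_wpM2r// lerDr mulr_ge0.
  apply: (@le_trans _ _ ((H * `|derive1 k (z ord0 (lift ord0 i'))|) *
      (H * `|derive1 k (z ord0 (lift ord0 j'))|) * M)).
    by apply: ler_pM => //; apply: ler_pM.
  have := dk1 i'; have := dk1 j'.
  set a := `|derive1 k (z ord0 (lift ord0 i'))|; set b := `|derive1 k (z ord0 (lift ord0 j'))|.
  move=> hb ha; have ab : a * b <= D * g by have := sqr_ge0 (a - b); nra.
  rewrite (_ : H * a * (H * b) * M = H ^+ 2 * M * (a * b)); last by ring.
  by rewrite -[leRHS]mulrA ler_wpM2l// mulr_ge0// sqr_ge0.
- apply: K2; apply: le_trans (mixed i').
  by rewrite partial_comm ler_wpM2r// ler_piMr.
- apply: K2; apply: le_trans (mixed j').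
  by rewrite ler_wpM2r// ler_piMl.
(* 1 - h'^2 is at most 4/3 of the gap, and (4/3)^(1-c) <= 2. *)
- apply: (@le_trans _ _ (C * 2 * g `^ (1 - c))); last exact: K1.
  apply: (@le_trans _ _ `|partial ord0 (partial ord0 calib) z|).
    by rewrite ler_piMl// mulr_ile1.
  rewrite partial00E normrM; have /andP[p0 p1] := P01 z; rewrite (ger0_norm p0).
  apply: (@le_trans _ _ `|derive1 (derive1 h) (z ord0 ord0)|); first by rewrite ler_piMr.
  apply: (le_trans (hC _)); rewrite -mulrA ler_wpM2l//.
  have hg : 1 - derive1 h (z ord0 ord0) ^+ 2 <= 4 / 3 * g.
    by have := gap_h z; rewrite -/g; lra.
  have hge : 0 <= 1 - derive1 h (z ord0 ord0) ^+ 2 by rewrite subr_ge0.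
  apply: (@le_trans _ _ ((4 / 3 * g) `^ (1 - c))).
    have g43 : 0 <= 4 / 3 * g by lra.
    by apply: ge0_ler_powR; rewrite ?nnegrE.
  rewrite powRM// ler_wpM2r ?powR_ge0//.
  apply: (@le_trans _ _ ((4 / 3) `^ 1)); last by rewrite powRr1//; lra.
  by apply: ler_powR; lra.
Qed.

End calibrated_function.

Section existence.
Context {R : realType}.

Lemma smf_compact_bounded m (f : 'rV[R]_m -> R) B : smf f ->
  (forall z, ~ cube m B z -> f z = 0) -> exists2 M, 0 <= M & forall z, `|f z| <= M.
Proof.
move=> sf f0; have [M M0 hM] := continuous_bounded_on (@compact_cube R m B) (smf_continuous sf).
exists M => // z; have [/hM//|/f0 ->] := pselect (cube m B z).
by rewrite normr0.
Qed.

Lemma closed_cube m (B : R) : closed (cube m B).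
Proof. by apply: compact_closed => //; exact: compact_cube. Qed.

Lemma exists_calibration n : exists (u : 'rV[R]_n.+1 -> R) (B : R),
  [/\ smf u, (forall z, ~ cube n.+1 B z -> u z = 0),
      u (axis_pt n 1) = 1 /\ u (axis_pt n (-1)) = -1,
      (forall z, 0 <= gap u z) &
      (forall z, gap u z = 0 -> exists2 t, `|t| <= 1 & z = axis_pt n t)] /\
  (forall T, exists2 c, 0 < c & forall z (j : 'I_n), cube n.+1 T z ->
    c * z ord0 (lift ord0 j) ^+ 2 <= gap u z) /\
  (forall c, 0 < c < 1 -> exists2 K, 0 <= K & forall z, `|hessq u z| <= K * gap u z `^ (1 - c)).
Proof.
have [h [eh hid [S hS] dh hpow]] := @axial_profile R.
have [H H0 hH] : exists2 M, 0 <= M & forall t : R, `|h t| <= M.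
  apply: (@bounded_of_compact_support _ _ (- S) S); first exact: elem_continuous.
  by move=> t; rewrite -ler_norml -ltNge => tS; apply: hS; exact: ltW.
(* The axial profile comes first: its bound [H] dictates how slowly the transverse profile may vary.
   The added 1 avoids a division by 0. *)
pose delta := (4 * (H ^+ 2 * n%:R + 1))^-1.
have Hn : 0 <= H ^+ 2 * n%:R by rewrite mulr_ge0// sqr_ge0.
have d0 : 0 < delta by rewrite invr_gt0; lra.
have Hd : H ^+ 2 * n%:R * delta <= 1 / 4.
  by rewrite /delta ler_pdivrMr; lra.
have [k [ek [k0 k01] [S' hS'] dk kT]] := transverse_profile d0.
pose u := calib (n := n) h k.
pose B := Num.max `|S| `|S'|.
have u0 z : ~ cube n.+1 B z -> u z = 0.
  move=> /existsNP[i /negP]; rewrite -ltNge gt_max => /andP[h1 h2].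
  rewrite /u calibE; case: (unliftP ord0 i) h1 h2 => [j|] -> h1 h2.
    rewrite (bigD1 j)//= hS' ?mul0r ?mulr0//.
    by rewrite ltW// (le_lt_trans _ h2)// ler_norm.
  by rewrite hS ?mul0r// ltW// (le_lt_trans _ h1)// ler_norm.
have su : smf u by exact: smf_calib.
have gk := gap_calib_k eh ek hH dh k01 dk (ltW d0) Hd.
exists u, B; split; [split => //|split].
- rewrite /u !calibE !axis_pt0 !hid ?normrN ?normr1//.
  rewrite !big1 ?mulr1// => j _; rewrite axis_ptS//.
- by move=> z; exact: (gap_calib_ge0 eh ek hH dh k01 dk (ltW d0) Hd).
- move=> z /(gap_calib_eq0 eh ek hH dh k01 dk (ltW d0) Hd)[z1 kz].
  exists (z ord0 ord0) => //; apply/rowP => i; case: (unliftP ord0 i) => [j|] ->.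
    (* The transverse profile equals 1 only at 0: its quadratic lower bound is taken with T =
       |z_j|. *)
    rewrite axis_ptS; have [c c0 hc] := kT `|z ord0 (lift ord0 j)|.
    have := hc _ (lexx _); rewrite kz expr1n subrr pmulr_rle0// => z0.
    by apply/eqP; rewrite -sqrf_eq0 eq_le z0 sqr_ge0.
  by rewrite axis_pt0.
- move=> T; have [c c0 hc] := kT T; exists (3 / 4 * c) => [|z j zT].
    by rewrite mulr_gt0.
  by have := hc _ (zT (lift ord0 j)); have := gk z j; rewrite -/u; lra.
- move=> c c01; have [C C0 hC] := hpow c c01.
  have hM i j : exists M, 0 <= M /\ forall z, `|partial j (partial i u) z| <= M.
    have [M M0 hM] : exists2 M, 0 <= M & forall z, `|partial j (partial i u) z| <= M.
      apply: (@smf_compact_bounded _ _ B); first by apply: partial_smf; exact: partial_smf.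
      apply: partial_supp; first exact: closed_cube.
      by apply: partial_supp => //; exact: closed_cube.
    by exists M.
  have /choice[M hM'] : forall p : 'I_n.+1 * 'I_n.+1, exists M, 0 <= M /\
      forall z, `|partial p.2 (partial p.1 u) z| <= M by move=> p; exact: hM.
  apply: (hessq_calib_le eh ek hH dh k01 dk (ltW d0) Hd c01 C0 hC (M := \sum_p M p)).
    by apply: sumr_ge0 => p _; case: (hM' p).
  move=> i j z; have [_ /(_ z) /=] := hM' (i, j); move=> /le_trans; apply.
  by rewrite (bigD1 (i, j))//= lerDl sumr_ge0// => p _; case: (hM' p).
Qed.

End existence.

(** * The domain and the competitors *)

Section euclidean_ball.
Context {R : realType}.

(** Here [r] is the square of the radius, so that the boundary is a level set of a polynomial. *)
Definition eball m (r : R) : set 'rV[R]_m := [set z | dotv z z < r].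

Lemma smf_dotv m : smf (fun z : 'rV[R]_m => dotv z z).
Proof.
apply: smf_sum => i; apply: (@smf_coord _ _ (fun t => t * t)).
by apply: elem_mul; exact: elem_id.
Qed.

Lemma dotv_ge0 m (z : 'rV[R]_m) : 0 <= dotv z z.
Proof. by apply: sumr_ge0 => i _; rewrite -expr2 sqr_ge0. Qed.

Lemma sqr_coord_le_dotv m (z : 'rV[R]_m) i : z ord0 i ^+ 2 <= dotv z z.
Proof.
by rewrite /dotv (bigD1 i)//= expr2 lerDl sumr_ge0// => j _; rewrite -expr2 sqr_ge0.
Qed.

Lemma open_eball m r : open (@eball m r).
Proof.
rewrite (_ : eball r = (fun z : 'rV[R]_m => dotv z z) @^-1` [set t | t < r]) //.
apply: open_comp; last exact: open_lt.
by move=> z _; exact: smf_continuous (@smf_dotv m) z.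
Qed.

Lemma eball_sub_cube m r : @eball m r `<=` cube m (`|r| + 1).
Proof.
move=> z zr i; have h := le_lt_trans (sqr_coord_le_dotv z i) zr.
rewrite -(@ler_pXn2r _ 2) ?nnegrE ?addr_ge0// real_normK ?num_real//.
rewrite (le_trans (ltW h))// (le_trans (ler_norm r))//.
have := normr_ge0 r; nra.
Qed.

Lemma cube_sub_eball m (B r : R) : m%:R * B ^+ 2 < r -> cube m B `<=` @eball m r.
Proof.
move=> mB z zB; apply: le_lt_trans mB.
rewrite /dotv (@le_trans _ _ (\sum_(i < m) B ^+ 2))//.
  apply: ler_sum => i _; rewrite -expr2 -real_normK ?num_real//.
  by rewrite ler_pXn2r ?nnegrE// (le_trans _ (zB i)).
by rewrite sumr_const card_ord -[leLHS]mulr_natl.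
Qed.

Lemma dotvZ m (t : R) (z : 'rV[R]_m) : dotv (t *: z) (t *: z) = t ^+ 2 * dotv z z.
Proof.
by rewrite /dotv mulr_sumr; apply: eq_bigr => i _; rewrite !mxE; ring.
Qed.

Lemma eball0 m r : 0 < r -> @eball m r 0.
Proof. by move=> r0; rewrite /eball/= /dotv big1// => i _; rewrite !mxE mulr0. Qed.

Lemma bounded_domain_eball m r : 0 < r -> bounded_domain (@eball m r).
Proof.
move=> r0; split.
- by exists 0; exact: eball0.
- exact: open_eball.
(* Connectedness: the ball is a union of segments issuing from 0. *)
- have -> : @eball m r = \bigcup_(z in @eball m r) ((fun t : R => t *: z) @` `[0, 1]).
    apply/seteqP; split => [z zr|z [y yr [t /=]]].
      by exists z => //; exists 1; rewrite ?scale1r//= in_itv/= ler01 lexx.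
    rewrite in_itv/= => /andP[t0 t1] <-; rewrite /eball/= dotvZ.
    by apply: le_lt_trans yr; rewrite ler_piMl ?dotv_ge0// expr_le1.
  apply: bigcup_connected.
    exists 0 => z _; exists 0; rewrite ?scale0r//= in_itv/= lexx ler01//.
  move=> z _; apply: connected_continuous_connected; first exact: segment_connected.
  apply: continuous_subspaceT => t; exact: scalel_continuous.
- have [M [Mr hM]] := compact_bounded (@compact_cube R m (`|r| + 1)).
  by exists M; split => // x Mx z zr; apply: (hM x Mx); exact: eball_sub_cube zr.
Qed.

Lemma partial_dotv m i (c : R) : partial i (fun z : 'rV[R]_m => dotv z z - c) =
  fun z => 2 * z ord0 i.
Proof.
apply: partial_eq => z; apply/is_derive_line.
rewrite (_ : (fun _ => _) = fun h : R =>
    (h + z ord0 i) ^+ 2 + (\sum_(j < m | j != i) z ord0 j ^+ 2 - c)); last first.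
  apply/funext => h; rewrite /dotv (bigD1 i)//= addrA; congr (_ + _ - _).
    by rewrite !mxE !eqxx/= mulr1 expr2.
  by apply: eq_bigr => j /negbTE ji; rewrite !mxE ji/= mulr0 add0r expr2.
apply: (is_derive_eq (is_derive_add (is_derive_sqr (is_derive_add (is_derive_id _ _)
  (is_derive_const _ _ _))) (is_derive_const _ _ _))).
by rewrite /=; ring.
Qed.

Lemma smooth_boundary_eball m r : 0 < r -> smooth_boundary (@eball m r).
Proof.
(* The origin is the only critical point of |z|^2 - r, and it is interior to the ball. *)
move=> r0 p [_ pi]; exists (~` [set 0]), (fun z => dotv z z - r); split.
- split; first by apply: closed_openC; apply: accessible_closed_set1; exact: hausdorff_accessible.
  move=> p0; apply: pi; rewrite p0 (interior_id _).1; first exact: eball0.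
  exact: open_eball.
- apply: smf_smooth_on; apply: smf_sub; [exact: smf_dotv|exact: smf_cst].
- move=> z z0; apply/eqP => g0; apply: z0; apply/rowP => i.
  have : grad (fun z => dotv z z - r) z ord0 i = 0 by rewrite g0 mxE.
  by rewrite mxE partial_dotv mxE => /eqP; rewrite mulf_eq0 pnatr_eq0/= => /eqP.
- by apply/seteqP; split => z [h1 h2]; split => //; move: h1; rewrite /eball/= subr_lt0.
Qed.

Lemma frontier_open m (A : set 'rV[R]_m) z : open A -> frontier A z -> ~ A z.
Proof. by move=> oA [_ h] Az; apply: h; rewrite (interior_id _).1. Qed.

End euclidean_ball.

Section regularity.
Context {R : realType}.

Lemma Lp_on_oo_bounded m (Omega : set 'rV[R]_m) (f : 'rV[R]_m -> R) (M : R) : measurable_fun Omega f ->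
  (forall z, Omega z -> `|f z| <= M) -> Lp_on Omega +oo%E f.
Proof.
move=> mf fM; split => //; rewrite /finite_norm Lnorm.unlock.
case: ifPn => _; last by rewrite ltry.
apply: (@le_lt_trans _ _ (`|M|)%:E); last by rewrite ltry.
apply/ess_supP; apply: nearW => z; rewrite /= lee_fin /patch; case: ifPn => zO.
  by rewrite (le_trans (fM z _)) ?ler_norm//; rewrite inE in zO.
by rewrite normr0.
Qed.

Lemma eball_exhaustion m r :
  @eball R m r = \bigcup_k [set z | dotv z z <= r - k.+1%:R^-1].
Proof.
apply/seteqP; split => [z zr|z [k _ /= zk]].
  have e0 : 0 < r - dotv z z by rewrite subr_gt0.
  have [k _ /(_ _ (leqnn k)) /= ke] := near_infty_natSinv_lt (PosNum e0).
  by exists k => //=; rewrite lerBrDr -lerBrDl ltW.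
by apply: le_lt_trans zk _; rewrite ltrBlDr ltrDl invr_gt0.
Qed.

Lemma compact_eball_le m (r c : R) : c < r ->
  compact [set z : 'rV[R]_m | dotv z z <= c] /\ [set z : 'rV[R]_m | dotv z z <= c] `<=` @eball R m r.
Proof.
move=> cr.
have sub : [set z : 'rV[R]_m | dotv z z <= c] `<=` @eball R m r by move=> z /= /le_lt_trans; apply.
split => //; apply: (subclosed_compact _ (@compact_cube R m (`|r| + 1))).
  rewrite (_ : [set z | _] = (fun z : 'rV[R]_m => dotv z z) @^-1` [set t | t <= c]) //.
  apply: closed_comp; last exact: closed_le.
  by move=> z _; exact: smf_continuous (@smf_dotv R m) z.
by apply: subset_trans sub _; exact: eball_sub_cube.
Qed.

Lemma compact_closure_eball m (r : R) : compact (closure (@eball R m r)).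
Proof.
have [cK _] := @compact_eball_le m (r + 1) r ltac:(by rewrite ltrDl).
have clK := compact_closed (@norm_hausdorff _ _) cK.
apply: (subclosed_compact (@closed_closure _ _) cK).
rewrite closureE; apply: smallest_sub => // z; exact: ltW.
Qed.

(** Integrability, and with it measurability, is given on compact subsets only; a countable
    exhaustion by closed balls carries measurability to the whole ball. *)
Lemma measurable_L1loc_eball m (r : R) (f : 'rV[R]_m -> R) :
  L1loc (eball r) (EFin \o f) -> measurable_fun (@eball R m r) f.
Proof.
move=> fl; rewrite eball_exhaustion; apply/measurable_fun_bigcup => k.
  by apply: measurable_compact_rV; have [] := @compact_eball_le m r (r - k.+1%:R^-1) ltac:(by rewrite gtrBl invr_gt0).
have [cK KO] := @compact_eball_le m r (r - k.+1%:R^-1) ltac:(by rewrite gtrBl invr_gt0).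
by apply/measurable_EFinP; exact: measurable_int (fl _ cK KO).
Qed.

Lemma coord_le_enorm m (z : 'rV[R]_m) i : `|z ord0 i| <= enorm z.
Proof.
by rewrite -sqrtr_sqr ler_wsqrtr// sqr_coord_le_dotv.
Qed.

Lemma enorm_sqr m (z : 'rV[R]_m) : enorm z ^+ 2 = dotv z z.
Proof. by rewrite sqr_sqrtr// dotv_ge0. Qed.

(** The form in which membership in [Y0] is used below: the coordinatewise bound on the gradient for
    the flux identity, continuity at points of the ball for [axis_increment], boundedness for the
    integrals against the source. *)
Lemma Y0_regular m (r : R) (w : 'rV[R]_m -> R) : Y0 (eball r) w ->
  [/\ weak_gradient (eball r) w (Dw (eball r) w),
      measurable_fun (eball r) w,
      exists M, forall z, @eball R m r z -> `|w z| <= M,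
      forall i, measurable_fun (eball r) (fun z => Dw (eball r) w z ord0 i) &
      {ae leb m, forall z, eball r z -> forall i : 'I_m, `|Dw (eball r) w z ord0 i| <= 1} /\
      forall z, eball r z -> {for z, continuous w}].
Proof.
move=> [[[mw _] [G [wG _]]] D1 cw _]; have wD := weak_gradient_Dw wG; split => //.
- have ci := continuous_compact cw (@compact_closure_eball m r).
  have [M [Mr hM]] := compact_bounded ci; exists (M + 1) => z zr.
  apply: (hM (M + 1)); first by rewrite ltrDl.
  by exists z => //; exact: subset_closure.
- by move=> i; apply: measurable_L1loc_eball; exact: wD.1.
- split.
    apply: filterS D1 => z D1 zr i; exact: le_trans (coord_le_enorm _ _) (D1 zr).
  have {}cw := continuous_subspaceW (@subset_closure _ (@eball R m r)) cw.
  have := cw; rewrite continuous_open_subspace; last exact: open_eball.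
  by move=> h z zr; apply: h; rewrite inE.
Qed.

End regularity.

Section lipschitz_bounds.
Context {R : realType}.

Lemma ae_eq_Rintegral m (A : set 'rV[R]_m) (f g : 'rV[R]_m -> R) :
  measurable A -> measurable_fun A f -> measurable_fun A g ->
  {ae leb m, forall z, A z -> f z = g z} ->
  \int[leb m]_(z in A) f z = \int[leb m]_(z in A) g z.
Proof.
move=> mA mf mg fg; rewrite /Rintegral; congr fine; apply: ae_eq_integral => //.
- exact/measurable_EFinP.
- exact/measurable_EFinP.
- by apply: filterS fg => z h /h ->.
Qed.

Lemma ae_le_Rintegral m (A : set 'rV[R]_m) (f g : 'rV[R]_m -> R) :
  measurable A -> (leb m).-integrable A (EFin \o f) -> (leb m).-integrable A (EFin \o g) ->
  {ae leb m, forall z, A z -> f z <= g z} ->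
  \int[leb m]_(z in A) f z <= \int[leb m]_(z in A) g z.
Proof.
move=> mA fi gi fg; rewrite -subr_ge0 -RintegralB//.
have mf : measurable_fun A f by apply/measurable_EFinP; exact: measurable_int fi.
have mg : measurable_fun A g by apply/measurable_EFinP; exact: measurable_int gi.
have mB : measurable_fun A (fun z => g z - f z) by exact: measurable_funB.
rewrite (ae_eq_Rintegral (g := fun z => `|g z - f z|) mA mB).
- by apply: Rintegral_ge0 => z _.
- exact: measurableT_comp mB.
- by apply: filterS fg => z h zA; rewrite ger0_norm// subr_ge0; exact: h.
Qed.

Lemma coord_le_norm m (z : 'rV[R]_m) i : `|z ord0 i| <= `|z|.
Proof.
rewrite [leRHS]mx_normrE.
exact: (le_bigmax _ (fun ij : 'I_1 * 'I_m => `|z ij.1 ij.2|) (ord0, i)).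
Qed.

Lemma smf_line_lipschitz m (f : 'rV[R]_m -> R) (i : 'I_m) (h : R) (z : 'rV[R]_m) : smf f ->
  (forall z, `|partial i f z| <= 1) ->
  `|f (h *: delta_mx ord0 i + z) - f z| <= `|h|.
Proof.
move=> sf f1; pose phi (t : R) := f (t *: delta_mx ord0 i + z).
have dphi (t : R) : is_derive t (1 : R) phi (partial i f (t *: delta_mx ord0 i + z)).
  have /is_derive_line h1 := smf_is_derive i (t *: delta_mx ord0 i + z) sf.
  have h2 : is_derive t (1 : R) (fun s : R => s - t) 1.
    by apply: (is_derive_eq (is_derive_sub (is_derive_id _ _) (is_derive_const _ _ _))); rewrite subr0.
  rewrite (_ : phi = fun s => f ((s - t) *: delta_mx ord0 i + (t *: delta_mx ord0 i + z))); last first.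
    by apply/funext => s; rewrite addrA -scalerDl subrK.
  rewrite -[partial i f _]mulr1.
  apply: (@is_derive_chain R _ (fun s => f (s *: delta_mx ord0 i + (t *: delta_mx ord0 i + z))) (fun s => s - t)) => //.
  by rewrite subrr.
have cphi (a b : R) : {within `[a, b], continuous phi}.
  apply: continuous_subspaceT => t; apply: differentiable_continuous; apply/derivable1_diffP.
  by have [] := dphi t.
have le (a b : R) : a <= b -> `|phi b - phi a| <= b - a.
  move=> ab; have [c _ ->] := MVT_segment ab (fun t _ => dphi t) (cphi a b).
  by rewrite normrM (ger0_norm (_ : 0 <= b - a)) ?subr_ge0// ler_piMl ?subr_ge0.
have phi0 : phi 0 = f z by rewrite /phi scale0r add0r.
have [h0|h0] := leP 0 h.
  by rewrite -/(phi h) -phi0 (ger0_norm h0) -[leRHS]subr0; exact: le.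
by rewrite -/(phi h) -phi0 distrC (ltr0_norm h0) -[leRHS]add0r; apply: le; exact: ltW.
Qed.

(** One passes from y to x by changing one coordinate at a time; each change costs at most the sup
    norm of x - y, whence the constant m. *)
Lemma smf_lipschitz m (f : 'rV[R]_m -> R) : smf f ->
  (forall i z, `|partial i f z| <= 1) -> lipschitz (f : 'rV[R]_m -> R^o).
Proof.
move=> sf f1; apply: (@klipschitzW _ _ _ m%:R).
  exact: (@globally_properfilter _ _ (0, 0)).
move=> [x y] _ /=.
(* The intermediate points: the first k coordinates come from x, the others from y. *)
pose p k : 'rV[R]_m := \row_j if (j < k)%N then x ord0 j else y ord0 j.
have h k : (k <= m)%N -> `|f (p k) - f y| <= k%:R * `|x - y|.
  elim: k => [_|k IH km].
    rewrite (_ : p 0%N = y) ?subrr ?normr0 ?mul0r//.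
    by apply/rowP => j; rewrite mxE.
  rewrite -natr1 mulrDl mul1r [leRHS]addrC -(subrKA (f (p k))) (le_trans (ler_normD _ _))//.
  apply: lerD; last by apply: IH; exact: ltnW.
  pose i := Ordinal km.
  have -> : p k.+1 = (x - y) ord0 i *: delta_mx ord0 i + p k.
    apply/rowP => j; rewrite !mxE eqxx/= eq_sym -val_eqE/= ltnS leq_eqVlt.
    case: ltngtP => [jk|kj|ik]; rewrite ?mulr0 ?add0r ?mulr1//=.
    by rewrite (_ : j = i) ?subrK//; exact/val_inj.
  apply: le_trans (coord_le_norm _ i); exact: smf_line_lipschitz.
have := h m (leqnn m); rewrite (_ : p m = x)//.
by apply/rowP => j; rewrite mxE ltn_ord.
Qed.

End lipschitz_bounds.

(** * The flux identity, minimality and failure of the weak equation *)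

Section real_dominated_convergence.
Context {R : realType} {m : nat}.

Lemma Rdominated_convergence (A : set 'rV[R]_m) (f_ : nat -> 'rV[R]_m -> R)
    (f g : 'rV[R]_m -> R) :
  measurable A -> (forall k, measurable_fun A (f_ k)) -> measurable_fun A f ->
  {ae leb m, forall z, A z -> f_ k z @[k --> \oo] --> f z} ->
  (leb m).-integrable A (EFin \o g) ->
  {ae leb m, forall z, A z -> forall k, `|f_ k z| <= g z} ->
  (leb m).-integrable A (EFin \o f) /\
  (\int[leb m]_(z in A) f_ k z @[k --> \oo] --> \int[leb m]_(z in A) f z).
Proof.
move=> mA mf_ mf cf ig fg.
have [|||||i1 _ i3] := @dominated_convergence _ _ _ (leb m) A mA
  (fun k => EFin \o f_ k) (EFin \o f) (EFin \o g).
- by move=> k; apply/measurable_EFinP.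
- exact/measurable_EFinP.
- apply: filterS cf => z cz Az; apply: cvg_EFin; last exact: cz.
  by near=> k.
- exact: ig.
- by apply: filterS fg => z gz k Az /=; rewrite lee_fin; exact: gz.
split => //; rewrite /Rintegral; apply: fine_cvg.
by rewrite fineK//; exact: integrable_fin_num i1.
Unshelve. all: by end_near. Qed.

Lemma Rintegral_sum (A : set 'rV[R]_m) (I : Type) (s : seq I) (f : I -> 'rV[R]_m -> R) :
  measurable A -> (forall i, (leb m).-integrable A (EFin \o f i)) ->
  (leb m).-integrable A (EFin \o (fun z => \sum_(i <- s) f i z)) /\
  \int[leb m]_(z in A) (\sum_(i <- s) f i z) = \sum_(i <- s) \int[leb m]_(z in A) f i z.
Proof.
move=> mA fi; elim: s => [|i s [IH1 IH2]].
  have e0 : (fun z : 'rV[R]_m => \sum_(i <- [::]) f i z) = fun=> 0.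
    by apply/funext => z; rewrite big_nil.
  rewrite e0 big_nil Rintegral_cst// mul0r; split => //.
  rewrite (_ : _ \o _ = cst 0%E); last by apply/funext.
  exact: integrable0.
have e1 : (fun z => \sum_(i <- i :: s) f i z) = fun z => f i z + \sum_(i <- s) f i z.
  by apply/funext => z; rewrite big_cons.
rewrite e1 big_cons RintegralD// IH2; split => //.
rewrite (_ : _ \o _ = (fun z => (EFin \o f i) z + (EFin \o (fun z => \sum_(i <- s) f i z)%R) z)%E).
  exact: integrableD.
by apply/funext => z; rewrite /= EFinD.
Qed.

End real_dominated_convergence.

Section energy_density.
Context {R : realType}.

(** The arithmetic of minimality, kept apart from the integrals: a and c stand for the gradient
    energies of u and of a competitor, d and b for the flux of u paired with their gradients, q and
    p for their dipole terms. *)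
Lemma lerB_swap (a b c d p q : R) : a + b <= c + d -> p <= q -> a - (q + d) <= c - (p + b).
Proof. lra. Qed.

(* The graph of the convex function v |-> 1 - sqrt (1 - |v|^2) lies above its
   tangent plane at [q]. *)
Lemma integrand_tangent m (p q : 'rV[R]_m) (g : R) : 0 < g -> dotv q q = 1 - g -> dotv p p <= 1 ->
  1 - Num.sqrt g + \sum_i q ord0 i / Num.sqrt g * p ord0 i <=
  1 - Num.sqrt (1 - dotv p p) + \sum_i q ord0 i / Num.sqrt g * q ord0 i.
Proof.
move=> g0 qg p1; have s0 : 0 < Num.sqrt g by rewrite sqrtr_gt0.
have sE : Num.sqrt g ^+ 2 = g by rewrite sqr_sqrtr// ltW.
have tE : Num.sqrt (1 - dotv p p) ^+ 2 = 1 - dotv p p by rewrite sqr_sqrtr// subr_ge0.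
have e (v : 'rV[R]_m) : \sum_i q ord0 i / Num.sqrt g * v ord0 i = dotv q v / Num.sqrt g.
  by rewrite mulr_suml; apply: eq_bigr => i _; rewrite mulrAC.
have cs : 2 * dotv q p <= dotv q q + dotv p p.
  rewrite /dotv mulr_sumr -big_split/=; apply: ler_sum => i _.
  by have := sqr_ge0 (q ord0 i - p ord0 i); nra.
rewrite 2!e; move: sE tE cs s0; rewrite qg.
set s := Num.sqrt g; set t := Num.sqrt _; set a := dotv q p; set b := dotv p p => sE tE cs s0.
(* Multiplied by s, the difference is 1 - s t - <q, p>, and [cs] makes this at least (s - t)^2 /
   2. *)
rewrite -subr_ge0 (_ : _ - _ = (1 - s * t - a + (s ^+ 2 - g)) / s).
  by apply: divr_ge0 (ltW s0); have := sqr_ge0 (s - t); nra.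
by field; rewrite gt_eqF.
Qed.

End energy_density.

(** * The regularised flux and its limit *)

Section flux.
Context {R : realType}.
Variables (n : nat) (u : 'rV[R]_n.+1 -> R) (B r : R).
Hypothesis n1 : (1 < n)%N.
Hypothesis su : smf u.
Hypothesis u0 : forall z, ~ cube n.+1 B z -> u z = 0.
Let Omega : set 'rV[R]_n.+1 := @eball R n.+1 r.
Hypothesis BO : cube n.+1 B `<=` Omega.
Hypothesis gap0 : forall z, 0 <= gap u z.
Hypothesis gapT : forall T, exists2 c, 0 < c & forall z (j : 'I_n), cube n.+1 T z ->
    c * z ord0 (lift ord0 j) ^+ 2 <= gap u z.
Hypothesis hessq_le : forall c, 0 < c < 1 ->
  exists2 K, 0 <= K & forall z, `|hessq u z| <= K * gap u z `^ (1 - c).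

Definition lap (z : 'rV[R]_n.+1) := \sum_i partial i (partial i u) z.

(** Negative powers of 0 being 0, this density takes the value 0 wherever the gap vanishes. *)
Definition rho_ac (z : 'rV[R]_n.+1) :=
  - (lap z * gap u z `^ (- (1 / 2)) + hessq u z * gap u z `^ (- (3 / 2))).

Let mO : measurable Omega. Proof. by apply: open_measurable_rV; exact: open_eball. Qed.

Lemma smf_gap : smf (gap u).
Proof.
apply: smf_sub; first exact: smf_cst.
apply: smf_sum => i; rewrite (_ : (fun _ => _) = fun z => partial i u z * partial i u z).
  by apply: smf_mul; exact: partial_smf.
by apply/funext => z; rewrite expr2.
Qed.

Lemma smf_lap : smf lap.
Proof. by apply: smf_sum => i; apply: partial_smf; exact: partial_smf. Qed.

Lemma smf_hessq : smf (hessq u).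
Proof.
apply: smf_sum => i; apply: smf_sum => j; apply: smf_mul; last by apply: partial_smf; exact: partial_smf.
by apply: smf_mul; exact: partial_smf.
Qed.

Lemma gap_le1 z : gap u z <= 1.
Proof. by rewrite gerBl sumr_ge0// => i _; rewrite sqr_ge0. Qed.

Lemma measurable_gap_powR A e : measurable_fun A (fun z => gap u z `^ e).
Proof.
by apply: (measurableT_comp (measurable_powR _)); apply: smf_measurable; exact: smf_gap.
Qed.

Lemma measurable_rho_ac A : measurable_fun A rho_ac.
Proof.
apply: measurableT_comp => //; apply: measurable_funD; apply: measurable_funM;
  (try exact: measurable_gap_powR); apply: smf_measurable.
  exact: smf_lap.
exact: smf_hessq.
Qed.

Lemma gap_powR_integrable th : 0 < th -> 2 * th < n%:R ->
  (leb n.+1).-integrable Omega (EFin \o (fun z => gap u z `^ (- th))).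
Proof.
move=> th0 thn; have [c c0 hc] := gapT (`|r| + 1).
apply: (@singular_integrable _ _ _ _ (`|r| + 1) c) => //.
- exact: eball_sub_cube.
- by apply: smf_measurable; exact: smf_gap.
- by move=> z j zr; apply: hc; exact: eball_sub_cube zr.
Qed.

(** A gap that is not positive forces a transverse coordinate to vanish, and hyperplanes are null
    sets. *)
Lemma gap_gt0_ae : {ae leb n.+1, forall z, Omega z -> 0 < gap u z}.
Proof.
have n0 : (0 < n)%N by apply: ltn_trans n1.
have := negligible_coord0 (R := R) (lift ord0 (Ordinal n0) : 'I_n.+1).
apply: negligibleS => z /= /not_implyP[zO /negP]; rewrite -leNgt => g0.
have [c c0 hc] := gapT (`|r| + 1).
have := le_trans (hc z (Ordinal n0) (@eball_sub_cube _ _ _ z zO)) g0.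
rewrite pmulr_rle0// => z0; apply/eqP; rewrite -sqrf_eq0 eq_le z0 sqr_ge0//.
Qed.

Lemma lap_le : exists2 K, 0 <= K & forall z, `|lap z| <= K.
Proof.
apply: (@smf_compact_bounded _ _ _ B); first exact: smf_lap.
move=> z nz; apply: big1 => i _.
apply: (@partial_supp _ _ (cube n.+1 B)) => //; first exact: closed_cube.
by apply: partial_supp => //; exact: closed_cube.
Qed.

(** The parameter [a] stands for N^(-1/2) and for all its regularisations alike, so that one bound
    dominates the sequence and controls its limit [rho_ac]. *)
Lemma divergence_bound c : 0 < c < 1 / 2 -> exists2 K, 0 <= K &
  forall z, 0 < gap u z -> forall a, 0 <= a <= gap u z `^ (- (1 / 2)) ->
  `|lap z * a + hessq u z * a ^+ 3| <= K * gap u z `^ (- (1 / 2 + c)).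
Proof.
move=> /andP[c0 c1]; have [K1 K10 hK1] := lap_le.
have [|K2 K20 hK2] := @hessq_le c; first by rewrite c0/=; lra.
exists (K1 + K2) => [|z g0 a /andP[a0 ha]]; first exact: addr_ge0.
have g01 : 0 < gap u z <= 1 by rewrite g0 gap_le1.
have gp0 e : 0 < gap u z `^ e by rewrite powR_gt0.
rewrite (le_trans (ler_normD _ _))// mulrDl lerD// normrM.
  rewrite ler_pM// ger0_norm// (le_trans ha)//.
  by apply: (ger_powR g01); lra.
have -> : K2 * gap u z `^ (- (1 / 2 + c)) =
    K2 * gap u z `^ (1 - c) * (gap u z `^ (- (1 / 2))) ^+ 3.
  rewrite -powR_mulrn ?powR_ge0// -powRrM -mulrA -powRD; last by rewrite (gt_eqF g0) implybT.
  by congr (_ * _ `^ _); field.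
by rewrite ler_pM// normrX ger0_norm// ler_pXn2r// nnegrE// (le_trans a0).
Qed.

Definition reg k (z : 'rV[R]_n.+1) : R := (Num.sqrt (gap u z + k.+1%:R^-1))^-1.

Lemma gap_reg_gt0 k z : 0 < gap u z + k.+1%:R^-1.
Proof. by rewrite ltr_wpDl// invr_gt0. Qed.

Lemma smf_reg k : smf (reg k).
Proof.
apply: smf_rsqrt; last exact: gap_reg_gt0.
by apply: smf_add; [exact: smf_gap|exact: smf_cst].
Qed.

Lemma partial_gap i z :
  partial i (gap u) z = - (2 * \sum_j partial j u z * partial i (partial j u) z).
Proof.
suff h : is_derive z (delta_mx ord0 i) (gap u)
  (- (2 * \sum_j partial j u z * partial i (partial j u) z)) by exact: derive_val.
have h (s : seq 'I_n.+1) : is_derive z (delta_mx ord0 i)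
    (fun z => \sum_(j <- s) partial j u z ^+ 2)
    (2 * \sum_(j <- s) partial j u z * partial i (partial j u) z).
  elim: s => [|j s IH].
    rewrite big_nil mulr0 (_ : (fun _ => _) = fun=> 0); first exact: is_derive_const.
    by apply/funext => y; rewrite big_nil.
  rewrite (_ : (fun _ => _) = fun z => partial j u z * partial j u z +
      \sum_(j <- s) partial j u z ^+ 2); last first.
    by apply/funext => y; rewrite big_cons expr2.
  have hj := smf_is_derive i z (partial_smf j su).
  apply: (is_derive_eq (is_derive_add (is_derive_mul hj hj) IH)).
  by rewrite big_cons/=; ring.
by apply: (is_derive_eq (is_derive_sub (is_derive_const _ _ _) (h _))); rewrite sub0r.
Qed.

(** The factor (N + 1/(k+1))^(-1/2) has gradient -1/2 times its cube times DN, and DN = -2 D^2u Du;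
    the two constants cancel. *)
Lemma divergence_reg k z :
  \sum_i partial i (fun z => partial i u z * reg k z) z =
  lap z * reg k z + hessq u z * reg k z ^+ 3.
Proof.
transitivity (\sum_i (partial i (partial i u) z * reg k z +
    reg k z ^+ 3 * \sum_j partial i u z * partial j u z * partial i (partial j u) z)).
  apply: eq_bigr => i _.
  have hi := smf_is_derive i z (partial_smf i su).
  have hg : is_derive z (delta_mx ord0 i) (fun z => gap u z + k.+1%:R^-1) (partial i (gap u) z).
    apply: (is_derive_eq (is_derive_add (smf_is_derive i z smf_gap) (is_derive_const _ _ _))).
    by rewrite addr0.
  have ha := @is_derive_rsqrt R _ (fun z => gap u z + k.+1%:R^-1) z _ _ (gap_reg_gt0 k z) hg.
  have h := is_derive_mul hi ha.
  suff : is_derive z (delta_mx ord0 i) (fun z => partial i u z * reg k z)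
    (partial i (partial i u) z * reg k z + reg k z ^+ 3 *
     \sum_j partial i u z * partial j u z * partial i (partial j u) z) by move=> ?; exact: derive_val.
  apply: (is_derive_eq h); rewrite -/(reg k z) partial_gap.
  have -> : \sum_j partial i u z * partial j u z * partial i (partial j u) z =
      partial i u z * \sum_j partial j u z * partial i (partial j u) z.
    by rewrite mulr_sumr; apply: eq_bigr => j _; rewrite mulrA.
  by set S := \sum_j _; field.
have hS : \sum_(i < n.+1) \sum_(j < n.+1) partial i u z * partial j u z * partial i (partial j u) z = hessq u z.
  rewrite exchange_big; apply: eq_bigr => j _; apply: eq_bigr => i _.
  by rewrite [partial i u z * _]mulrC.
by rewrite big_split -mulr_suml -mulr_sumr hS [reg k z ^+ 3 * _]mulrC.
Qed.

Lemma gap_powRN12 z : gap u z `^ (- (1 / 2)) = (Num.sqrt (gap u z))^-1.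
Proof. by rewrite powRN mul1r powR12_sqrt. Qed.

Lemma gap_powRN32 z : gap u z `^ (- (3 / 2)) = (Num.sqrt (gap u z))^-1 ^+ 3.
Proof.
rewrite -gap_powRN12 -powR_mulrn ?powR_ge0// -powRrM.
by congr (_ `^ _); field.
Qed.

Lemma reg_le k z : 0 < gap u z -> 0 <= reg k z <= gap u z `^ (- (1 / 2)).
Proof.
move=> g0; rewrite invr_ge0 sqrtr_ge0/= gap_powRN12 lef_pV2 ?posrE ?sqrtr_gt0 ?gap_reg_gt0//.
by rewrite ler_wsqrtr// lerDl invr_ge0.
Qed.

Lemma cvg_reg z : 0 < gap u z -> reg k z @[k --> \oo] --> (Num.sqrt (gap u z))^-1.
Proof.
move=> g0; apply: cvgV; first by rewrite gt_eqF// sqrtr_gt0.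
have h : gap u z + k.+1%:R^-1 @[k --> \oo] --> gap u z.
  rewrite -[X in _ --> X]addr0; apply: cvgD; first exact: cvg_cst.
  exact: cvg_harmonic.
exact: (continuous_cvg _ (@sqrt_continuous R _) h).
Qed.

Lemma partial_le1 i z : `|partial i u z| <= 1.
Proof.
rewrite -(@ler_pXn2r _ 2) ?nnegrE// expr1n real_normK ?num_real//.
have := gap0 z; rewrite /gap subr_ge0; apply: le_trans.
by rewrite (bigD1 i)//= lerDl sumr_ge0// => j _; rewrite sqr_ge0.
Qed.

(** The roles are exchanged: for fixed k the components of the regularised flux of [u] are smooth
    with compact support, so they are test functions for the weak gradient of [w], which needs no
    regularity beyond the hypotheses. Both sides then pass to the limit by dominated convergence. *)
Lemma flux_identity (w : 'rV[R]_n.+1 -> R) (G : 'rV[R]_n.+1 -> 'rV[R]_n.+1) M :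
  weak_gradient Omega w G -> measurable_fun Omega w ->
  (forall z, Omega z -> `|w z| <= M) ->
  (forall i, measurable_fun Omega (fun z => G z ord0 i)) ->
  {ae leb n.+1, forall z, Omega z -> forall i : 'I_n.+1, `|G z ord0 i| <= 1} ->
  [/\ (leb n.+1).-integrable Omega
        (EFin \o (fun z => \sum_i partial i u z / Num.sqrt (gap u z) * G z ord0 i)),
      (leb n.+1).-integrable Omega (EFin \o (fun z => rho_ac z * w z)) &
      \int[leb n.+1]_(z in Omega) (\sum_i partial i u z / Num.sqrt (gap u z) * G z ord0 i) =
      \int[leb n.+1]_(z in Omega) (rho_ac z * w z)].
Proof.
move=> [Gl GE] mw wM mG G1.
pose F k i z := partial i u z * reg k z.
have sF k i : smf (F k i) by apply: smf_mul; [exact: partial_smf|exact: smf_reg].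
have cB : compact (cube n.+1 B) by exact: compact_cube.
have clB : closed (cube n.+1 B) by exact: closed_cube.
have du0 i z : ~ cube n.+1 B z -> partial i u z = 0 by exact: partial_supp.
have F0 k i z : ~ cube n.+1 B z -> F k i z = 0 by move=> /du0; rewrite /F => ->; rewrite mul0r.
have cF k i : Cc_smooth Omega (F k i) by exact: smf_Cc_smooth (F0 k i).
have iL k i : (leb n.+1).-integrable Omega (EFin \o (fun z => w z * partial i (F k i) z)).
  rewrite (_ : _ \o _ = fun z => (partial i (F k i) z * w z)%:E); last first.
    by apply/funext => z; rewrite /= mulrC.
  apply: (integrable_mul_bounded _ _ _ wM) => //.
  apply: (@integrable_supp _ _ _ (cube n.+1 B)) => //.
  - exact: measurable_cube.
  - exact: partial_supp clB (F0 k i).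
  - apply: (@integrable_continuous_compact _ _ (cube n.+1 B) (partial i (F k i)) B); [exact: measurable_cube|by []|].
    by apply: smf_continuous; exact: partial_smf.
have iR k i : (leb n.+1).-integrable Omega (EFin \o (fun z => G z ord0 i * F k i z)).
  apply: (@integrable_supp _ _ _ (cube n.+1 B)) => //.
  - exact: measurable_cube.
  - by move=> z /F0 ->; rewrite mulr0.
  - by apply: L1loc_mul_integrable (Gl i) cB BO _; apply: smf_continuous.
have eqk k : \int[leb n.+1]_(z in Omega) (w z * (lap z * reg k z + hessq u z * reg k z ^+ 3)) =
    - \int[leb n.+1]_(z in Omega) (\sum_i G z ord0 i * F k i z).
  have [_ ->] := Rintegral_sum (index_enum 'I_n.+1) mO (iR k).
  transitivity (\int[leb n.+1]_(z in Omega) (\sum_i w z * partial i (F k i) z)).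
    by apply: eq_Rintegral => z _; rewrite -mulr_sumr divergence_reg.
  have [_ ->] := Rintegral_sum (index_enum 'I_n.+1) mO (iL k).
  by rewrite -sumrN; apply: eq_bigr => i _; exact: GE.
have mr k A : measurable_fun A (reg k) by apply: smf_measurable; exact: smf_reg.
have msq A : measurable_fun A (fun z => (Num.sqrt (gap u z))^-1).
  rewrite (_ : (fun _ => _) = fun z => gap u z `^ (- (1 / 2))); first exact: measurable_gap_powR.
  by apply/funext => z; rewrite gap_powRN12.
have n2 : 2 <= n%:R :> R by rewrite ler_nat.
(* With c = 1/4 the majorant is a multiple of N^(-3/4), integrable since 2 (3/4) < 2 <= n; here m >=
   3 is used. *)
have [K K0 hK] := @divergence_bound (1 / 4) ltac:(apply/andP; split; lra).
have [|||||| iA cA] := @Rdominated_convergence R n.+1 Omega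
  (fun k z => w z * (lap z * reg k z + hessq u z * reg k z ^+ 3))
  (fun z => - (rho_ac z * w z)) (fun z => `|M| * K * gap u z `^ (- (3 / 4))).
- exact: mO.
- move=> k; apply: measurable_funM => //; apply: smf_measurable; apply: smf_add.
    by apply: smf_mul; [exact: smf_lap|exact: smf_reg].
  apply: smf_mul; first exact: smf_hessq.
  rewrite (_ : (fun _ => _) = fun z => reg k z * (reg k z * reg k z)).
    by apply: smf_mul; [exact: smf_reg|apply: smf_mul; exact: smf_reg].
  by apply/funext => z; rewrite !exprS expr0 mulr1.
- apply: measurableT_comp => //; apply: measurable_funM => //; exact: measurable_rho_ac.
- apply: filterS gap_gt0_ae => z gz /gz g0.
  have -> : - (rho_ac z * w z) = w z * (lap z * (Num.sqrt (gap u z))^-1 +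
      hessq u z * (Num.sqrt (gap u z))^-1 ^+ 3).
    by rewrite /rho_ac gap_powRN12 gap_powRN32; ring.
  apply: cvgMr; apply: cvgD; apply: cvgMr; first exact: cvg_reg.
  exact: (continuous_cvg _ (@exprn_continuous _ 3 _) (cvg_reg g0)).
- rewrite (_ : _ \o _ = fun z => ((`|M| * K)%:E * (EFin \o (fun z => gap u z `^ (- (3 / 4)))%R) z)%E).
    apply: integrableZl => //; apply: gap_powR_integrable; first by [].
    by apply: lt_le_trans n2; lra.
  by apply/funext => z; rewrite /= EFinM.
- apply: filterS gap_gt0_ae => z gz zO k; have g0 := gz zO.
  rewrite normrM -mulrA ler_pM//; first by rewrite (le_trans (wM _ zO))// ler_norm.
  have := hK z g0 _ (reg_le k g0).
  by rewrite (_ : 1 / 2 + 1 / 4 = 3 / 4 :> R)//; field.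
have [|||||| iC cC] := @Rdominated_convergence R n.+1 Omega
  (fun k z => \sum_i G z ord0 i * F k i z)
  (fun z => \sum_i partial i u z / Num.sqrt (gap u z) * G z ord0 i)
  (fun z => n.+1%:R * gap u z `^ (- (1 / 2))).
- exact: mO.
- move=> k; apply: measurable_sum => i; apply: measurable_funM => //.
  exact: smf_measurable.
- apply: measurable_sum => i; apply: measurable_funM => //.
  apply: measurable_funM => //; apply: smf_measurable; exact: partial_smf.
- apply: filterS gap_gt0_ae => z gz /gz g0.
  apply: cvg_big; first exact: add_continuous.
  move=> i _; rewrite [X in _ --> X]mulrC; apply: cvgMr; apply: cvgMr; exact: cvg_reg.
- rewrite (_ : _ \o _ = fun z => ((n.+1%:R)%:E * (EFin \o (fun z => gap u z `^ (- (1 / 2)))%R) z)%E).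
    apply: integrableZl => //; apply: gap_powR_integrable; first by [].
    by apply: lt_le_trans n2; lra.
  by apply/funext => z; rewrite /= EFinM.
- apply: filterS2 gap_gt0_ae G1 => z gz g1 zO k; have g0 := gz zO.
  rewrite (le_trans (ler_norm_sum _ _ _))//.
  rewrite (@le_trans _ _ (\sum_(i < n.+1) gap u z `^ (- (1 / 2))))//.
    apply: ler_sum => i _; have /andP[r0 r1] := reg_le k g0.
    rewrite 2!normrM (ger0_norm r0).
    rewrite -[leRHS]mul1r ler_pM// ?mulr_ge0//; first exact: g1.
    by rewrite -[leRHS]mul1r ler_pM// partial_le1.
  by rewrite sumr_const card_ord -[leLHS]mulr_natl.
split => //.
  rewrite (_ : _ \o _ = (\- (EFin \o (fun z => - (rho_ac z * w z))%R))%E); first exact: integrableN.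
  by apply/funext => z; rewrite /= opprK.
have cC' := cvgN cC.
have e1 : (fun k => \int[leb n.+1]_(z in Omega) (w z * (lap z * reg k z + hessq u z * reg k z ^+ 3))) =
    (\- (fun k => \int[leb n.+1]_(z in Omega) (\sum_i G z ord0 i * F k i z))).
  by apply/funext => k; exact: eqk.
rewrite e1 in cA; have e2 := @cvg_unique _ (@norm_hausdorff _ _) _ _ _ _ cA (cC' _).
apply: oppr_inj; rewrite -e2.
rewrite -[RHS]mulN1r -RintegralZl//; first by apply: eq_Rintegral => z _; rewrite mulN1r.
by rewrite (_ : _ \o _ = (\- (EFin \o (fun z => - (rho_ac z * w z))%R))%E);
  [exact: integrableN|apply/funext => z; rewrite /= opprK].
Qed.

Lemma rho_ac_le c : 0 < c < 1 / 2 -> exists2 K, 0 <= K &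
  forall z, `|rho_ac z| <= K * gap u z `^ (- (1 / 2 + c)).
Proof.
move=> c01; have [K K0 hK] := divergence_bound c01; exists K => // z.
have [g0|] := ltP 0 (gap u z).
  rewrite normrN gap_powRN32 -gap_powRN12; apply: hK => //.
  by rewrite powR_ge0 lexx.
(* On the segment both sides are 0, again because negative powers of 0 are 0. *)
rewrite le_eqVlt ltNge gap0 orbF => /eqP g0.
have /andP[c0 c1] := c01.
rewrite /rho_ac g0 !powR0; last first.
- by rewrite oppr_eq0 gt_eqF.
- by rewrite oppr_eq0 gt_eqF// divr_gt0.
- by rewrite oppr_eq0 gt_eqF// addr_gt0// divr_gt0.
by rewrite !mulr0 addr0 oppr0 normr0.
Qed.

Lemma rho_ac_integrable : (leb n.+1).-integrable setT (EFin \o (rho_ac \_ Omega)).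
Proof.
have [K K0 hK] := @rho_ac_le (1 / 4) ltac:(apply/andP; split; lra).
have h : (leb n.+1).-integrable Omega (EFin \o rho_ac).
  apply: (@le_integrable _ _ _ _ _ mO _ (fun z => (K%:E * (gap u z `^ (- (1 / 2 + 1 / 4)))%:E)%E)).
  - by apply/measurable_EFinP; exact: measurable_rho_ac.
  - move=> z _; rewrite /= lee_fin (le_trans (hK z))//.
    by rewrite ler_norm.
  apply: integrableZl => //; apply: gap_powR_integrable; first lra.
  have n2 : 2 <= n%:R :> R by rewrite ler_nat.
  by apply: lt_le_trans n2; lra.
move/(integrable_mkcond _ mO).1: h; congr (_.-integrable _ _).
by apply/funext => z; rewrite /patch /=; case: (z \in Omega).
Qed.

Lemma rho_ac_Lp q : 1 <= q < n%:R -> Lp_on Omega q%:E rho_ac.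
Proof.
move=> /andP[q1 qn]; split; first exact: measurable_rho_ac.
have q0 : 0 < q by apply: lt_le_trans q1.
have nq0 : 0 < (n%:R - q) / (4 * q) by rewrite divr_gt0 ?subr_gt0// mulr_gt0.
(* The q-th power of the bound has exponent q (1/2 + c), and twice this is q + 2 q c <= (n + q)/2 <
   n. *)
pose c := Num.min (1 / 4) ((n%:R - q) / (4 * q)).
have c0 : 0 < c by rewrite lt_min nq0 andbT; lra.
have c1 : c <= 1 / 4 by rewrite ge_min lexx.
have c2 : q * c <= (n%:R - q) / 4.
  rewrite mulrC -ler_pdivlMr// (_ : _ / 4 / q = (n%:R - q) / (4 * q)).
    by rewrite ge_min lexx orbT.
  by field; rewrite gt_eqF.
have [|K K0 hK] := @rho_ac_le c; first by rewrite c0/=; lra.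
rewrite /finite_norm unlock; apply: poweR_lty.
apply: (@le_lt_trans _ _ (\int[leb n.+1]_(z in Omega)
    ((K `^ q)%:E * (gap u z `^ (- (q * (1 / 2 + c))))%:E))%E).
  rewrite [leRHS]integral_mkcond; apply: ge0_le_integral => //.
  - by move=> z _; exact: poweR_ge0.
  - have m1 : measurable_fun setT (fun z => ((`|(rho_ac \_ Omega) z| `^ q)%R)%:E).
      apply/measurable_EFinP; apply: (measurableT_comp (measurable_powR _)).
      apply: measurableT_comp => //.
      by apply/(measurable_restrict _ mO measurableT); rewrite setTI; exact: measurable_rho_ac.
    exact: m1.
  - apply/(measurable_restrict _ mO measurableT); rewrite setTI.
    by apply: emeasurable_funM => //; apply/measurable_EFinP; exact: measurable_gap_powR.
  - move=> z _; rewrite /patch; case: ifPn => zO; last first.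
      by rewrite /= (negbTE zO) (_ : point = 0 :> R)// normr0 powR0// gt_eqF.
    rewrite /= zO lee_fin -mulrN [q * _]mulrC powRrM -powRM ?powR_ge0//.
    apply: ge0_ler_powR; [exact: ltW|by rewrite nnegrE|by rewrite nnegrE mulr_ge0 ?powR_ge0|].
    exact: hK.
have ig := @gap_powR_integrable (q * (1 / 2 + c)).
have {}ig : (leb n.+1).-integrable Omega (fun z => ((K `^ q)%:E * (gap u z `^ (- (q * (1 / 2 + c))))%:E)%E).
  apply: integrableZl => //; apply: ig; first by rewrite mulr_gt0// addr_gt0// divr_gt0.
  by rewrite mulrDr; lra.
have /integrableP[_] := ig; apply: le_lt_trans; apply: ge0_le_integral => //.
- by move=> z _; rewrite mule_ge0// lee_fin powR_ge0.
- by apply: measurable_int ig.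
- by apply: measurableT_comp => //; apply: measurable_int ig.
- by move=> z _; exact: lee_abs.
Qed.

Lemma dotv_grad z : dotv (grad u z) (grad u z) = 1 - gap u z.
Proof.
rewrite /gap opprB addrC subrK; apply: eq_bigr => i _.
by rewrite mxE expr2.
Qed.

Lemma Cc_smooth_calibration : Cc_smooth Omega u.
Proof. exact: smf_Cc_smooth su (@compact_cube R _ B) BO u0. Qed.

Lemma Y0_calibration : Y0 Omega u.
Proof.
have [M _ hM] := smf_compact_bounded su u0.
have mu : measurable_fun Omega u by exact: smf_measurable.
have oO : open Omega by exact: open_eball.
split.
- split; first by apply: (Lp_on_oo_bounded mu) => z _; exact: hM.
  exists (grad u); split; first exact: weak_gradient_smf.
  move=> i; rewrite (_ : (fun z => _) = partial i u); last by apply/funext => z; rewrite mxE.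
  apply: (@Lp_on_oo_bounded _ _ _ _ 1); first by apply: smf_measurable; exact: partial_smf.
  by move=> z _; exact: partial_le1.
- apply: filterS (Dw_smf oO su) => z h /h ->.
  by rewrite /enorm dotv_grad -[leRHS]sqrtr1 ler_wsqrtr// gerBl.
- by apply: continuous_subspaceT; exact: smf_continuous.
- by move=> z /(frontier_open oO) nz; apply: u0; move=> /BO.
Qed.

Lemma energy_integrable (w : 'rV[R]_n.+1 -> R) : Y0 Omega w ->
  (leb n.+1).-integrable Omega (EFin \o (fun z => 1 - Num.sqrt (1 - enorm (Dw Omega w z) ^+ 2))).
Proof.
move=> Yw; have [_ _ _ mG _] := Y0_regular Yw.
apply: (@integrable_bounded _ _ _ _ (`|r| + 1) 1) => //; first exact: eball_sub_cube.
  apply: measurable_funB => //; apply: (measurableT_comp (continuous_measurable_fun (@sqrt_continuous R))).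
  apply: measurable_funB => //.
  rewrite (_ : (fun z => _) = fun z => \sum_i Dw Omega w z ord0 i * Dw Omega w z ord0 i); last first.
    by apply/funext => z; rewrite enorm_sqr.
  by apply: measurable_sum => i; exact: measurable_funM.
(* The root of a negative number is 0, so the integrand lies in [0, 1] even on the null set where
   |Dw| may exceed 1. *)
move=> z _; set s := Num.sqrt _.
have s0 : 0 <= s by exact: sqrtr_ge0.
have s1 : s <= 1 by rewrite -sqrtr1 ler_wsqrtr// gerBl sqr_ge0.
by rewrite ger0_norm ?subr_ge0// gerBl.
Qed.

Lemma flux_identity_Y0 (w : 'rV[R]_n.+1 -> R) : Y0 Omega w ->
  [/\ (leb n.+1).-integrable Omega (EFin \o (fun z =>
        \sum_i grad u z ord0 i / Num.sqrt (gap u z) * Dw Omega w z ord0 i)),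
      (leb n.+1).-integrable Omega (EFin \o (fun z => rho_ac z * w z)) &
      \int[leb n.+1]_(z in Omega)
        (\sum_i grad u z ord0 i / Num.sqrt (gap u z) * Dw Omega w z ord0 i) =
      \int[leb n.+1]_(z in Omega) (rho_ac z * w z)].
Proof.
move=> /Y0_regular[wG mw [M wM] mG [G1 _]].
have := flux_identity wG mw wM mG G1.
rewrite (_ : (fun z => \sum_i partial i u z / _ * _) = fun z =>
  \sum_i grad u z ord0 i / Num.sqrt (gap u z) * Dw Omega w z ord0 i) => [//|].
by apply/funext => z; apply: eq_bigr => i _; rewrite mxE.
Qed.

Lemma Dw_calibration : {ae leb n.+1, forall z, Omega z -> Dw Omega u z = grad u z}.
Proof. by apply: Dw_smf => //; exact: open_eball. Qed.

Section dipole.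
Variables (alpha : R) (intAC : (leb n.+1).-integrable setT (EFin \o (rho_ac \_ Omega))).
Hypothesis alpha0 : 0 < alpha.
Hypotheses (ux : u (axis_pt n 1) = 1) (uy : u (axis_pt n (-1)) = -1).
Hypothesis slabO : @slab R n (-1) 1 1 `<=` Omega.
Let source := dipole_source alpha (axis_pt n (-1)) (axis_pt n 1) intAC.

Let axisO (t : R) : -1 <= t <= 1 -> Omega (axis_pt n t).
Proof.
move=> /andP[t1 t2]; apply: slabO; split => [|j]; last by rewrite axis_ptS lexx ler01.
by rewrite axis_pt0 t1/= (le_trans t2)// lerDl.
Qed.

Let Ox : Omega (axis_pt n (-1)). Proof. by apply: axisO; rewrite lexx/=; lra. Qed.
Let Oy : Omega (axis_pt n 1). Proof. by apply: axisO; rewrite lexx andbT; lra. Qed.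

Lemma charge_integral_Y0 (w : 'rV[R]_n.+1 -> R) : Y0 Omega w ->
  charge_integral Omega source w = alpha * (w (axis_pt n 1) - w (axis_pt n (-1))) +
    \int[leb n.+1]_(z in Omega) (rho_ac z * w z).
Proof.
move=> /Y0_regular[_ mw [M wM] _ _].
by apply: charge_integral_dipole mw wM; rewrite ?ltW.
Qed.

Lemma calibration_minimizer : BI_minimizer Omega source u.
Proof.
split; first exact: Y0_calibration.
move=> w Yw; rewrite /BI_energy !charge_integral_Y0//; last exact: Y0_calibration.
have Yu := Y0_calibration.
(* The absolutely continuous part of the source is replaced by the flux of [u] paired with the
   gradients of w and u, the form in which convexity can be applied. *)
have [iSw _ <-] := flux_identity_Y0 Yw; have [iSu _ <-] := flux_identity_Y0 Yu.
have iLw := energy_integrable Yw; have iLu := energy_integrable Yu.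
have [wG mw _ _ [G1 cw]] := Y0_regular Yw.
have inc : w (axis_pt n 1) - w (axis_pt n (-1)) <= 2.
  have := @axis_increment R n Omega w (Dw Omega w) (-1) 1 1.
  rewrite opprK; apply => //.
  - exact: open_eball.
  - by apply: filterS G1 => z h /h /(_ ord0).
  - exact: cw.
  - exact: cw.
(* The integrated tangent inequality. It holds at almost every point, namely where the gap is
   positive, [Dw] of u is the classical gradient and |Dw| <= 1 for the competitor. *)
have key := @ae_le_Rintegral R n.+1 Omega _ _ mO (integrableD mO iLu iSw) (integrableD mO iLw iSu).
rewrite (RintegralD mO iLu iSw) (RintegralD mO iLw iSu) in key.
have {}key := key ltac:(
  have [_ Dw1 _ _] := Yw;
  apply: filterS3 Dw_calibration Dw1 gap_gt0_ae => z h1 h2 h3 zO;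
  rewrite (h1 zO) 2!enorm_sqr dotv_grad subKr;
  apply: integrand_tangent; [exact: h3|exact: dotv_grad|];
  by rewrite -enorm_sqr expr_le1 ?sqrtr_ge0//; exact: h2).
have inc' : alpha * (w (axis_pt n 1) - w (axis_pt n (-1))) <= alpha * (1 - -1).
  by rewrite ler_pM2l// opprK.
rewrite ux uy; exact: lerB_swap key inc'.
Qed.

Lemma calibration_not_weak_solution : ~ BI_weak_solution Omega source u.
Proof.
move=> [Yu _ W].
have lu : lipschitz (u : 'rV[R]_n.+1 -> R^o).
  by apply: smf_lipschitz => // i z; exact: partial_le1.
have := W u lu Cc_smooth_calibration.2.
rewrite charge_integral_Y0//; have [iSu _ <-] := flux_identity_Y0 Yu.
have [_ _ _ mG _] := Y0_regular Yu.
rewrite ux uy opprK (ae_eq_Rintegral (g := fun z => 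
   \sum_i grad u z ord0 i / Num.sqrt (gap u z) * Dw Omega u z ord0 i)) //; first last.
- apply: filterS Dw_calibration => z h /h ->.
  rewrite enorm_sqr {2}dotv_grad subKr mulr_suml.
  by apply: eq_bigr => i _; rewrite mulrAC.
- by apply/measurable_EFinP; exact: measurable_int iSu.
- have md (v : 'rV[R]_n.+1 -> 'rV[R]_n.+1) : (forall i, measurable_fun Omega (fun z => v z ord0 i)) ->
      measurable_fun Omega (fun z => dotv (v z) (v z)).
    by move=> mv; apply: measurable_sum => i; exact: measurable_funM.
  (* Written as a power, the inverse root is visibly measurable. Nonpositive radicands agree as
     well: their root is 0, its inverse is 0, and so is the negative power of 0. *)
  have -> : (fun z => dotv (Dw Omega u z) (Dw Omega u z) /
      Num.sqrt (1 - enorm (Dw Omega u z) ^+ 2)) = fun z => dotv (Dw Omega u z) (Dw Omega u z) *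
      Num.max (1 - dotv (Dw Omega u z) (Dw Omega u z)) 0 `^ (- (1 / 2)).
    apply/funext => z; rewrite enorm_sqr; congr (_ * _).
    rewrite powRN mul1r powR12_sqrt ?le_max ?lexx ?orbT//; congr _^-1.
    by case: leP => // /ler0_sqrtr ->; rewrite sqrtr0.
  apply: measurable_funM; first exact: md.
  apply: (measurableT_comp (measurable_powR _)); apply: measurable_maxr => //.
  by apply: measurable_funB => //; exact: md.
by move/eqP; rewrite -[X in X == _]add0r (inj_eq (addIr _)) eq_sym mulf_eq0 (gt_eqF alpha0) (pnatr_eq0 R 2).
Qed.

End dipole.

End flux.

Theorem corollary1p10 (R : realType) (m : nat) (hm : (3 <= m)%N) :
  exists (Omega : set 'rV[R]_m) (u : 'rV[R]_m -> R) (x y : 'rV[R]_m)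
         (rhoAC : 'rV[R]_m -> R)
         (intAC : (leb m).-integrable setT (EFin \o (rhoAC \_ Omega))),
    [/\ bounded_domain Omega /\ smooth_boundary Omega,
        Cc_smooth Omega u /\ Y0 Omega u,
        [/\ Omega x, Omega y & x <> y] &
        forall q : R, 1 <= q < m%:R - 1 -> Lp_on Omega q%:E rhoAC]
    /\ [/\ light_segment u x y,
           forall z, Omega z -> ~ segment x y z -> enorm (grad u z) < 1 &
           forall alpha : R, 0 < alpha ->
             BI_minimizer Omega (dipole_source alpha x y intAC) u /\
             ~ BI_weak_solution Omega (dipole_source alpha x y intAC) u].
Proof.
case: m hm => // n n1.
have [u [B [[su u0 [ux uy] gap0 gap_eq0] [gapT hessq_le]]]] := @exists_calibration R n.
(* The cube of half-side [B] contains the support of u; half-side 3 is ample for the slab [-1, 2] x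
   [0, 1]^n around the segment; the added 1 makes the inclusion in the open ball strict. *)
pose r : R := n.+1%:R * Num.max B 3 ^+ 2 + 1.
have cubeO : cube n.+1 (Num.max B 3) `<=` @eball R n.+1 r.
  by apply: cube_sub_eball; rewrite ltrDl.
have BO : cube n.+1 B `<=` @eball R n.+1 r.
  by move=> z zB; apply: cubeO => i; rewrite le_max zB.
have slabO : @slab R n (-1) 1 1 `<=` @eball R n.+1 r.
  move=> z [/andP[h1 h2] h3]; apply: cubeO => i; rewrite le_max; apply/orP; right.
  case: (unliftP ord0 i) => [j|] ->; first by have /andP[a b] := h3 j; rewrite ger0_norm//; lra.
  by rewrite ler_norml; apply/andP; split; lra.
have r0 : 0 < r by rewrite ltr_wpDl// mulr_ge0// sqr_ge0.
have axisO (t : R) : -1 <= t <= 1 -> @eball R n.+1 r (axis_pt n t).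
  move=> /andP[t1 t2]; apply: slabO; split => [|j]; last by rewrite axis_ptS lexx ler01.
  by rewrite axis_pt0 t1/= (le_trans t2)// lerDl.
have xy : axis_pt n (-1) <> axis_pt n 1 :> 'rV[R]_n.+1.
  by move=> /(congr1 (fun z : 'rV[R]_n.+1 => z ord0 ord0)); rewrite 2!axis_pt0; lra.
exists (eball r), u, (axis_pt n (-1)), (axis_pt n 1), (rho_ac u).
exists (rho_ac_integrable r n1 su u0 gap0 gapT hessq_le); split; split.
- by split; [exact: bounded_domain_eball|exact: smooth_boundary_eball].
- by split; [exact: Cc_smooth_calibration su u0 BO|exact: Y0_calibration su u0 BO gap0].
- by split => //; apply: axisO; apply/andP; split; lra.
- move=> q hq; apply: (rho_ac_Lp r su u0 gap0 gapT hessq_le).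
  by move: hq; rewrite -[n.+1%:R]natr1 addrK.
- split => //; rewrite ux uy /enorm (_ : axis_pt n (-1) - axis_pt n 1 = axis_pt n (-2)).
    rewrite dotvZ (_ : dotv (delta_mx ord0 ord0 : 'rV[R]_n.+1) _ = 1).
      by rewrite mulr1 sqrtr_sqr; congr `|_|; lra.
    rewrite /dotv big_ord_recl !mxE eqxx/= big1 => [|j _]; last by rewrite !mxE/= mulr0.
    by rewrite mulr1 addr0.
  by rewrite /axis_pt -scalerBl; congr (_ *: _); lra.
- move=> z _ nz; rewrite -[ltRHS]sqrtr1 ltr_sqrt// dotv_grad gtrBl lt_def gap0 andbT.
  (* The end points have first coordinates -1 and 1, so the point at abscissa t has parameter (1 +
     t)/2. *)
  apply/eqP => /gap_eq0[t t1 zt]; apply: nz; exists ((1 + t) / 2).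
    by move: t1; rewrite ler_norml => /andP[a b]; apply/andP; split; lra.
  by rewrite zt /axis_pt 2!scalerA -scalerDl; congr (_ *: _); lra.
- move=> alpha alpha0; split.
    exact: (calibration_minimizer n1 su u0 BO gap0 gapT hessq_le _ alpha0 ux uy slabO).
  exact: (calibration_not_weak_solution n1 su u0 BO gap0 gapT hessq_le alpha0 ux uy slabO).
Qed.
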